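(* Let $h\in(0,1)$, let $(\xi_{j,k})_{(j,k)\in\mathbb{N}\times\mathbb{Z}}$ be independent $\mathcal{N}(0,1)$ random variables and let $$f_h=\sum_{j\in\mathbb{N}}\sum_{k\in\mathbb{Z}}\xi_{j,k}2^{-hj}\psi(2^j\cdot-k),$$ where $\psi$ is a wavelet as described in the context. Almost surely, the following holds for every non-empty open interval $I$ of $\mathbb{R}$: (1) For almost every $t\in I$ (with respect to Lebesgue measure), called ordinary points, $$\limsup_{s\to t}\frac{|f_h(s)-f_h(t)|}{\omega_o^{(h)}(|s-t|)}<+\infty,$$ and for every modulus of continuity $\omega$ with $\omega=o(\omega_o^{(h)})$ one has $$\limsup_{s\to t}\frac{|f_h(s)-f_h(t)|}{\omega(|s-t|)}=+\infty.$$ (2) There exists $t\in I$, called a rapid point, such that $$\limsup_{s\to t}\frac{|f_h(s)-f_h(t)|}{\omega_r^{(h)}(|s-t|)}<+\infty,$$ and for every modulus of continuity $\omega$ with $\omega=o(\omega_r^{(h)})$ one has $$\limsup_{s\to t}\frac{|f_h(s)-f_h(t)|}{\omega(|s-t|)}=+\infty.$$ (3) There exists $t\in I$, called a slow point, such that $$\limsup_{s\to t}\frac{|f_h(s)-f_h(t)|}{\omega_s^{(h)}(|s-t|)}<+\infty,$$ and for every modulus of continuity $\omega$ with $\omega=o(\omega_s^{(h)})$ one has $$\limsup_{s\to t}\frac{|f_h(s)-f_h(t)|}{\omega(|s-t|)}=+\infty.$$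
   Context: $\mathbb{N}=\{0,1,2,\dots\}$. Wavelets: $\psi,\widetilde\psi:\mathbb{R}\to\mathbb{R}$ generate a pair of biorthogonal wavelet bases of $L^2(\mathbb{R})$, i.e. $\{2^{j/2}\psi(2^j\cdot-k)\}_{j,k\in\mathbb{Z}}$ and $\{2^{j/2}\widetilde\psi(2^j\cdot-k)\}_{j,k\in\mathbb{Z}}$ are Riesz bases of $L^2(\mathbb{R})$ and $2^{j/2}2^{j'/2}\int_{\mathbb{R}}\psi(2^jx-k)\widetilde\psi(2^{j'}x-k')\,dx=\delta_{j,j'}\delta_{k,k'}$. The orthonormal case $\widetilde\psi=\psi$ (e.g. Lemarié–Meyer or Daubechies wavelets) is included. Either both $\psi,\widetilde\psi$ belong to the Schwartz class, or both are compactly supported; moreover $\psi$ is continuously differentiable and $\int\psi=\int\widetilde\psi=0$. Almost surely the series defining $f_h$ converges uniformly on every compact subset of $\mathbb{R}$ (sum over $k$ first, then over $j$), and $f_h$ denotes its sum. A modulus of continuity is an increasing function $\omega:[0,\infty)\to[0,\infty)$ (in particular $\omega(x)>0$ for $x>0$) with $\omega(0)=0$ for which there is $C>0$ such that $\omega(2x)\le C\omega(x)$ for all $x\ge0$. For $x$ near $0$: $\omega_r^{(h)}(x)=|x|^h\sqrt{\log|x|^{-1}}$, $\omega_o^{(h)}(x)=|x|^h\sqrt{\log\log|x|^{-1}}$, $\omega_s^{(h)}(x)=|x|^h$. The notation $\omega=o(\omega')$ means $\omega(x)/\omega'(x)\to0$ as $x\to0^+$. *)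

(* Defs.v *)
From HB Require Import structures.
From mathcomp Require Import all_boot all_order all_algebra.
From mathcomp Require Import all_classical all_reals all_analysis.

Set Implicit Arguments.
Unset Strict Implicit.
Unset Printing Implicit Defensive.

Import Order.TTheory GRing.Theory Num.Theory.
Import numFieldNormedType.Exports.

Local Open Scope classical_set_scope.
Local Open Scope ring_scope.

Definition schwartz {R : realType} (f : R -> R) : Prop :=
  (forall (n : nat) (x : R), derivable (derive1n n f) x 1) /\
  (forall m n : nat, exists C : R, forall x : R, `|x ^+ m * derive1n n f x| <= C).

Definition compactly_supported {R : realType} (f : R -> R) : Prop :=
  compact (closure [set x | f x != 0]).

Definition lincomb {R : realType} (I : Type) (e : I -> R -> R)
    (s : seq I) (c : I -> R) (x : R) : R :=
  \sum_(i <- s) c i * e i x.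

(* Riesz basis of the real space L^2(R): a complete family satisfying the
   two-sided l^2 inequality on finite linear combinations. The lists [s] are
   duplicate-free so that [c] is really the coefficient sequence. *)
Definition riesz_basis {R : realType} (I : choiceType) (e : I -> R -> R)
    : Prop :=
  [/\ forall i, e i \in Lfun lebesgue_measure 2%:E,
      forall g : R -> R, g \in Lfun lebesgue_measure 2%:E ->
        forall eps : R, 0 < eps -> exists (s : seq I) (c : I -> R),
          ('N[lebesgue_measure]_2%:E[EFin \o (g \- lincomb e s c)%R]
             < eps%:E)%E
    & exists A B : R, [/\ 0 < A, 0 < B &
        forall (s : seq I) (c : I -> R), uniq s ->
          ((A * \sum_(i <- s) c i ^+ 2)%:E
             <= 'N[lebesgue_measure]_2%:E[EFin \o lincomb e s c] ^+ 2)%E /\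
          ('N[lebesgue_measure]_2%:E[EFin \o lincomb e s c] ^+ 2
             <= (B * \sum_(i <- s) c i ^+ 2)%:E)%E]].

Definition wavelet_atom {R : realType} (psi : R -> R) (jk : int * int) (x : R)
    : R :=
  2 `^ (jk.1%:~R / 2) * psi (2 ^ jk.1 * x - jk.2%:~R).

Record biorthogonal_wavelets {R : realType} (psi psit : R -> R) : Prop := {
  wavelets_riesz : riesz_basis (wavelet_atom psi);
  wavelets_dual_riesz : riesz_basis (wavelet_atom psit);
  wavelets_biorthogonal : forall jk jk' : int * int,
    (\int[lebesgue_measure]_x (wavelet_atom psi jk x
       * wavelet_atom psit jk' x)%:E)%E = ((jk == jk')%:R)%:E;
  wavelets_localized : (schwartz psi /\ schwartz psit) \/
    (compactly_supported psi /\ compactly_supported psit);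
  wavelets_derivable : forall x : R, derivable psi x 1;
  wavelets_C1 : continuous (derive1 psi);
  wavelets_mean0 : (\int[lebesgue_measure]_x (psi x)%:E)%E = 0%:E;
  wavelets_dual_mean0 : (\int[lebesgue_measure]_x (psit x)%:E)%E = 0%:E }.

(* Mutual independence: product rule over every finite subfamily. *)
Definition independent_RVs {R : realType} (d : measure_display)
    (T : measurableType d) (P : probability T R) (I : choiceType)
    (X : I -> {RV P >-> R}) : Prop :=
  forall (s : seq I) (B : I -> set R), uniq s ->
    (forall i, measurable (B i)) ->
    P (\bigcap_(i in [set` s]) (X i @^-1` B i))
      = (\prod_(i <- s) P (X i @^-1` B i))%E.

Definition standard_normal {R : realType} (d : measure_display)
    (T : measurableType d) (P : probability T R) (X : {RV P >-> R}) : Prop :=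
  forall A : set R, measurable A -> distribution P X A = normal_prob 0 1 A.

Definition zsum {R : realType} (a : int -> R) : R :=
  limn (series (fun n : nat => a n%:Z))
    + limn (series (fun n : nat => a (- (n.+1)%:Z))).

(* The sum over [k] is taken first, then the sum over [j]; [limn] is total, and
   is the sum of the series wherever the series converges. *)
Definition wavelet_series {R : realType} (h : R) (psi : R -> R)
    (x : nat -> int -> R) (t : R) : R :=
  limn (series (fun j : nat =>
    zsum (fun k : int => x j k * 2 `^ (- h * j%:R)
      * psi (2 ^+ j * t - k%:~R)))).

(* A modulus of continuity is a function on [0, +oo[; the values of [w] at
   negative arguments are irrelevant. *)
Record modulus_of_continuity {R : realType} (w : R -> R) : Prop := {
  modulus_ge0 : forall x, 0 <= x -> 0 <= w x;
  modulus_incr : forall x y, 0 <= x -> x < y -> w x < w y;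
  modulus0 : w 0 = 0;
  modulus_doubling :
    exists2 C : R, 0 < C & forall x, 0 <= x -> w (2 * x) <= C * w x }.

Definition modulus_little_o {R : realType} (w w' : R -> R) : Prop :=
  (fun x => w x / w' x) @ 0^'+ --> (0 : R).

(* Meaningful for x near 0 only. *)
Definition omega_r {R : realType} (h x : R) : R :=
  `|x| `^ h * Num.sqrt (ln (`|x|^-1)).

Definition omega_o {R : realType} (h x : R) : R :=
  `|x| `^ h * Num.sqrt (ln (ln (`|x|^-1))).

Definition omega_s {R : realType} (h x : R) : R := `|x| `^ h.

(* limsup of |f(s) - f(t)| / w(|s - t|) as s -> t, s != t. *)
Definition limsup_ratio {R : realType} (f w : R -> R) (t : R) : \bar R :=
  lime_sup (fun s : R => (`|f s - f t| / w `|s - t|)%:E) t.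

Definition sharp_modulus_at {R : realType} (f w : R -> R) (t : R) : Prop :=
  (limsup_ratio f w t < +oo)%E /\
  forall w' : R -> R, modulus_of_continuity w' -> modulus_little_o w' w ->
    limsup_ratio f w' t = +oo%E.

(* Main.v *)
(* The increments of [f_h] at [t] on the scale [2^-n] are governed by the
   coefficients [xi_(j,k)] with [k / 2^j] close to [t]. If [|xi_(j,k)|] is at most
   a constant times [phi j * (1 + ln (1 + |k - 2^j t|))], for a slowly varying
   [phi], the decay and the smoothness of [psi] give
   [|f s - f t| = O (2^(-hn) phi n)] for [|s - t| <= 2^-n]. Conversely, pairing
   [f - f t] with the dual wavelets, which have mean zero, shows that increments
   [o (2^(-hn) phi n)] force [xi_(j,k) = o (phi j)] for [|k - 2^j t| <= 2]. Hence
   everything reduces to Gaussian coefficients near [t], with [phi j] equal to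
   [sqrt (ln j)], [sqrt j] and [1] respectively.
   - Ordinary points: both halves of Borel-Cantelli at a fixed [t], then Fubini.
   - Rapid points: almost surely every coefficient is [O (sqrt (j + ln |k|))], and
     every dyadic interval contains some with [|xi_(j,k)| > sqrt j / 2], so
     Baire's theorem applies.
   - Slow points: by a second moment estimate on the dyadic tree there are, below
     every dyadic interval, arbitrarily long branches along which [xi_(j,k)] is
     bounded on a window of length [2^(j/2)] (up to the logarithmic weight) and
     bounded away from [0] at its centre; compactness provides a limit point. *)
Require Import Defs.
From HB Require Import structures.
From mathcomp Require Import all_boot all_order all_algebra.
From mathcomp Require Import all_classical all_reals all_analysis.
From mathcomp Require Import measurable_realfun ring lra zify.
Import Order.TTheory GRing.Theory Num.Theory.
Import numFieldNormedType.Exports.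
Local Open Scope classical_set_scope.
Local Open Scope ring_scope.

Set Implicit Arguments.
Unset Strict Implicit.
Unset Printing Implicit Defensive.

(** * Logarithmic weights and series over the integers *)

Section LogWeight.
Variable R : realType.
Implicit Types (a b d e y z : R).

(** The weight [lnw] is dictated from two sides: it grows slowly enough to be summed against the
    decay of [psi], and it turns a Gaussian tail into a summable inverse square. The obstacle lies
    in the slow points. There a bound independent of [j] must hold for all [k], but distinct
    branches of the tree share coefficients, so the windows cannot be too long, and outside them
    only the almost sure bound [sqrt (j + ln |k|)] is available. The length [2^(j/2)] meets both
    needs: outside, [ln (1 + |k - m|)] is at least of order [j]; inside, the windows of two branches
    meet at level [j] for a proportion of about [2^(-j/2)] of the pairs, which beats the growth
    [(5/4)^j] allowed to the correlations. The moduli [w' = o(w)] form an uncountable family, but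
    one criterion excludes them all: a finite limsup for one of them would make the increments
    [o (2^(-hn) phi n)]. Randomness enters only through statements on dyadic nodes and, for ordinary
    points, through a set measurable in the pair of [w] and [t]. One null set therefore serves all
    intervals, and the analysis is deterministic. *)

Definition lnw d : R := 1 + ln (1 + d).

Lemma lnw_ge1 d : 0 <= d -> 1 <= lnw d.
Proof. by move=> d0; rewrite /lnw lerDl ln_ge0// lerDl. Qed.

Lemma lnw_gt0 d : 0 <= d -> 0 < lnw d.
Proof. by move=> d0; exact: (lt_le_trans ltr01 (lnw_ge1 d0)). Qed.

Lemma lnw_le d : 0 <= d -> lnw d <= 1 + d.
Proof. by move=> d0; rewrite /lnw lerD2l le_ln1Dx//; lra. Qed.

Lemma lnw_mono a b : 0 <= a -> a <= b -> lnw a <= lnw b.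
Proof. by move=> a0 ab; rewrite /lnw lerD2l ler_ln ?posrE; lra. Qed.

Lemma lnw_add a b : 0 <= a -> 0 <= b -> lnw (a + b) <= lnw a + lnw b.
Proof.
move=> a0 b0; rewrite /lnw.
have : ln (1 + (a + b)) <= ln ((1 + a) * (1 + b)).
  by rewrite ler_ln ?posrE; nra.
by rewrite lnM ?posrE; lra.
Qed.

Lemma ln_expn2 (i : nat) : ln (2 ^+ i) <= i%:R :> R.
Proof.
have ln2 : ln 2 <= 1 :> R.
  by rewrite (_ : 2 = 1 + 1) ?le_ln1Dx//; lra.
by rewrite lnXn// lerMn2r ln2 orbT.
Qed.

Lemma ln2_ge_half : 2^-1 <= ln 2 :> R.
Proof.
have : ln (1 + - 2^-1) <= - 2^-1 :> R by rewrite le_ln1Dx//; lra.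
by rewrite (_ : 1 + - 2^-1 = 2^-1) ?lnV ?posrE//; lra.
Qed.

Lemma dyadic_lt e : 0 < e -> exists n, 2 ^- n < e.
Proof.
move=> e0.
have /cvgr0Pnorm_lt/(_ _ e0) : (fun n => 2^-1 ^+ n : R) @ \oo --> 0.
  by apply: cvg_expr; rewrite ger0_norm ?invf_lt1//; lra.
by move=> [N _ hN]; exists N; have := hN N (leqnn _); rewrite /= -exprVn ger0_norm.
Qed.

Lemma lnw_expn2 (i : nat) : lnw (2 ^+ i) <= 2 + i%:R.
Proof.
have h1 : (1 : R) <= 2 ^+ i by rewrite exprn_ege1//; lra.
have : ln (1 + 2 ^+ i) <= ln (2 ^+ i.+1) :> R.
  by rewrite ler_ln ?posrE ?exprS; [lra|lra|apply: mulr_gt0; lra].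
by have := ln_expn2 i.+1; rewrite /lnw -natr1; lra.
Qed.

End LogWeight.

Section Sums.
Variable R : realType.
Implicit Types (u v : nat -> R) (a b : int -> R) (K c y z : R).

Lemma norm_bounded_series_cvg u K :
  (forall n, \sum_(0 <= k < n) `|u k| <= K) -> cvgn (series u).
Proof.
move=> uK; apply: normed_cvg; apply: nondecreasing_is_cvgn.
  by apply: nondecreasing_series => i _ _; exact: normr_ge0.
by exists K => _ [n _ <-]; exact: uK.
Qed.

(** [zsum] adds two separate limits; truncating both halves at the same [N] yields a single
    sequence, to which dominated convergence can be applied. *)
Definition zpart (N : nat) a : R :=
  \sum_(0 <= k < N) a k%:Z + \sum_(0 <= k < N) a (- k.+1%:Z).

Let F y : R := y / (1 + `|y|).

Let F_bound y : `|F y| <= 1.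
Proof.
rewrite /F normrM normfV [X in _ / X]ger0_norm ?addr_ge0//.
by rewrite ler_pdivrMr ?mul1r ?lerDr// ltr_pwDl.
Qed.

(* The increments of [y / (1 + |y|)] dominate [(1 + |y|)^-2], so that sums over
   the integers telescope, uniformly in the centre. *)
Let F_incr y : (1 + `|y|) ^- 2 <= 4 * (F (y + 1) - F y).
Proof.
rewrite /F; have := ger0_norm; have := @normr_ge0 _ _ y.
have [y0|y0] := leP 0 y.
  rewrite !ger0_norm ?addr_ge0// => _ _.
  have -> : (y + 1) / (1 + (y + 1)) - y / (1 + y) = ((1 + y) * (2 + y))^-1.
    by field; apply/andP; split; lra.
  rewrite expr2 -[X in 4 * X]div1r mulrA mulr1 ler_pdivlMr; last by nra.
  by rewrite mulrC ler_pdivrMr; nra.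
have [y1|y1] := leP 0 (y + 1).
  rewrite (ltr0_norm y0) (ger0_norm y1) => _ _.
  have -> : (y + 1) / (1 + (y + 1)) - y / (1 - y) =
     ((y + 1) * (1 - y) - y * (y + 2)) / ((1 - y) * (2 + y)).
    by field; apply/andP; split; lra.
  rewrite expr2 mulrA ler_pdivlMr; last by nra.
  rewrite mulrC ler_pdivrMr; last by nra.
  have : 0 <= (y + 1) * (- y) * (1 - y) by rewrite !mulr_ge0//; lra.
  by nra.
rewrite (ltr0_norm y0) (ltr0_norm y1) => _ _.
have -> : (y + 1) / (1 - (y + 1)) - y / (1 - y) = ((1 - y) * (- y))^-1.
  by field; apply/andP; split; lra.
rewrite expr2 -[X in 4 * X]div1r mulrA mulr1 ler_pdivlMr; last by nra.
by rewrite mulrC ler_pdivrMr; nra.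
Qed.

(** The telescoped sum is [4 * (F (n - c) - F (- c))], and [F] takes values between -1 and 1. *)
Lemma sum_invsq_shift c (n : nat) :
  \sum_(0 <= k < n) (1 + `|c - k%:R|) ^- 2 <= 8.
Proof.
apply: (@le_trans _ _ (\sum_(0 <= k < n) (4 * F (k.+1%:R - c) - 4 * F (k%:R - c)))).
  apply: ler_sum => k _; rewrite -mulrBr -[k.+1%:R]natr1 distrC.
  by rewrite (_ : k%:R + 1 - c = k%:R - c + 1) ?F_incr//; ring.
rewrite (telescope_sumr (fun k => 4 * F (k%:R - c)))//.
have := F_bound (n%:R - c); have := F_bound (0 - c).
by rewrite !ler_norml => /andP[? ?] /andP[? ?]; lra.
Qed.

Variables (a : int -> R) (K c : R).
Hypothesis aK : forall k : int, `|a k| <= K * (1 + `|c - k%:~R|) ^- 2.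

Let K0 : 0 <= K.
Proof.
by have := le_trans (normr_ge0 _) (aK 0); rewrite pmulr_lge0.
Qed.

Let pos n : \sum_(0 <= k < n) `|a k%:Z| <= 8 * K.
Proof.
apply: (@le_trans _ _ (\sum_(0 <= k < n) K * (1 + `|c - k%:R|) ^- 2)).
  by apply: ler_sum => k _; have := aK k%:Z.
by rewrite -mulr_sumr mulrC ler_wpM2r// sum_invsq_shift.
Qed.

Let neg n : \sum_(0 <= k < n) `|a (- k.+1%:Z)| <= 8 * K.
Proof.
(* Reflecting the integers [- k.+1] onto the naturals moves the centre from [c] to [- 1 - c]. *)
apply: (@le_trans _ _ (\sum_(0 <= k < n) K * (1 + `|(- 1 - c) - k%:R|) ^- 2)).
  apply: ler_sum => k _; rewrite (le_trans (aK _))//.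
  rewrite (_ : `|c - (- k.+1%:Z)%:~R| = `|- 1 - c - k%:R|)// -normrN.
  by congr `| _ |; rewrite mulrNz -[k.+1%:~R]/(k.+1%:R) -natr1; ring.
by rewrite -mulr_sumr mulrC ler_wpM2r// sum_invsq_shift.
Qed.

Lemma zpart_cvg : zpart N a @[N --> \oo] --> zsum a.
Proof.
apply: cvgD.
  exact: (norm_bounded_series_cvg pos).
exact: (norm_bounded_series_cvg neg).
Qed.

Lemma zpart_le N : `|zpart N a| <= 16 * K.
Proof.
rewrite (le_trans (ler_normD _ _))//.
have := le_trans (ler_norm_sum _ _ _) (pos N).
by have := le_trans (ler_norm_sum _ _ _) (neg N); lra.
Qed.

Lemma zsum_le : `|zsum a| <= 16 * K.
Proof.
by apply: (cvgr_to_le (cvg_norm zpart_cvg)); near=> N; exact: zpart_le.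
Unshelve. all: by end_near. Qed.

End Sums.

(** * Geometric sums and the weights of the scales *)

Section GeometricSums.
Variable R : realType.
Implicit Types (q b : R).

Lemma sum_expr_le q n : 0 <= q -> q < 1 -> \sum_(0 <= i < n) q ^+ i <= (1 - q)^-1.
Proof.
move=> q0 q1; rewrite -[leRHS]mul1r ler_pdivlMr ?subr_gt0//.
suff -> : (\sum_(0 <= i < n) q ^+ i) * (1 - q) = 1 - q ^+ n.
  by rewrite lerBlDr lerDl exprn_ge0.
elim: n => [|n IH]; first by rewrite big_geq// mul0r subrr.
by rewrite big_nat_recr//= mulrDl IH exprSr; ring.
Qed.

(** Each of the first [n.+1] powers of [q] is at least [q ^+ n], so the left-hand side is below a
    geometric sum. *)
Lemma succ_expr_le q n : 0 <= q -> q < 1 -> n.+1%:R * q ^+ n <= (1 - q)^-1.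
Proof.
move=> q0 q1; rewrite (le_trans _ (sum_expr_le n.+1 q0 q1))//.
rewrite mulr_natl -[X in _ *+ X]subn0 -sumr_const_nat big_nat_cond [leRHS]big_nat_cond.
apply: ler_sum => i /andP[/andP[_ iltn] _].
by apply: ler_wiXn2l => //; exact: ltW.
Qed.

(** With [d] the fourth root of [b], half of the decay pays for the polynomial factor, since
    [i.+1 * d ^+ i] is bounded, and the powers of [d ^+ 2] remain to be summed. *)
Lemma sum_sqr_expr_le b : 0 < b -> b < 1 ->
  exists2 S, 0 < S & forall n, \sum_(0 <= i < n) i.+1%:R ^+ 2 * b ^+ i <= S.
Proof.
move=> b0 b1; pose d := Num.sqrt (Num.sqrt b).
have d0 : 0 < d by rewrite !sqrtr_gt0.
have dE : d ^+ 4 = b.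
  by rewrite (exprM d 2 2) sqr_sqrtr ?sqrtr_ge0// sqr_sqrtr// ltW.
have d1 : d < 1.
  by rewrite ltNge; apply/negP => d1; move: b1; rewrite ltNge -dE exprn_ege1.
have dd1 : d ^+ 2 < 1 by rewrite expr_lt1// ltW.
exists ((1 - d)^-1 ^+ 2 * (1 - d ^+ 2)^-1).
  by rewrite mulr_gt0 ?exprn_gt0// invr_gt0 subr_gt0.
move=> n; apply: (@le_trans _ _ (\sum_(0 <= i < n) (1 - d)^-1 ^+ 2 * (d ^+ 2) ^+ i)).
  apply: ler_sum => i _.
  have -> : i.+1%:R ^+ 2 * b ^+ i = (i.+1%:R * d ^+ i) ^+ 2 * (d ^+ 2) ^+ i.
    rewrite (exprMn _ i.+1%:R) -[RHS]mulrA; congr (_ * _).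
    by rewrite -[in LHS]dE -!exprM -exprD; congr (d ^+ _); lia.
  apply: ler_wpM2r; first by rewrite exprn_ge0// sqr_ge0.
  apply: lerXn2r; last exact: (succ_expr_le _ (ltW d0) d1).
    by rewrite nnegrE mulr_ge0// exprn_ge0// ltW.
  by rewrite nnegrE invr_ge0 subr_ge0 ltW.
rewrite -mulr_sumr ler_wpM2l ?sqr_ge0//.
by rewrite sum_expr_le// sqr_ge0.
Qed.

(* Scales coarser than [n] see increments of a smooth function, finer ones are
   bounded directly. *)
Definition scale_weight (q b : R) (n j : nat) : R :=
  if (j <= n)%N then q ^+ (n - j) else (j - n).+1%:R ^+ 2 * b ^+ (j - n).

Lemma scale_weight_ge0 q b n j : 0 <= q -> 0 <= b -> 0 <= scale_weight q b n j.
Proof.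
by move=> q0 b0; rewrite /scale_weight; case: ifP => _; rewrite ?mulr_ge0 ?exprn_ge0.
Qed.

Lemma sum_scale_weight_le q b : 0 <= q -> q < 1 -> 0 < b -> b < 1 ->
  exists2 S, 0 < S & forall n J, \sum_(0 <= j < J) scale_weight q b n j <= S.
Proof.
move=> q0 q1 b0 b1; have [S S0 hS] := sum_sqr_expr_le b0 b1.
exists ((1 - q)^-1 + S); first by rewrite addr_gt0// invr_gt0 subr_gt0.
move=> n J; have w0 j := scale_weight_ge0 n j q0 (ltW b0).
(* Lengthening the range allows splitting it after [n] without comparing [J] with [n]. *)
apply: (@le_trans _ _ (\sum_(0 <= j < n.+1 + J) scale_weight q b n j)).
  rewrite [leRHS](@big_cat_nat _ _ _ J)//= ?leq_addl//.
  by rewrite lerDl sumr_ge0.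
rewrite (@big_cat_nat _ _ _ n.+1)//= ?leq_addr// lerD//.
  rewrite big_nat_rev/= add0n (le_trans _ (sum_expr_le n.+1 q0 q1))//.
  rewrite big_nat_cond [leRHS]big_nat_cond ler_sum// => i /andP[/andP[_ i1] _].
  by rewrite /scale_weight subSS leq_subr subKn.
rewrite -[X in index_iota X _]add0n big_addn addKn.
apply: le_trans (hS J.+1); rewrite big_nat_recl//= expr0 mulr1 ler_wpDl//.
apply: ler_sum => i _; rewrite /scale_weight ifF; last by lia.
by rewrite (_ : i + n.+1 - n = i.+1)%N//; lia.
Qed.

End GeometricSums.

Section SumsOverIntegers.
Variable R : realType.
Implicit Types (a b u v : int -> R) (A E K c y rho : R).

Lemma zpartB N a b : zpart N a - zpart N b = zpart N (fun k => a k - b k).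
Proof. by rewrite /zpart !sumrB; ring. Qed.

(** The first two bounds provide the convergence of both series, each around its own centre; the
    estimate itself comes from the third one. *)
Lemma zsum_dist_le a b Ka ca Kb cb K c :
  (forall k : int, `|a k| <= Ka * (1 + `|ca - k%:~R|) ^- 2) ->
  (forall k : int, `|b k| <= Kb * (1 + `|cb - k%:~R|) ^- 2) ->
  (forall k : int, `|a k - b k| <= K * (1 + `|c - k%:~R|) ^- 2) ->
  `|zsum a - zsum b| <= 16 * K.
Proof.
move=> ha hb hab.
have cv : zpart N (fun k => a k - b k) @[N --> \oo] --> zsum a - zsum b.
  rewrite (_ : (fun N => _) = (fun N => zpart N a - zpart N b)).
    exact: cvgB (zpart_cvg ha) (zpart_cvg hb).
  by apply/funext => N; rewrite zpartB.
apply: (cvgr_to_le (cvg_norm cv)); near=> N; exact: zpart_le hab N.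
Unshelve. all: by end_near. Qed.

(** The logarithmic weight costs at most one power of [1 + |c - k|], so that cubic decay leaves a
    summable inverse square; [1 + lnw rho] pays for the distance between the node [m] and the centre
    [c]. *)
Lemma weighted_term_le u v A E c rho (m : int) : 0 <= A -> 0 <= E -> 0 <= rho ->
  `|c - m%:~R| <= rho ->
  (forall k : int, `|u k| <= A * lnw `|(k - m)%:~R|) ->
  (forall k : int, `|v k| <= E * (1 + `|c - k%:~R|) ^- 3) ->
  forall k : int,
    `|u k * v k| <= A * E * (1 + lnw rho) * (1 + `|c - k%:~R|) ^- 2.
Proof.
move=> A0 E0 rho0 cm uA vE k; set y := c - k%:~R.
have y0 := normr_ge0 y; have r1 := lnw_ge1 rho0.
have wk : lnw `|(k - m)%:~R : R| <= (1 + `|y|) * (1 + lnw rho).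
  have : lnw `|(k - m)%:~R : R| <= lnw (`|y| + rho).
    apply: lnw_mono => //; rewrite intrB.
    rewrite (_ : k%:~R - m%:~R = - y + (c - m%:~R)); last by rewrite /y; ring.
    by rewrite (le_trans (ler_normD _ _))// normrN lerD2l.
  by have := lnw_add y0 rho0; have := lnw_le y0; nra.
rewrite normrM; apply: (@le_trans _ _
    ((A * ((1 + `|y|) * (1 + lnw rho))) * (E * (1 + `|y|) ^- 3))).
  by rewrite ler_pM//; rewrite (le_trans (uA k))// ler_wpM2l.
rewrite le_eqVlt; apply/orP; left; apply/eqP; field.
by rewrite gt_eqF// ltr_pwDl.
Qed.

End SumsOverIntegers.

(** * Increments of the series in terms of its coefficients *)

Section Blocks.
Variables (R : realType) (h : R) (psi : R -> R) (x : nat -> int -> R).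
Hypotheses (h0 : 0 < h) (h1 : h < 1).
Implicit Types (s t y : R) (j n : nat) (m k : int).

(** [beta ^+ n] is [|x|^h] at the scale [|x| = 2^-n]. The conditions on [h] become [1/2 < beta < 1]:
    the upper bound makes the scales finer than an increment summable, the lower one the coarser
    scales, with ratio [(2 * beta)^-1]. *)
Definition beta : R := 2 `^ (- h).

Lemma beta_gt0 : 0 < beta. Proof. exact: powR_gt0. Qed.

Lemma beta_lt1 : beta < 1.
Proof.
have l2 : 0 < ln 2 :> R by rewrite ln_gt0//; lra.
by rewrite /beta /powR gt_eqF// -[ltRHS]expR0 ltr_expR; have := mulr_gt0 h0 l2; lra.
Qed.

Lemma beta_gt_half : 2^-1 < beta.
Proof.
have l2 : 0 < ln 2 :> R by rewrite ln_gt0//; lra.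
have h1' : 0 < 1 - h by rewrite subr_gt0.
have -> : 2^-1 = expR (- ln 2) :> R by rewrite expRN lnK ?posrE.
by rewrite /beta /powR gt_eqF// ltr_expR; have := mulr_gt0 h1' l2; lra.
Qed.

Lemma betaX j : 2 `^ (- h * j%:R) = beta ^+ j.
Proof. by rewrite powRrM powR_mulrn// powR_ge0. Qed.

Lemma betaX_ge0 j : 0 <= beta ^+ j.
Proof. by rewrite exprn_ge0// ltW// beta_gt0. Qed.

Definition block_term j t k : R :=
  x j k * 2 `^ (- h * j%:R) * psi (2 ^+ j * t - k%:~R).

Definition block j t : R := zsum (block_term j t).

Variable D : R.
Hypothesis psi_decay : forall y, `|psi y| <= D * (1 + `|y|) ^- 3.

Lemma decay_ge0 : 0 <= D.
Proof. by have := le_trans (normr_ge0 _) (psi_decay 0); rewrite pmulr_lge0. Qed.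

Lemma block_term_le j t m A rho : 0 <= A -> 0 <= rho ->
  `|2 ^+ j * t - m%:~R| <= rho ->
  (forall k, `|x j k| <= A * lnw `|(k - m)%:~R|) ->
  forall k, `|block_term j t k| <=
    A * (beta ^+ j * D) * (1 + lnw rho) * (1 + `|2 ^+ j * t - k%:~R|) ^- 2.
Proof.
move=> A0 rho0 near_m xA k; rewrite /block_term betaX -mulrA.
apply: (@weighted_term_le _ (x j) (fun k => beta ^+ j * psi (2 ^+ j * t - k%:~R))
   A _ _ _ m) => //; first by rewrite mulr_ge0 ?betaX_ge0// decay_ge0.
by move=> i; rewrite normrM ger0_norm ?betaX_ge0// -mulrA ler_wpM2l ?betaX_ge0.
Qed.

Lemma block_le j t m A rho : 0 <= A -> 0 <= rho ->
  `|2 ^+ j * t - m%:~R| <= rho ->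
  (forall k, `|x j k| <= A * lnw `|(k - m)%:~R|) ->
  `|block j t| <= 16 * (A * (beta ^+ j * D) * (1 + lnw rho)).
Proof. by move=> A0 r0 hm hx; apply: zsum_le; exact: block_term_le hx. Qed.

Hypothesis psi_lip : forall y y', `|y - y'| <= 1 ->
  `|psi y - psi y'| <= D * `|y - y'| * (1 + `|y'|) ^- 3.

Lemma block_dist_le j s t m A : 0 <= A ->
  `|2 ^+ j * t - m%:~R| <= 2 -> 2 ^+ j * `|s - t| <= 1 ->
  (forall k, `|x j k| <= A * lnw `|(k - m)%:~R|) ->
  `|block j s - block j t| <=
    16 * (A * (beta ^+ j * (D * (2 ^+ j * `|s - t|))) * (1 + lnw 2)).
Proof.
move=> A0 tm st xA.
have D0 := decay_ge0; have b0 := betaX_ge0 j.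
have stE k : 2 ^+ j * s - k%:~R - (2 ^+ j * t - k%:~R) = 2 ^+ j * (s - t) by ring.
have st' k : `|2 ^+ j * s - k%:~R - (2 ^+ j * t - k%:~R)| = 2 ^+ j * `|s - t|.
  by rewrite stE normrM ger0_norm.
have sm : `|2 ^+ j * s - m%:~R| <= 3.
  rewrite -(subrK (2 ^+ j * t - m%:~R) (2 ^+ j * s - m%:~R)).
  by rewrite (le_trans (ler_normD _ _))// st'; lra.
apply: (zsum_dist_le (block_term_le A0 _ sm xA) (block_term_le A0 _ tm xA)
  (c := 2 ^+ j * t)) => //.
move=> k; rewrite /block_term betaX -mulrBr -[X in `|X|]mulrA.
apply: (@weighted_term_le _ (x j) (fun k => beta ^+ j *
   (psi (2 ^+ j * s - k%:~R) - psi (2 ^+ j * t - k%:~R))) A _ _ _ m) => //.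
  by rewrite !mulr_ge0.
move=> i; rewrite normrM ger0_norm// -mulrA ler_wpM2l//.
by rewrite -(st' i) psi_lip// st'.
Qed.

End Blocks.

Lemma sqr_le_norm {R : realDomainType} (a b : R) :
  0 <= b -> a ^+ 2 <= b ^+ 2 -> `|a| <= b.
Proof. by move=> b0; rewrite -[a ^+ 2]real_normK ?num_real// ler_sqr. Qed.

Definition coef_bound {R : realType} (x : nat -> int -> R) (C : R) : Prop :=
  forall j k, x j k ^+ 2 <= C * (1 + j%:R + ln (1 + `|k%:~R|)).

(** Turns a sum of weights into a product, whose square root splits into factors depending on [t],
    on [j] and on [k]. *)
Lemma weights_le {R : realType} (T J W : R) : 1 <= T -> 1 <= J -> 1 <= W ->
  2 * J + W + T + 1 <= 5 * (T ^+ 2 * J * W ^+ 2).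
Proof.
move=> T1 J1 W1.
have T2 : T <= T ^+ 2 by rewrite expr2 ler_peMr//; lra.
have W2 : W <= W ^+ 2 by rewrite expr2 ler_peMr//; lra.
move: (T ^+ 2) (W ^+ 2) T2 W2 => T' W' T2 W2.
have TJ : J <= T' * J by rewrite ler_peMl//; lra.
have TJ' : T' <= T' * J by rewrite ler_peMr//; lra.
have TJW : T' * J <= T' * J * W' by rewrite ler_peMr//; lra.
have TJW' : W' <= T' * J * W' by rewrite ler_peMl//; lra.
by lra.
Qed.

(** Moving the centre from the origin to [m] costs [ln (1 + 2^j |t|) <= j + |t|], whence the factor
    2 in front of the level. *)
Lemma coef_bound_sqr_near {R : realType} (x : nat -> int -> R) (C : R) :
  0 <= C -> coef_bound x C -> forall t j (m k : int),
  `|2 ^+ j * t - m%:~R| <= 2 ->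
  x j k ^+ 2 <= C * (2 * j.+1%:R + lnw `|(k - m)%:~R| + (1 + `|t|) + 1).
Proof.
move=> C0 xC t j m k tm.
set T := 1 + `|t|; set W := lnw _; set J : R := j.+1%:R.
have p1 : (1 : R) <= 2 ^+ j by rewrite exprn_ege1//; lra.
have t0 := normr_ge0 t.
have km : `|k%:~R : R| <= `|(k - m)%:~R| + (2 ^+ j * `|t| + 2).
  rewrite (_ : k%:~R = (k - m)%:~R + (2 ^+ j * t - (2 ^+ j * t - m%:~R))); last first.
    by rewrite intrB; ring.
  rewrite (le_trans (ler_normD _ _))// lerD2l (le_trans (ler_normB _ _))//.
  by rewrite normrM (ger0_norm (exprn_ge0 _ _))// lerD2l.
have l2t : ln (1 + 2 ^+ j * `|t|) <= j%:R + `|t|.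
  apply: (@le_trans _ _ (ln (2 ^+ j * T))).
    by rewrite ler_ln ?posrE /T; nra.
  rewrite lnM ?posrE /T; [|by lra|by lra].
  by apply: lerD; [exact: ln_expn2 | apply: le_ln1Dx; lra].
have kW : lnw `|k%:~R : R| <= W + (1 + j%:R + `|t|) + 3.
  apply: (le_trans (lnw_mono (normr_ge0 _) km)).
  have q0 : 0 <= 2 ^+ j * `|t| by nra.
  apply: (le_trans (lnw_add (normr_ge0 _) _)); first by nra.
  have := lnw_add q0 (ltW (@ltr0n R 2)); have := lnw_le (ltW (@ltr0n R 2)).
  by rewrite -/W {3}/lnw; lra.
rewrite (le_trans (xC j k))//; apply: ler_wpM2l => //.
have Jj : J = j%:R + 1 by rewrite /J -natr1.
by move: kW; rewrite {1}/lnw Jj /T; lra.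
Qed.

Lemma coef_bound_near {R : realType} (x : nat -> int -> R) (C : R) :
  0 <= C -> coef_bound x C -> forall t j (m k : int),
  `|2 ^+ j * t - m%:~R| <= 2 ->
  `|x j k| <= Num.sqrt (5 * C) * (1 + `|t|) * Num.sqrt j.+1%:R
                * lnw `|(k - m)%:~R|.
Proof.
move=> C0 xC t j m k tm; have := coef_bound_sqr_near C0 xC k tm.
set T := 1 + `|t|; set W := lnw _; set J : R := j.+1%:R => H.
have T1 : 1 <= T by rewrite lerDl.
have W1 : 1 <= W by exact: lnw_ge1.
have J1 : 1 <= J by rewrite ler1n.
have : x j k ^+ 2 <= (Num.sqrt (5 * C) * T * Num.sqrt J * W) ^+ 2.
  have J0 : 0 <= J by lra.
  have C5 : 0 <= 5 * C by lra.
  rewrite (le_trans H)// !exprMn !sqr_sqrtr//.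
  apply: (@le_trans _ _ (C * (5 * (T ^+ 2 * J * W ^+ 2)))); last first.
    by rewrite le_eqVlt; apply/orP; left; apply/eqP; ring.
  by apply: ler_wpM2l => //; exact: weights_le.
by apply: sqr_le_norm; rewrite !mulr_ge0//; lra.
Qed.

(** That far from [m] the level disappears from the bound: [j.+1 <= 4 * W], because
    [W >= 1 + j./2 * ln 2] and [ln 2 >= 1/2]. Then [9 * W + T + 1 <= 11 * (T * W ^ 2)]. *)
Lemma coef_bound_far {R : realType} (x : nat -> int -> R) (C : R) :
  0 <= C -> coef_bound x C -> forall t j (m k : int),
  `|2 ^+ j * t - m%:~R| <= 2 -> (2 ^ j./2)%N%:Z < `|k - m| ->
  `|x j k| <= Num.sqrt (11 * (C * (1 + `|t|))) * lnw `|(k - m)%:~R|.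
Proof.
move=> C0 xC t j m k tm; rewrite -(ltr_int R) intr_norm => far.
have := coef_bound_sqr_near C0 xC k tm.
set T := 1 + `|t|; set W := lnw _ => H.
have T1 : 1 <= T by rewrite lerDl.
have W1 : 1 <= W by exact: lnw_ge1.
have lh := ln2_ge_half R.
have jW : j.+1%:R <= 4 * W.
  have : j./2%:R * ln 2 <= ln (1 + `|(k - m)%:~R|) :> R.
    rewrite mulr_natl -lnXn// ler_ln ?posrE ?exprn_gt0 ?ltr_pwDl//.
    by rewrite -natrX; apply: (le_trans (ltW far)); rewrite lerDr.
  have : j.+1%:R <= 2 * j./2%:R + 2 :> R.
    by rewrite -natrM -natrD ler_nat; lia.
  have : 0 <= j./2%:R :> R by [].
  by rewrite /W /lnw; nra.
apply: sqr_le_norm; first by rewrite mulr_ge0//; lra.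
have CT : 0 <= C * T by rewrite mulr_ge0//; lra.
rewrite exprMn sqr_sqrtr; last by lra.
apply: (le_trans H); rewrite (_ : 11 * (C * T) * W ^+ 2 = C * (11 * (T * W ^+ 2))); last by ring.
apply: ler_wpM2l => //.
have W2 : W <= W ^+ 2 by rewrite expr2 ler_peMr//; lra.
by nra.
Qed.

Section Series.
Variables (R : realType) (h : R) (psi : R -> R) (x : nat -> int -> R).
Hypotheses (h0 : 0 < h) (h1 : h < 1).
Variable D : R.
Hypothesis psi_decay : forall y, `|psi y| <= D * (1 + `|y|) ^- 3.
Variable C : R.
Hypotheses (C0 : 0 <= C) (xC : coef_bound x C).
Implicit Types (s t y : R) (j n : nat) (m k : int).

Local Notation b := (beta h).
Local Notation B := (block h psi x).
Local Notation f := (wavelet_series h psi x).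

Lemma near_floor j t : `|2 ^+ j * t - (Num.floor (2 ^+ j * t))%:~R| <= 1.
Proof.
have := floor_le (2 ^+ j * t); have := floorD1_gt (2 ^+ j * t).
by rewrite intrD ler_norml; lra.
Qed.

Lemma block_growth : exists2 K, 0 < K &
  forall t j, `|B j t| <= K * (1 + `|t|) * (j.+1%:R * b ^+ j).
Proof.
have D0 := decay_ge0 psi_decay; have b0 j := betaX_ge0 h j.
have l2 : 1 <= lnw 2 :> R by apply: lnw_ge1; lra.
pose K := 16 * (Num.sqrt (5 * C) * D * (1 + lnw 2)).
have K0 : 0 <= K by rewrite !mulr_ge0//; lra.
exists (1 + K); first by lra.
move=> t j; have t0 := normr_ge0 t.
pose A := Num.sqrt (5 * C) * (1 + `|t|) * Num.sqrt j.+1%:R.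
have A0 : 0 <= A by rewrite !mulr_ge0//; lra.
have near : `|2 ^+ j * t - (Num.floor (2 ^+ j * t))%:~R| <= 2.
  by have := near_floor j t; lra.
have /= := block_le h psi_decay A0 (ltW (@ltr0n R 2)) near
  (fun k => coef_bound_near C0 xC k near).
move=> /le_trans; apply.
have sj : Num.sqrt j.+1%:R <= j.+1%:R :> R.
  rewrite -[leRHS]sqr_sqrtr// expr2 ler_peMr ?sqrtr_ge0//.
  by rewrite -[leLHS]sqrtr1 ler_wsqrtr// ler1n.
apply: (@le_trans _ _ (K * (1 + `|t|) * (Num.sqrt j.+1%:R * b ^+ j))).
  by rewrite le_eqVlt; apply/orP; left; apply/eqP; rewrite /K /A; ring.
apply: ler_pM; rewrite ?mulr_ge0//; [by lra| |by apply: ler_wpM2r].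
by apply: ler_wpM2r; lra.
Qed.

(** Crude, but it yields absolute convergence and a majorant, linear in [t] and uniform in [n], for
    the pairing with the dual wavelets. *)
Lemma series_growth : exists2 K, 0 < K & forall t n,
  \sum_(0 <= j < n) `|B j t| <= K * (1 + `|t|).
Proof.
have [K K0 hK] := block_growth.
have [S S0 hS] := sum_sqr_expr_le (beta_gt0 h) (beta_lt1 h0).
exists (K * S); first by rewrite mulr_gt0.
move=> t n; have t0 := normr_ge0 t; have b0 j := betaX_ge0 h j.
apply: (@le_trans _ _ (\sum_(0 <= j < n) K * (1 + `|t|) * (j.+1%:R ^+ 2 * b ^+ j))).
  apply: ler_sum => j _; rewrite (le_trans (hK _ _))//.
  rewrite ler_wpM2l//; first by rewrite mulr_ge0//; lra.
  by rewrite ler_wpM2r// expr2 ler_peMr// ler1n.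
rewrite -mulr_sumr [leRHS]mulrAC; apply: ler_wpM2l; first by apply: mulr_ge0; lra.
exact: hS.
Qed.

Lemma wavelet_series_cvg t : series (fun j => B j t) n @[n --> \oo] --> f t.
Proof.
have [K K0 hK] := series_growth.
exact: (norm_bounded_series_cvg (hK t)).
Qed.

Lemma wavelet_series_growth : exists2 K, 0 < K & forall t,
  `|f t| <= K * (1 + `|t|).
Proof.
have [K K0 hK] := series_growth; exists K => // t.
apply: (cvgr_to_le (cvg_norm (wavelet_series_cvg (t := t)))); near=> n.
exact: le_trans (ler_norm_sum _ _ _) (hK t n).
Unshelve. all: by end_near. Qed.

Hypothesis psi_lip : forall y y', `|y - y'| <= 1 ->
  `|psi y - psi y'| <= D * `|y - y'| * (1 + `|y'|) ^- 3.

(** Relative to [b^n phi n], level [j] contributes at most a multiple of [scale_weight q b n j]. For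
    [j <= n] the smoothness of [psi] gains [2^-(n - j)] against a loss [b^-(n - j)], whence
    [q = (2 * b)^-1]. For [j > n] the two values are bounded separately: [2^j s] may be
    [2^(j - n) + 2] away from the node, which costs a factor linear in [j - n] through [lnw], and
    [phi_slow] costs another; hence the square in [scale_weight]. *)
Lemma wavelet_series_modulus t (phi : nat -> R) A : 0 <= A ->
  (forall j, 0 <= phi j) ->
  (forall j n, (j <= n)%N -> phi j <= phi n) ->
  (forall j n, (n <= j)%N -> phi j <= (j - n).+1%:R * phi n) ->
  (forall j, exists2 m, `|2 ^+ j * t - m%:~R| <= 2 &
     forall k, `|x j k| <= A * phi j * lnw `|(k - m)%:~R|) ->
  exists2 K, 0 < K & forall n s, `|s - t| <= 2 ^- n ->
    `|f s - f t| <= K * (b ^+ n * phi n).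
Proof.
move=> A0 phi0 phi_nd phi_slow near_t.
have D0 := decay_ge0 psi_decay; have b0 j := betaX_ge0 h j.
have bgt0 := beta_gt0 h; have bh := beta_gt_half h1; have b1 := beta_lt1 h0.
pose q := (2 * b)^-1.
have qb : q * (2 * b) = 1 by rewrite mulVf// gt_eqF//; lra.
have q0 : 0 < q by rewrite invr_gt0; lra.
have q1 : q < 1 by rewrite invf_lt1; lra.
have [S S0 hS] := sum_scale_weight_le (ltW q0) q1 bgt0 b1.
have l2 : 1 <= lnw 2 :> R by apply: lnw_ge1; lra.
have l23 : lnw 2 <= 3 :> R by have := lnw_le (ltW (@ltr0n R 2)); lra.
(* With [i = j - n], 176 covers [16 * (1 + lnw 2)] at the coarse scales and
   [16 * (6 + i) + 16 * 4 <= 176 * i.+1] at the fine ones. *)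
pose E := 176 * (A * D).
have E0 : 0 <= E by rewrite mulr_ge0// mulr_ge0.
exists (E * S + 1); first by have := mulr_ge0 E0 (ltW S0); lra.
move=> n s st.
have main j : `|B j s - B j t| <= E * (b ^+ n * phi n) * scale_weight q b n j.
  have [m tm xm] := near_t j.
  have Aphi : 0 <= A * phi j by rewrite mulr_ge0.
  rewrite /scale_weight; case: ifPn => [jn|]; last rewrite -ltnNge => nj.
    have p0 : (0 : R) < 2 ^+ j by rewrite exprn_gt0.
    have s1 : 2 ^+ j * `|s - t| <= 2 ^- (n - j).
      rewrite (le_trans (ler_wpM2l (ltW p0) st))//.
      rewrite -{1}(subnK jn) exprD invfM mulrCA mulfV ?mulr1// gt_eqF//.
    have s2 : (2 : R) ^- (n - j) <= 1.
      by rewrite invf_le1 ?exprn_gt0// exprn_ege1//; lra.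
    apply: (le_trans (block_dist_le h psi_decay psi_lip Aphi tm (le_trans s1 s2) xm)).
    have -> : q ^+ (n - j) = 2 ^- (n - j) * b ^- (n - j).
      by rewrite exprVn exprMn invfM.
    have -> : E * (b ^+ n * phi n) * (2 ^- (n - j) * b ^- (n - j)) =
        E * (b ^+ j * phi n * 2 ^- (n - j)).
      rewrite -{1}(subnK jn) exprD.
      have : b ^+ (n - j) != 0 by rewrite gt_eqF// exprn_gt0.
      have : (2 : R) ^+ (n - j) != 0 by rewrite gt_eqF// exprn_gt0.
      by move=> ? ?; field; apply/andP.
    apply: (@le_trans _ _ ((16 * (1 + lnw 2)) * (A * D) *
       (b ^+ j * phi j * (2 ^+ j * `|s - t|)))).
      by rewrite le_eqVlt; apply/orP; left; apply/eqP; ring.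
    apply: ler_pM; rewrite ?mulr_ge0//; [by lra| |].
      by apply: ler_wpM2r; [rewrite mulr_ge0|lra].
    apply: ler_pM; rewrite ?mulr_ge0//.
    by rewrite ler_wpM2l// phi_nd.
  have p0 : (0 : R) < 2 ^+ (j - n) by rewrite exprn_gt0.
  have sm : `|2 ^+ j * s - m%:~R| <= 2 ^+ (j - n) + 2.
    rewrite (_ : _ - _ = 2 ^+ j * (s - t) + (2 ^+ j * t - m%:~R)); last by ring.
    rewrite (le_trans (ler_normD _ _))// lerD// normrM ger0_norm//.
    rewrite -{1}(subnK (ltnW nj)) exprD -mulrA ler_piMr//.
    by rewrite mulrC -ler_pdivlMr ?mul1r// exprn_gt0.
  have r0 : (0 : R) <= 2 ^+ (j - n) + 2 by lra.
  have lr : lnw (2 ^+ (j - n) + 2) <= 5 + (j - n)%:R :> R.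
    have := lnw_add (ltW p0) (ltW (@ltr0n R 2)); have := lnw_expn2 R (j - n).
    by lra.
  have hs := block_le h psi_decay Aphi r0 sm xm.
  have ht := block_le h psi_decay Aphi (ltW (@ltr0n R 2)) tm xm.
  have Q0 : 0 <= A * phi j * (b ^+ j * D) by rewrite !mulr_ge0.
  apply: (@le_trans _ _ (E * (b ^+ j * phi j) * (j - n).+1%:R)).
    rewrite (le_trans (ler_normB _ _))//.
    rewrite (_ : E * _ * _ = A * phi j * (b ^+ j * D) * (176 * (j - n).+1%:R)); last first.
      by rewrite /E; ring.
    apply: (@le_trans _ _ (A * phi j * (b ^+ j * D) * (16 * (6 + (j - n)%:R) + 16 * 4))).
      have lr' : 1 + lnw (2 ^+ (j - n) + 2) <= 6 + (j - n)%:R :> R by lra.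
      have := ler_wpM2l Q0 lr'; have l24 : 1 + lnw 2 <= 4 :> R by lra.
      by have := ler_wpM2l Q0 l24; lra.
    rewrite ler_wpM2l// -natr1.
    by have : 0 <= (j - n)%:R :> R by []; lra.
  apply: (@le_trans _ _
      (E * (b ^+ (j - n + n) * ((j - n).+1%:R * phi n) * (j - n).+1%:R))).
    rewrite subnK ?(ltnW nj)// -[leLHS]mulrA; apply: ler_wpM2l => //.
    apply: ler_wpM2r => //; apply: ler_wpM2l => //.
    by apply: phi_slow; exact: ltnW.
  by rewrite le_eqVlt; apply/orP; left; apply/eqP; rewrite exprD; ring.
have cv : series (fun j => B j s) N - series (fun j => B j t) N @[N --> \oo]
    --> f s - f t.
  exact: cvgB (wavelet_series_cvg (t := s)) (wavelet_series_cvg (t := t)).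
have bp : 0 <= b ^+ n * phi n by rewrite mulr_ge0.
apply: (cvgr_to_le (cvg_norm cv)); near=> N.
rewrite /series/= -sumrB (le_trans (ler_norm_sum _ _ _))//.
apply: (@le_trans _ _ (\sum_(0 <= j < N) E * (b ^+ n * phi n) * scale_weight q b n j)).
  by apply: ler_sum => j _; exact: main.
rewrite -mulr_sumr.
apply: (@le_trans _ _ (E * (b ^+ n * phi n) * S)); last by nra.
by rewrite ler_wpM2l// mulr_ge0.
Unshelve. all: by end_near. Qed.

End Series.

(** * Weighted integrals *)

Section AffineChangeOfVariables.
Variable R : realType.
Local Notation mu := (@lebesgue_measure R).
Local Open Scope ereal_scope.

(** By uniqueness of Lebesgue measure, which agrees on half-open intervals with [a] times its image
    under [x |-> a x + b]. *)
Lemma ge0_integral_affine (a b : R) (g : R -> \bar R) : (0 < a)%R ->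
  measurable_fun [set: R] g -> (forall x, 0 <= g x) ->
  \int[mu]_x g x = a%:E * \int[mu]_x g (a * x + b)%R.
Proof.
move=> a0 mg g0; have a0' := ltW a0.
pose phi : measurableTypeR R -> measurableTypeR R := fun x => (a * x + b)%R.
have mphi : measurable_fun [set: measurableTypeR R] phi.
  by apply: measurable_funD => //; exact: measurable_funM.
pose m1 : {measure set (measurableTypeR R) -> \bar R} := pushforward mu phi.
pose m2 : {measure set (measurableTypeR R) -> \bar R} := mscale (NngNum a0') (m1 mphi).
have muE A : measurable A -> mu A = m2 A.
  apply: lebesgue_measure_unique => _ [[u v] _ <-].
  rewrite [RHS](_ : _ = a%:E * mu (phi @^-1` `]u, v])) //.
  rewrite (_ : phi @^-1` _ = `](u - b) / a, (v - b) / a]%classic)%R; last first.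
    apply/seteqP; split => x; rewrite /phi/= !in_itv/=;
      by rewrite ltr_pdivrMr// ler_pdivlMr// ltrBlDr lerBrDr mulrC.
  rewrite !lebesgue_measure_itv/= !lte_fin ltr_pM2r ?invr_gt0// ltrD2r.
  case: ifPn => uv; last by rewrite mule0.
  by rewrite -!EFinB -EFinM; congr EFin; field; rewrite gt_eqF.
rewrite (eq_measure_integral m2); last by move=> A mA _; exact: muE.
rewrite ge0_integral_mscale//=; congr (_ * _).
by rewrite (ge0_integral_pushforward mphi)// => y _.
Qed.

Lemma integrable_affine (a b : R) (g : R -> \bar R) : (0 < a)%R ->
  mu.-integrable setT g -> mu.-integrable setT (fun x => g (a * x + b)%R).
Proof.
move=> a0 /integrableP[mg ig].
have mphi : measurable_fun [set: R] (fun x => a * x + b : R)%R.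
  by apply: measurable_funD => //; exact: measurable_funM.
apply/integrableP; split; first exact: (measurableT_comp mg).
move: ig; rewrite (ge0_integral_affine b a0)//; last exact: measurableT_comp.
by rewrite !ltey; apply: contra_neq => ->; rewrite gt0_muley ?lte_fin.
Qed.

Lemma integral_affine (a b : R) (g : R -> \bar R) : (0 < a)%R ->
  mu.-integrable setT g ->
  \int[mu]_x g x = a%:E * \int[mu]_x g (a * x + b)%R.
Proof.
move=> a0 ig; have [mg _] := integrableP _ _ _ ig.
rewrite integralE [X in _ = _ * X]integralE.
have ep : (fun x => g (a * x + b)%R)^\+ = (fun x => g^\+ (a * x + b)%R).
  by apply/funext => x; rewrite !funeposE.
have en : (fun x => g (a * x + b)%R)^\- = (fun x => g^\- (a * x + b)%R).
  by apply/funext => x; rewrite !funenegE.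
rewrite ep en (ge0_integral_affine b a0 (measurable_funepos mg))//.
rewrite (ge0_integral_affine b a0 (measurable_funeneg mg))//.
rewrite [RHS]muleBr//; apply: fin_num_adde_defl; rewrite fin_numN.
by have := integrable_neg_fin_num measurableT (integrable_affine b a0 ig); rewrite en; apply.
Qed.

End AffineChangeOfVariables.

Lemma integrable_oneDsqrV (R : realType) :
  (@lebesgue_measure R).-integrable setT (fun x => ((1 + x ^+ 2)^-1)%:E).
Proof.
have c : continuous (fun x : R => (1 + x ^+ 2)^-1) by exact: continuous_oneDsqrV.
have p0 (x : R) : 0 <= (1 + x ^+ 2)^-1.
  by rewrite invr_ge0 addr_ge0// sqr_ge0.
apply/integrableP; split.
  by apply/measurable_EFinP; exact: continuous_measurable_fun.
under eq_integral do rewrite gee0_abs ?lee_fin//.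
rewrite ge0_symfun_integralT//; last by move=> x /=; rewrite sqrrN.
rewrite (_ : [set x | _] = `[0, +oo[%classic); last first.
  by apply/seteqP; split => x/=; rewrite in_itv/= andbT.
by rewrite (integral0y_oneDsqr R) -EFinM ltry.
Qed.

Section WeightedFunctional.
Variables (R : realType) (w : R -> R).
Local Notation mu := (@lebesgue_measure R).
Hypothesis mw : measurable_fun [set: R] w.
Hypothesis iw : mu.-integrable setT (fun x => ((1 + `|x|) * w x)%:E).

(** The series is only known to grow at most linearly, whence this class of functions and the factor
    [1 + |x|] in the integrability of [w]. *)
Definition linear_growth (g : R -> R) :=
  measurable_fun [set: R] g /\ exists K, forall x, `|g x| <= K * (1 + `|x|).

Definition wint (g : R -> R) : R := \int[mu]_x (g x * w x).

Let dom K : mu.-integrable setT (fun x => (K * (1 + `|x|) * `|w x|)%:E).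
Proof.
have := integrableZl measurableT K (integrable_abse iw).
apply: eq_integrable => // x _ /=.
by rewrite -EFinM normrM (ger0_norm (addr_ge0 _ _))// mulrA.
Qed.

Lemma integrable_linear_growth g : linear_growth g ->
  mu.-integrable setT (EFin \o (fun x => g x * w x)).
Proof.
move=> [mg [K gK]]; apply: le_integrable (dom K) => //.
  by apply/measurable_EFinP; exact: measurable_funM.
move=> x _ /=; rewrite lee_fin normrM.
rewrite [leRHS]ger0_norm; first by rewrite ler_wpM2r.
by rewrite mulr_ge0// (le_trans _ (gK x)).
Qed.

Lemma wint_sum (n : nat) (G : nat -> R -> R) : (forall i, linear_growth (G i)) ->
  wint (fun x => \sum_(0 <= i < n) G i x) = \sum_(0 <= i < n) wint (G i).
Proof.
move=> hG; rewrite /wint /Rintegral.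
under eq_integral do rewrite mulr_suml -sumEFin.
rewrite integral_sum//; last by move=> i; exact: integrable_linear_growth.
rewrite -sum_fine// => i _; apply: integrable_fin_num => //.
exact: integrable_linear_growth.
Qed.

Lemma wintZ c g : linear_growth g -> wint (fun x => c * g x) = c * wint g.
Proof.
move=> hg; rewrite /wint -RintegralZl//; last exact: integrable_linear_growth.
by apply: eq_Rintegral => x _; rewrite mulrA.
Qed.

Lemma wintD g1 g2 : linear_growth g1 -> linear_growth g2 ->
  wint (fun x => g1 x + g2 x) = wint g1 + wint g2.
Proof.
move=> h1 h2; rewrite /wint -RintegralD//; try exact: integrable_linear_growth.
by apply: eq_Rintegral => x _; rewrite mulrDl.
Qed.

Lemma wintB g1 g2 : linear_growth g1 -> linear_growth g2 ->
  wint (fun x => g1 x - g2 x) = wint g1 - wint g2.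
Proof.
move=> h1 h2; rewrite /wint -RintegralB//; try exact: integrable_linear_growth.
by apply: eq_Rintegral => x _; rewrite mulrBl.
Qed.

(** Dominated convergence. It serves twice: to exchange the pairing with the sum over [k], and with
    the sum over [j]. *)
Lemma wint_cvg (G : nat -> R -> R) g K : (forall n, measurable_fun [set: R] (G n)) ->
  (forall n x, `|G n x| <= K * (1 + `|x|)) ->
  (forall x, G n x @[n --> \oo] --> g x) ->
  linear_growth g /\ wint (G n) @[n --> \oo] --> wint g.
Proof.
move=> mG GK Gg.
have hg : linear_growth g.
  split; first by apply: (measurable_fun_cvg mG) => x _.
  exists K => x; apply: (cvgr_to_le (cvg_norm (Gg x))); near=> n; exact: GK.
split => //.
have [||||| _ _] := @dominated_convergence _ _ _ mu setT measurableT
  (fun n x => (G n x * w x)%:E) (fun x => (g x * w x)%:E)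
  (fun x => (K * (1 + `|x|) * `|w x|)%:E).
- by move=> n; apply/measurable_EFinP; exact: measurable_funM (mG n) mw.
- by apply/measurable_EFinP; apply: measurable_funM => //; case: hg.
- apply: aeW => x _; apply: cvg_EFin; first exact: nearW.
  by apply: cvgM (Gg x) _; exact: cvg_cst.
- exact: dom.
- apply: aeW => x n _; rewrite /= lee_fin normrM; exact: ler_wpM2r.
rewrite -[X in _ --> X -> _]fineK; first exact: fine_cvg.
exact: integrable_fin_num (integrable_linear_growth hg).
Unshelve. all: by end_near. Qed.

End WeightedFunctional.

(** * Regularity and decay of the wavelets *)

Section Localization.
Variable R : realType.
Implicit Types (f g psi : R -> R) (y D : R).

Lemma one_add_expr_le y n : 0 <= y -> (1 + y) ^+ n <= 2 ^+ n * (1 + y ^+ n).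
Proof.
move=> y0; have yn : 0 <= y ^+ n by rewrite exprn_ge0.
have [y1|/ltW y1] := leP y 1.
  apply: (@le_trans _ _ (2 ^+ n)); last by rewrite ler_peMr ?exprn_ge0//; lra.
  by apply: lerXn2r; rewrite ?nnegrE; lra.
apply: (@le_trans _ _ ((2 * y) ^+ n)).
  by apply: lerXn2r; rewrite ?nnegrE; lra.
by rewrite exprMn ler_wpM2l ?exprn_ge0//; lra.
Qed.

Lemma schwartz_decay g n p : schwartz g ->
  exists2 D, 0 <= D & forall y, `|derive1n n g y| <= D * (1 + `|y|) ^- p.
Proof.
move=> [_ hg]; have [C0 hC0] := hg 0%N n; have [C1 hC1] := hg p n.
have D0 : 0 <= C0 + C1.
  by apply: addr_ge0; [exact: le_trans (hC0 0)|exact: le_trans (hC1 0)].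
exists (2 ^+ p * (C0 + C1)); first by rewrite mulr_ge0// exprn_ge0.
move=> y; rewrite ler_pdivlMr; last by rewrite exprn_gt0// ltr_pwDl.
have := one_add_expr_le p (normr_ge0 y).
move=> /(ler_wpM2l (normr_ge0 (derive1n n g y)))/le_trans; apply.
rewrite mulrCA ler_wpM2l ?exprn_ge0// mulrDr mulr1.
have := hC0 y; have := hC1 y; rewrite !normrM expr0 normr1 mul1r normrX.
by rewrite [`|y| ^+ p * _]mulrC; lra.
Qed.

Lemma compactly_supported_bounded g : compactly_supported g ->
  exists2 B, 0 <= B & forall y, B < `|y| -> g y = 0.
Proof.
move=> /compact_bounded[M [_ hM]].
exists (`|M| + 1); first by rewrite addr_ge0.
move=> y yM; apply/eqP; apply/negPn/negP => gy.
have M1 : M < `|M| + 1 by have := ler_norm M; lra.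
have := hM _ M1 y.
by move=> /(_ (@subset_closure _ [set x | g x != 0] y gy)) /=; rewrite leNgt yM.
Qed.

Lemma continuous_compactly_supported_decay g B p : 0 <= B -> continuous g ->
  (forall y, B < `|y| -> g y = 0) ->
  exists2 D, 0 <= D & forall y, `|g y| <= D * (1 + `|y|) ^- p.
Proof.
move=> B0 cg gB; have BB : - B <= B by lra.
have [|c _ hc] := @EVT_max R (fun y => `|g y|) (- B) B BB.
  by apply: continuous_subspaceT => y; exact: cvg_norm (cg y).
exists (`|g c| * (1 + B) ^+ p).
  by rewrite mulr_ge0// exprn_ge0// addr_ge0.
move=> y; have [yB|yB] := leP `|y| B; last first.
  rewrite gB// normr0 mulr_ge0 ?invr_ge0 ?exprn_ge0 ?addr_ge0//.
  by rewrite mulr_ge0// exprn_ge0// addr_ge0.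
rewrite ler_pdivlMr; last by rewrite exprn_gt0// ltr_pwDl.
apply: ler_pM => //.
  by apply: hc; rewrite in_itv/= -ler_norml.
by apply: lerXn2r; rewrite ?nnegrE ?addr_ge0// lerD2l.
Qed.

(** The mean value theorem gives a point [c] within distance 1 of [y']; then
    [1 + |y'| <= 2 * (1 + |c|)], and the cube of this 2 is the 8. *)
Lemma lipschitz_decay psi D : (forall y : R, derivable psi y 1) ->
  (forall y, `|derive1 psi y| <= D * (1 + `|y|) ^- 3) ->
  forall y y', `|y - y'| <= 1 ->
    `|psi y - psi y'| <= 8 * D * `|y - y'| * (1 + `|y'|) ^- 3.
Proof.
move=> dpsi hD.
have D0 : 0 <= D by have := le_trans (normr_ge0 _) (hD 0); rewrite pmulr_lge0.
have key a b : a <= b -> exists2 c, c \in `[a, b] & psi b - psi a = derive1 psi c * (b - a).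
  move=> ab; apply: MVT_segment => //.
    by move=> x _; rewrite derive1E; exact: derivableP (dpsi x).
  by apply: derivable_within_continuous => x _; exact: dpsi.
move=> y y' yy'.
have [c cy' ->] : exists2 c, `|c - y'| <= 1 & `|psi y - psi y'| = `|derive1 psi c| * `|y - y'|.
  have [ab|/ltW ab] := leP y y'.
    have [c + e] := key _ _ ab; rewrite in_itv/= => /andP[c1 c2].
    move: yy'; rewrite distrC ger0_norm ?subr_ge0// => yy'.
    exists c; first by rewrite ler_norml; lra.
    by rewrite distrC e normrM (ger0_norm (_ : 0 <= y' - y)) ?subr_ge0.
  have [c + e] := key _ _ ab; rewrite in_itv/= => /andP[c1 c2].
  move: yy'; rewrite ger0_norm ?subr_ge0// => yy'.
  exists c; first by rewrite ler_norml; lra.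
  by rewrite e normrM (ger0_norm (_ : 0 <= y - y')) ?subr_ge0.
rewrite mulrAC ler_wpM2r// (le_trans (hD c))//.
have cn : 1 + `|y'| <= 2 * (1 + `|c|).
  have : `|y'| <= `|c| + 1.
    rewrite -(subrK c y') addrC (le_trans (ler_normD _ _))// lerD2l distrC//.
  by have := normr_ge0 c; lra.
rewrite ler_pdivlMr; last by rewrite exprn_gt0// ltr_pwDl.
rewrite mulrAC ler_pdivrMr; last by rewrite exprn_gt0// ltr_pwDl.
rewrite (_ : 8 * D * _ = D * (2 * (1 + `|c|)) ^+ 3); last by ring.
rewrite ler_wpM2l//.
by apply: lerXn2r; rewrite ?nnegrE ?mulr_ge0 ?addr_ge0.
Qed.

Lemma wavelet_regularity psi : (forall y : R, derivable psi y 1) ->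
  continuous (derive1 psi) -> schwartz psi \/ compactly_supported psi ->
  exists D, (forall y, `|psi y| <= D * (1 + `|y|) ^- 3) /\
    (forall y y', `|y - y'| <= 1 ->
      `|psi y - psi y'| <= D * `|y - y'| * (1 + `|y'|) ^- 3).
Proof.
move=> dpsi cpsi' loc.
suff [D1 [D2 [D10 D20 h1 h2]]] : exists D1 D2, [/\ 0 <= D1, 0 <= D2,
    forall y, `|psi y| <= D1 * (1 + `|y|) ^- 3 &
    forall y, `|derive1 psi y| <= D2 * (1 + `|y|) ^- 3].
  exists (D1 + 8 * D2); split.
    move=> y; rewrite (le_trans (h1 y))// ler_wpM2r//.
    by rewrite lerDl mulr_ge0.
  move=> y y' /(lipschitz_decay dpsi h2)/le_trans; apply.
  rewrite ler_wpM2r ?invr_ge0 ?exprn_ge0 ?addr_ge0//.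
  by rewrite ler_wpM2r// lerDr.
case: loc => [spsi|cpsi].
  have [D1 D10 h1] := schwartz_decay 0 3 spsi.
  have [D2 D20 h2] := schwartz_decay 1 3 spsi.
  by exists D1, D2.
have [B B0 psiB] := compactly_supported_bounded cpsi.
have contpsi : continuous psi.
  by move=> y; apply: differentiable_continuous; exact/derivable1_diffP.
have psi'B y : B < `|y| -> derive1 psi y = 0.
  move=> yB; rewrite derive1E -[RHS](derive_cst 0 y 1); apply: near_eq_derive.
  near=> z; rewrite psiB//; near: z.
  by apply: (@cvgr_norm_gt _ _ _ (nbhs y) _ id y) => //; exact: cvg_id.
have [D1 D10 h1] := continuous_compactly_supported_decay 3 B0 contpsi psiB.
have [D2 D20 h2] := continuous_compactly_supported_decay 3 B0 cpsi' psi'B.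
by exists D1, D2.
Unshelve. all: by end_near. Qed.

Local Notation mu := (@lebesgue_measure R).

(** A Schwartz function decays like [(1 + |y|)^-4], enough against the square. In the compactly
    supported case no boundedness is at hand, only [L^2]: on the support, [|psit| <= 1 + psit^2],
    and 1 is dominated by [(1 + B^2) / (1 + y^2)]. *)
Lemma wavelet_moment psit : psit \in Lfun mu 2%:E ->
  schwartz psit \/ compactly_supported psit ->
  measurable_fun [set: R] psit /\
  mu.-integrable setT (fun y => ((3 + `|y|) ^+ 2 * `|psit y|)%:E).
Proof.
move=> L2 loc.
have mpsi : measurable_fun [set: R] psit.
  by move: L2; rewrite inE => /andP[]; rewrite inE.
split => //.
have mw : measurable_fun [set: R] (fun y => ((3 + `|y|) ^+ 2 * `|psit y|)%:E).
  apply/measurable_EFinP; apply: measurable_funM.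
    by apply: measurable_funX; apply: measurable_funD => //; exact: measurableT_comp.
  exact: measurableT_comp.
have p0 y : 0 < 1 + y ^+ 2 :> R by rewrite ltr_pwDl// sqr_ge0.
case: loc => [spsi|cpsi].
  have [D D0 hD] := schwartz_decay 0 4 spsi.
  have := integrableZl measurableT (9 * D) (integrable_oneDsqrV R).
  apply: le_integrable => // y _; rewrite /= lee_fin.
  have y0 := normr_ge0 y; have yD : 0 < (1 + `|y|) ^+ 4 by rewrite exprn_gt0; lra.
  rewrite [leLHS]ger0_norm ?mulr_ge0 ?exprn_ge0 ?addr_ge0//.
  rewrite [leRHS]ger0_norm ?mulr_ge0 ?invr_ge0 ?(ltW (p0 y))//.
  apply: (@le_trans _ _ ((3 + `|y|) ^+ 2 * (D * (1 + `|y|) ^- 4))).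
    by rewrite ler_wpM2l ?exprn_ge0 ?addr_ge0//; exact: hD.
  rewrite ler_pdivlMr// mulrA mulrAC ler_pdivrMr//.
  rewrite (_ : 9 * D * _ = D * ((3 * (1 + `|y|)) ^+ 2 * (1 + `|y|) ^+ 2)); last by ring.
  rewrite mulrAC [leLHS]mulrC; apply: ler_wpM2l => //.
  apply: ler_pM; rewrite ?sqr_ge0 ?(ltW (p0 _))//.
    by apply: lerXn2r; rewrite ?nnegrE; lra.
  by rewrite -[y ^+ 2]real_normK ?num_real//; nra.
have [B B0 psiB] := compactly_supported_bounded cpsi.
have i1 := integrableZl measurableT (1 + B ^+ 2) (integrable_oneDsqrV R).
have i2 := integrableD measurableT i1 (Lfun2_integrable_sqr L2).
have := integrableZl measurableT ((3 + B) ^+ 2) i2.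
apply: le_integrable => // y _; rewrite /= lee_fin.
have [yB|yB] := leP `|y| B; last by rewrite psiB// normr0 mulr0 normr0.
have B2 : 0 <= (1 + B ^+ 2) * (1 + y ^+ 2)^-1.
  by rewrite mulr_ge0 ?addr_ge0 ?sqr_ge0// invr_ge0 ltW ?p0.
rewrite [leLHS]ger0_norm ?mulr_ge0 ?exprn_ge0 ?addr_ge0//.
rewrite [leRHS]ger0_norm; last by rewrite mulr_ge0 ?sqr_ge0// addr_ge0// sqr_ge0.
rewrite ler_pM ?sqr_ge0//; first by apply: lerXn2r; rewrite ?nnegrE; have := normr_ge0 y; lra.
have : 1 <= (1 + B ^+ 2) * (1 + y ^+ 2)^-1.
  rewrite ler_pdivlMr// mul1r lerD2l -[y ^+ 2]real_normK ?num_real//.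
  by apply: lerXn2r; rewrite ?nnegrE.
rewrite -[psit y ^+ 2]real_normK ?num_real//.
by have := sqr_ge0 (`|psit y| - 1); nra.
Qed.

End Localization.

Lemma dyadic_scale {R : archiRealFieldType} (r : R) n0 : 0 < r -> r <= 2 ^- n0 ->
  exists2 n, (n0 <= n)%N & 2 ^- n.+1 < r /\ r <= 2 ^- n.
Proof.
move=> r0 rn0.
have [N hN] : exists N, 2 ^- N < r.
  exists (Num.truncn r^-1).+1; rewrite invf_plt ?posrE ?exprn_gt0//.
  have := truncnS_gt r^-1 => /lt_le_trans; apply.
  by rewrite -natrX ler_nat ltnW// ltn_expl.
case: (ex_minnP (ex_intro (fun N => 2 ^- N < r) N hN)) => p hp minp.
have np : (n0 < p)%N.
  rewrite ltnNge; apply/negP => pn0; move: hp; rewrite ltNge.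
  by rewrite (le_trans rn0)// lef_pV2 ?posrE ?exprn_gt0// ler_weXn2l// ler1n.
case: p np hp minp => // n nn0 hp minp; exists n => //; split => //.
by rewrite leNgt; apply/negP => /minp; rewrite ltnn.
Qed.

Lemma zpart_delta {R : realType} (a : int -> R) (m : int) N : (`|m| < N)%N ->
  zpart N (fun k => a k * (k == m)%:R) = a m.
Proof.
have delta0 (G : nat -> int) n : (forall k, G k != m) ->
    \sum_(0 <= k < n) a (G k) * (G k == m)%:R = 0.
  by move=> Gm; rewrite big1// => k _; rewrite (negbTE (Gm k)) mulr0.
have delta1 (G : nat -> int) (p : nat) n : (p < n)%N -> G p = m -> injective G ->
    \sum_(0 <= k < n) a (G k) * (G k == m)%:R = a m.
  move=> pn Gp iG; rewrite (bigD1_seq p) ?mem_index_iota ?iota_uniq//=.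
  rewrite Gp eqxx mulr1 big1 ?addr0// => k kp.
  by rewrite -Gp (inj_eq iG) (negbTE kp) mulr0.
rewrite /zpart; case: m delta0 delta1 => p delta0 delta1 pN.
  by rewrite (delta1 Posz p)// ?delta0 ?addr0// => // k l [].
rewrite delta0// add0r; apply: (delta1 (fun k : nat => - k.+1%:Z) p) => //.
  exact: leq_trans pN.
by move=> k l /oppr_inj [].
Qed.

(** Origin of the weight [3 + |y|] in the moment of the dual wavelet: distances to [t] become
    distances to a node at most 2 away from [2^j t]. *)
Lemma shifted_dist_le {R : realDomainType} (a t m y : R) : 0 <= a ->
  `|a * t - m| <= 2 -> 1 + a * `|y - t| <= 3 + `|a * y - m|.
Proof.
move=> a0 tm; have : `|a * (y - t)| <= `|a * y - m| + `|a * t - m|.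
  by rewrite (_ : a * (y - t) = (a * y - m) - (a * t - m)) ?ler_normB//; ring.
by rewrite normrM (ger0_norm a0); lra.
Qed.

(** * Coefficients in terms of increments *)

Section Coefficients.
Variables (R : realType) (h : R) (psi psit : R -> R) (x : nat -> int -> R).
Hypotheses (h0 : 0 < h) (h1 : h < 1).
Variable D : R.
Hypothesis psi_decay : forall y, `|psi y| <= D * (1 + `|y|) ^- 3.
Variable C : R.
Hypotheses (C0 : 0 <= C) (xC : coef_bound x C).
Hypothesis cpsi : continuous psi.
Local Notation mu := (@lebesgue_measure R).
Hypothesis mpsit : measurable_fun [set: R] psit.
Hypothesis ipsit :
  mu.-integrable setT (fun y => ((3 + `|y|) ^+ 2 * `|psit y|)%:E).
Hypothesis psit0 : (\int[mu]_y (psit y)%:E)%E = 0%:E.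
Hypothesis biorth : forall jk jk' : int * int,
  (\int[mu]_x (wavelet_atom psi jk x * wavelet_atom psit jk' x)%:E)%E
    = ((jk == jk')%:R)%:E.
Implicit Types (s t y : R) (i j n : nat) (m k : int).

Local Notation b := (beta h).
Local Notation B := (block h psi x).
Local Notation f := (wavelet_series h psi x).

Let wt j m y : R := psit (2 ^+ j * y - m%:~R).

Let mwt j m : measurable_fun [set: R] (wt j m).
Proof.
by apply: (measurableT_comp mpsit); apply: measurable_funB => //.
Qed.

Let moment : R := fine (\int[mu]_y ((3 + `|y|) ^+ 2 * `|psit y|)%:E).

Let iwt3 j m : mu.-integrable setT
  (fun y => ((3 + `|2 ^+ j * y - m%:~R|) ^+ 2 * `|wt j m y|)%:E).
Proof. by have := integrable_affine (- m%:~R) (exprn_gt0 j (@ltr0n R 2)) ipsit. Qed.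

Let iwt j m : mu.-integrable setT (fun y => ((1 + `|y|) * wt j m y)%:E).
Proof.
have := integrableZl measurableT (1 + `|m%:~R : R|) (iwt3 j m).
apply: le_integrable => //.
  apply/measurable_EFinP; apply: measurable_funM; last exact: mwt.
  by apply: measurable_funD => //; exact: measurableT_comp.
move=> y _ /=; rewrite lee_fin; set z := 2 ^+ j * y - m%:~R.
rewrite [leRHS]ger0_norm ?mulr_ge0// normrM mulrA ler_wpM2r//.
rewrite [leLHS]ger0_norm//.
have p1 : (1 : R) <= 2 ^+ j by rewrite exprn_ege1//; lra.
have : `|y| <= `|z| + `|m%:~R : R|.
  apply: (@le_trans _ _ (2 ^+ j * `|y|)); first by rewrite ler_peMl.
  rewrite -[2 ^+ j * _](_ : `|2 ^+ j * y| = _); last by rewrite normrM ger0_norm.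
  by rewrite -{1}(subrK m%:~R (2 ^+ j * y)) ler_normD.
by have := normr_ge0 z; have := normr_ge0 (m%:~R : R); nra.
Qed.

(** The [L^2] normalisation of the atoms, absent both from the series and from [wt]. *)
Let c i : R := 2 `^ (i%:R / 2).

Let c_gt0 i : 0 < c i. Proof. exact: powR_gt0. Qed.

Let c_sqr i : c i ^+ 2 = 2 ^+ i.
Proof.
rewrite /c -powR_mulrn ?powR_ge0// -powRrM divfK// powR_mulrn//.
Qed.

Let psi_lg i k : linear_growth (fun y => psi (2 ^+ i * y - k%:~R)).
Proof.
split.
  apply: measurableT_comp; first exact: continuous_measurable_fun.
  by apply: measurable_funB => //; exact: measurable_funM.
exists D => y; have D0 := decay_ge0 psi_decay.
rewrite (le_trans (psi_decay _))// ler_wpM2l//.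
rewrite (@le_trans _ _ 1)// ?lerDl//.
by rewrite invf_le1 ?exprn_gt0 ?ltr_pwDl// exprn_ege1// lerDl.
Qed.

Let wint_psi i k j m :
  wint (wt j m) (fun y => psi (2 ^+ i * y - k%:~R)) =
  ((i == j) && (k == m))%:R / (c i * c j).
Proof.
have := biorth (Posz i, k) (Posz j, m).
set I := (\int[mu]_x _)%E => Ieq.
have cc0 : c i * c j != 0 by rewrite gt_eqF// mulr_gt0 ?c_gt0.
have : fine I = c i * c j * wint (wt j m) (fun y => psi (2 ^+ i * y - k%:~R)).
  rewrite /wint -RintegralZl//; last first.
    exact: (integrable_linear_growth (mwt j m) (iwt j m) (psi_lg i k)).
  congr fine; apply: eq_integral => y _; congr EFin.
  by rewrite /wavelet_atom /= /wt /c; ring.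
rewrite Ieq /= -[(Posz i, k) == (Posz j, m)]/((i == j) && (k == m)).
by move=> ->; rewrite mulrAC mulfV ?mul1r.
Qed.

(** Biorthogonality, applied term by term, makes the pairing with [zpart N] constant as soon as
    [N > |m|]; dominated convergence carries the value over to the whole block. *)
Lemma wint_block i j m : linear_growth (B i) /\
  wint (wt j m) (B i) = (i == j)%:R * (x j m * b ^+ j) / 2 ^+ j.
Proof.
have D0 := decay_ge0 psi_decay.
have l2 : 1 <= lnw 2 :> R by apply: lnw_ge1; lra.
pose A (y : R) := Num.sqrt (5 * C) * (1 + `|y|) * Num.sqrt i.+1%:R.
have A0 y : 0 <= A y by rewrite !mulr_ge0.
have near y : `|2 ^+ i * y - (Num.floor (2 ^+ i * y))%:~R| <= 2.
  by have := near_floor i y; lra.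
have tb y := block_term_le h psi_decay (A0 y) (ltW (@ltr0n R 2)) (near y)
  (fun k => coef_bound_near C0 xC k (near y)).
have lgterm k : linear_growth (fun y => block_term h psi x i y k).
  have [mp [K hK]] := psi_lg i k; split; first exact: measurable_funM.
  exists (`|x i k * 2 `^ (- h * i%:R)| * K) => y.
  by rewrite normrM -mulrA ler_wpM2l.
have wterm k : wint (wt j m) (fun y => block_term h psi x i y k) =
    x i k * b ^+ i * (((i == j) && (k == m))%:R / (c i * c j)).
  by rewrite -wint_psi -betaX wintZ//; exact: psi_lg.
pose K := 16 * (Num.sqrt (5 * C) * Num.sqrt i.+1%:R * (b ^+ i * D) * (1 + lnw 2)).
have zb N y : `|zpart N (block_term h psi x i y)| <= K * (1 + `|y|).
  apply: (le_trans (zpart_le (tb y) N)).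
  by rewrite le_eqVlt; apply/orP; left; apply/eqP; rewrite /K /A; ring.
have lgp (s : nat -> int) n :
    linear_growth (fun y => \sum_(0 <= k < n) block_term h psi x i y (s k)).
  split; first by apply: measurable_sum => k; case: (lgterm (s k)).
  exists (\sum_(0 <= k < n) `|x i (s k) * 2 `^ (- h * i%:R)| * D) => y.
  rewrite mulr_suml (le_trans (ler_norm_sum _ _ _))//; apply: ler_sum => k _.
  rewrite normrM -mulrA ler_wpM2l// (le_trans (psi_decay _))// ler_wpM2l//.
  rewrite (@le_trans _ _ 1)// ?lerDl//.
  by rewrite invf_le1 ?exprn_gt0 ?ltr_pwDl// exprn_ege1// lerDl.
have mz N : measurable_fun [set: R] (fun y => zpart N (block_term h psi x i y)).
  by apply: measurable_funD; [case: (lgp Posz N)|case: (lgp (fun k : nat => - k.+1%:Z) N)].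
have [lgB cvB] := wint_cvg (mwt j m) (iwt j m) mz zb (fun y => zpart_cvg (tb y)).
split => //; apply: (cvg_unique _ cvB) => //.
apply: cvg_near_cst; near=> N.
transitivity (zpart N (fun k => x i k * b ^+ i * (i == j)%:R / (c i * c j) *
    (k == m)%:R)).
  rewrite /zpart wintD; [|exact: mwt|exact: iwt|exact: (lgp Posz)|].
    rewrite (wint_sum (mwt j m) (iwt j m))//.
    rewrite (wint_sum (mwt j m) (iwt j m))//.
    by congr (_ + _); apply: eq_bigr => k _; rewrite wterm -mulnb natrM; ring.
  exact: (lgp (fun k : nat => - k.+1%:Z)).
rewrite (zpart_delta (fun k => x i k * b ^+ i * (i == j)%:R / (c i * c j))); last first.
  by near: N; exists `|m|.+1.
have [->|ij] := eqVneq i j; last by rewrite !mulr0 !mul0r.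
by rewrite -expr2 c_sqr mulr1 mul1r.
Unshelve. all: by end_near. Qed.

Lemma wint_series j m : linear_growth f /\
  wint (wt j m) f = x j m * b ^+ j / 2 ^+ j.
Proof.
have [K K0 hK] := series_growth h0 psi_decay C0 xC.
have lgB i := (wint_block i j m).1.
have ms n : measurable_fun [set: R] (fun y => series (fun i => B i y) n).
  by apply: measurable_sum => i; case: (lgB i).
have [lgf cvf] := wint_cvg (mwt j m) (iwt j m) ms
  (fun n y => le_trans (ler_norm_sum _ _ _) (hK y n))
  (fun y => wavelet_series_cvg h0 psi_decay C0 xC (t := y)).
split => //; apply: (cvg_unique _ cvf) => //.
apply: cvg_near_cst; near=> N.
rewrite /series/= (wint_sum (mwt j m) (iwt j m))//.
rewrite (bigD1_seq j) ?mem_index_iota ?iota_uniq//=; last by near: N; exists j.+1.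
rewrite (wint_block j j m).2 eqxx mul1r big1 ?addr0// => i ij.
by rewrite (wint_block i j m).2 (negbTE ij) !mul0r.
Unshelve. all: by end_near. Qed.

(* The vanishing mean of the dual wavelet lets one subtract [f t], so that a
   coefficient located near [t] is controlled by the increments of [f] at [t]. *)
Lemma coef_le t j m K : `|2 ^+ j * t - m%:~R| <= 2 ->
  (forall y, `|f y - f t| <= K * (1 + 2 ^+ j * `|y - t|) ^+ 2) ->
  `|x j m| * b ^+ j <= K * moment.
Proof.
move=> tm fK.
have K0 : 0 <= K.
  by have := le_trans (normr_ge0 _) (fK t); rewrite pmulr_lge0// subrr normr0 mulr0 addr0 expr1n.
have [lgf wf] := wint_series j m.
have p0 : (0 : R) < 2 ^+ j by rewrite exprn_gt0.
have lgc : linear_growth (fun _ => f t).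
  split => //; exists `|f t| => y; rewrite ler_peMr// lerDl//.
have w0 : wint (wt j m) (fun _ => f t) = 0.
  rewrite /wint RintegralZl//; last first.
    have lg1 : linear_growth (cst 1 : R -> R).
      by split => //; exists 1 => y; rewrite normr1 mul1r lerDl.
    have := integrable_linear_growth (mwt j m) (iwt j m) lg1.
    by apply: eq_integrable => // y _; rewrite /= mul1r.
  have ip : mu.-integrable setT (EFin \o psit).
    apply: le_integrable ipsit => //; first exact/measurable_EFinP.
    move=> y _ /=; rewrite lee_fin [leRHS]ger0_norm ?mulr_ge0 ?sqr_ge0//.
    by rewrite ler_peMl// exprn_ege1//; have := normr_ge0 y; lra.
  have := integral_affine (- m%:~R) p0 ip; rewrite psit0.
  move=> /esym/eqP; rewrite mule_eq0 eqe gt_eqF//= => /eqP.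
  by rewrite /Rintegral => ->; rewrite mulr0.
have E : x j m * b ^+ j = 2 ^+ j * wint (wt j m) (fun y => f y - f t).
  rewrite wintB//.
  by rewrite w0 subr0 wf; field; rewrite gt_eqF.
rewrite -[_ * b ^+ j](_ : `|x j m * b ^+ j| = _); last first.
  by rewrite normrM (ger0_norm (betaX_ge0 _ _)).
rewrite E normrM ger0_norm//.
have iwK : mu.-integrable setT
    (EFin \o (fun y => K * ((3 + `|2 ^+ j * y - m%:~R|) ^+ 2 * `|wt j m y|))).
  by have := integrableZl measurableT K (iwt3 j m); apply: eq_integrable.
have lgfc : linear_growth (fun y => f y - f t).
  case: lgf => mf [K1 hK1]; split; first exact: measurable_funB.
  exists (K1 + `|f t|) => y; rewrite (le_trans (ler_normB _ _))// mulrDl lerD//.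
  by rewrite ler_peMr// lerDl.
have iwf := integrable_linear_growth (mwt j m) (iwt j m) lgfc.
have near_y (y : R) := shifted_dist_le y (ltW p0) tm.
rewrite (_ : moment = 2 ^+ j * \int[mu]_y ((3 + `|2 ^+ j * y - m%:~R|) ^+ 2 * `|wt j m y|)).
  rewrite mulrCA; apply: ler_wpM2l; [exact: ltW|rewrite /wint].
  rewrite (le_trans (le_normr_Rintegral measurableT iwf))// -RintegralZl//.
  apply: le_Rintegral => //.
    exact: integrable_norm iwf.
  move=> y _; rewrite normrM mulrA ler_wpM2r// (le_trans (fK y))// ler_wpM2l//.
  by apply: lerXn2r (near_y y); rewrite nnegrE addr_ge0// mulr_ge0// ltW.
  exact: (iwt3 j m).
rewrite /moment; have -> := integral_affine (- m%:~R) p0 ipsit.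
by rewrite fineM// integrable_fin_num.
Qed.

(** [coef_le] wants a global bound, here [|f y - f t| <= 2 e' b^j phi j (1 + 2^j |y - t|)^2], while
    the hypothesis is local. Within [2^-j] of [t] it applies directly. At an intermediate scale
    [2^-n], one uses [b^n <= b^j 2^(j - n)], a consequence of [b > 1/2], and
    [2^(j - n) <= 2 * 2^j |y - t|]. Beyond [2^-n0] the linear growth of [f] gives
    [L |y - t|^2 = L 4^-j (2^j |y - t|)^2], and [L 4^-j <= e' b^j] for large [j]. *)
Lemma coef_small_of_increments t (phi : nat -> R) :
  (forall j, 1 <= phi j) -> (forall i j, (i <= j)%N -> phi i <= phi j) ->
  (forall e, 0 < e -> exists n0, forall n, (n0 <= n)%N -> forall s,
     `|s - t| <= 2 ^- n -> `|f s - f t| <= e * (b ^+ n * phi n)) ->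
  forall e, 0 < e -> exists j0, forall j, (j0 <= j)%N -> forall m,
    `|2 ^+ j * t - m%:~R| <= 2 -> `|x j m| <= e * phi j.
Proof.
move=> phi1 phi_nd incr e e0.
have M0 : 0 <= moment.
  by rewrite fine_ge0// integral_ge0// => y _; rewrite lee_fin mulr_ge0// sqr_ge0.
pose e' := e / (2 * (moment + 1)).
have e'0 : 0 < e' by rewrite divr_gt0// mulr_gt0//; lra.
have e'e : 2 * e' * moment <= e.
  rewrite (_ : 2 * e' * moment = e * (moment / (moment + 1))).
    by rewrite ler_piMr ?(ltW e0)// ler_pdivrMr; lra.
  by rewrite /e'; field; lra.
have [n0 hn0] := incr _ e'0.
have [K K0 fK] := wavelet_series_growth h0 psi_decay C0 xC.
have bh := beta_gt_half h1; have bgt0 := beta_gt0 h.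
pose L := K * (3 + 2 * `|t|) * 4 ^+ n0.
have L0 : 0 <= L.
  by rewrite !mulr_ge0// ?(ltW K0)// addr_ge0// mulr_ge0.
have far y : 2 ^- n0 <= `|y - t| -> `|f y - f t| <= L * `|y - t| ^+ 2.
  move=> yt; pose r := 2 ^+ n0 * `|y - t|.
  have r1 : 1 <= r by rewrite /r mulrC -ler_pdivrMr ?exprn_gt0// mul1r.
  have p1 : (1 : R) <= 2 ^+ n0 by rewrite exprn_ege1//; lra.
  have yr : `|y - t| <= r by rewrite /r ler_peMl.
  have yy : `|y| <= `|y - t| + `|t| by rewrite -{1}(subrK t y) ler_normD.
  have -> : L * `|y - t| ^+ 2 = K * ((3 + 2 * `|t|) * r ^+ 2).
    rewrite /L /r exprMn -exprM mulnC exprM (_ : 2 ^+ 2 = 4) ?mulrA//.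
    by rewrite -natrX.
  rewrite (le_trans (ler_normB _ _))// (le_trans (lerD (fK y) (fK t)))//.
  rewrite -mulrDr ler_wpM2l ?(ltW K0)//.
  have r2 : r <= r ^+ 2 by rewrite expr2 ler_peMr//; lra.
  have := normr_ge0 t; move: (r ^+ 2) r2 => r' r2 t0.
  have : (2 + 2 * `|t|) * 1 <= (2 + 2 * `|t|) * r' by rewrite ler_wpM2l; lra.
  by lra.
clearbody L.
have [j1 hj1] : exists j1, forall j, (j1 <= j)%N -> L * 2 ^- j <= e'.
  exists (Num.truncn (L / e')).+1 => j hj.
  rewrite ler_pdivrMr ?exprn_gt0// mulrC -ler_pdivrMr//.
  have := truncnS_gt (L / e') => /ltW/le_trans; apply.
  by rewrite -natrX ler_nat (leq_trans hj)// ltnW// ltn_expl.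
exists (maxn n0 j1) => j; rewrite geq_max => /andP[n0j j1j] m tm.
have bj0 : 0 < b ^+ j by rewrite exprn_gt0.
have ph0 : 0 < phi j by have := phi1 j; lra.
have p0 : (0 : R) < 2 ^+ j by rewrite exprn_gt0.
have bp0 : 0 < b ^+ j * phi j by rewrite mulr_gt0.
rewrite -(ler_pM2r bj0); apply: (@le_trans _ _ (2 * e' * (b ^+ j * phi j) * moment)).
  apply: coef_le tm _ => y.
  have z0 : 0 <= 2 ^+ j * `|y - t| by rewrite mulr_ge0// ltW.
  have [|yt] := leP `|y - t| (2 ^- n0); last first.
    apply: (le_trans (far y (ltW yt))).
    rewrite (_ : L * _ ^+ 2 = (L * 2 ^- j) * 2 ^- j * (2 ^+ j * `|y - t|) ^+ 2); last first.
      by field; rewrite gt_eqF.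
    apply: ler_pM; [by do 2 (rewrite mulr_ge0 ?invr_ge0 ?(ltW p0)//)|exact: sqr_ge0| |].
      apply: (@le_trans _ _ (e' * (b ^+ j * phi j))); last first.
        by rewrite ler_wpM2r ?(ltW bp0)//; lra.
      apply: ler_pM; rewrite ?mulr_ge0 ?invr_ge0 ?(ltW p0)//; first exact: hj1.
      rewrite -[leLHS]mulr1 ler_pM ?invr_ge0 ?(ltW p0)//.
      by rewrite -exprVn lerXn2r ?nnegrE ?(ltW bgt0)// ltW.
    by apply: lerXn2r; rewrite ?nnegrE; lra.
  have [yj yn0|yj yn0] := leP `|y - t| (2 ^- j).
    apply: (le_trans (hn0 _ n0j _ yj)).
    have one : 1 <= (1 + 2 ^+ j * `|y - t|) ^+ 2 by rewrite exprn_ege1// lerDl.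
    have : e' * (b ^+ j * phi j) <= 2 * e' * (b ^+ j * phi j) by rewrite ler_wpM2r ?(ltW bp0)//; lra.
    move=> /le_trans; apply; rewrite ler_peMr//.
    by rewrite mulr_ge0 ?(ltW bp0)//; lra.
  have yt0 : 0 < `|y - t| by apply: lt_trans yj; rewrite invr_gt0.
  have [n n0n [yn1 yn]] := dyadic_scale yt0 yn0.
  apply: (le_trans (hn0 _ n0n _ yn)).
  have nj : (n < j)%N.
    rewrite ltnNge; apply/negP => jn; move: yj; rewrite ltNge (le_trans yn)//.
    by rewrite lef_pV2 ?posrE ?exprn_gt0// ler_weXn2l// ler1n.
  have bn0 : 0 < b ^+ n by rewrite exprn_gt0.
  have bjn : b ^+ n <= b ^+ j * 2 ^+ (j - n).
    rewrite -[in b ^+ j](subnK (ltnW nj)) exprD mulrAC ler_peMl ?(ltW bn0)//.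
    by rewrite -exprMn exprn_ege1//; lra.
  have two : 2 ^+ (j - n) <= 2 * (2 ^+ j * `|y - t|).
    have H := ler_wpM2l (ltW p0) (ltW yn1).
    apply: (@le_trans _ _ (2 * (2 ^+ j * 2 ^- n.+1))); last by rewrite ler_wpM2l.
    have -> : 2 ^+ j = 2 ^+ (j - n) * 2 ^+ n :> R by rewrite -exprD subnK// ltnW.
    rewrite le_eqVlt; apply/orP; left; apply/eqP; rewrite exprS; field.
    by rewrite gt_eqF// exprn_gt0.
  apply: (@le_trans _ _ (e' * (b ^+ j * (2 * (2 ^+ j * `|y - t|)) * phi j))).
    apply: ler_wpM2l; first exact: ltW.
    apply: ler_pM; rewrite ?(ltW bn0)//; [by have := phi1 n; lra| |exact: phi_nd (ltnW nj)].
    by rewrite (le_trans bjn)// ler_wpM2l// ltW.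
  rewrite (_ : e' * _ = 2 * e' * (b ^+ j * phi j) * (2 ^+ j * `|y - t|)); last by ring.
  rewrite ler_wpM2l//; first by rewrite mulr_ge0 ?(ltW bp0)//; lra.
  by move: (2 ^+ j * _) z0 => z z0; nra.
rewrite (_ : 2 * e' * _ * moment = 2 * e' * moment * (b ^+ j * phi j)); last by ring.
rewrite (_ : e * phi j * _ = e * (b ^+ j * phi j)); last by ring.
by rewrite ler_wpM2r// ltW.
Qed.

End Coefficients.

(** * From increments on dyadic scales to sharp moduli *)

Section ScaleProfiles.
Variable R : realType.

Definition phi_r (n : nat) : R := Num.sqrt n.+1%:R.
Definition phi_o (n : nat) : R := Num.sqrt (lnw n%:R).
Definition phi_s (n : nat) : R := 1.

(* [phi n] stands for the modulus of continuity divided by [|x|^h] at the scale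
   [|x| = 2^-n]. *)
Record scale_profile (phi : nat -> R) : Prop := {
  profile_ge1 : forall n, 1 <= phi n;
  profile_nd : forall i n, (i <= n)%N -> phi i <= phi n;
  profile_slow : forall i n, (n <= i)%N -> phi i <= (i - n).+1%:R * phi n }.

Let sqrt_profile (g : nat -> R) : (forall n, 1 <= g n) ->
  (forall i n, (i <= n)%N -> g i <= g n) ->
  (forall i n, g (i + n)%N <= i.+1%:R * g n) -> scale_profile (fun n => Num.sqrt (g n)).
Proof.
move=> g1 gnd gs; split=> [n|i n ile|i n nle].
- by rewrite -sqrtr1 ler_wsqrtr.
- by rewrite ler_wsqrtr// gnd.
have i1 : 1 <= (i - n).+1%:R :> R by rewrite ler1n.
rewrite -[leRHS](_ : Num.sqrt ((i - n).+1%:R ^+ 2 * g n) = _); last first.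
  by rewrite sqrtrM ?sqr_ge0// sqrtr_sqr ger0_norm.
rewrite ler_wsqrtr// -{1}(subnK nle) (le_trans (gs _ _))//.
by rewrite ler_wpM2r ?(le_trans _ (g1 n))// expr2 ler_peMr.
Qed.

Lemma phi_r_profile : scale_profile phi_r.
Proof.
apply: (sqrt_profile (g := fun n => n.+1%:R)) => [n|i n ile|i n].
- by rewrite ler1n.
- by rewrite ler_nat.
- by rewrite -natrM ler_nat; nia.
Qed.

Lemma phi_o_profile : scale_profile phi_o.
Proof.
apply: (sqrt_profile (g := fun n => lnw n%:R)) => [n|i n ile|i n].
- exact: lnw_ge1.
- by apply: lnw_mono => //; rewrite ler_nat.
have n1 := @lnw_ge1 R n%:R (ler0n _ _).
have : ln (1 + (i + n)%:R) <= ln ((1 + i%:R) * (1 + n%:R)) :> R.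
  rewrite ler_ln ?posrE ?mulr_gt0// natrD.
  by have := mulr_ge0 (ler0n R i) (ler0n R n); lra.
rewrite lnM ?posrE ?ltr_pwDl// => H.
have Hi : ln (1 + i%:R) <= i%:R :> R.
  by rewrite le_ln1Dx// (lt_le_trans _ (ler0n _ _)).
have : i%:R * 1 <= i%:R * lnw n%:R :> R by rewrite ler_wpM2l.
by rewrite -natr1 mulrDl mul1r; move: n1; rewrite /lnw; lra.
Qed.

Lemma phi_s_profile : scale_profile phi_s.
Proof. by split => // i n _; rewrite /phi_s mulr1 ler1n. Qed.

End ScaleProfiles.

Section Sharpness.
Variables (R : realType) (h : R).
Hypotheses (h0 : 0 < h) (h1 : h < 1).
Local Notation b := (beta h).

(** The comparison is restricted to small scales, where [omega_r] and [omega_o] are meaningful. *)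
Definition comparable_modulus (w : R -> R) (phi : nat -> R) := exists c C n1,
  [/\ 0 < c, 0 < C & forall n r, (n1 <= n)%N -> 2 ^- n.+1 < r -> r <= 2 ^- n ->
    c * (b ^+ n * phi n) <= w r /\ w r <= C * (b ^+ n * phi n)].

(** A finite limsup for some [w' = o(w)] would make the increments [O(w')], thus [o(w)], thus
    [o (b^n phi n)]. One failure of smallness therefore excludes every [w']. *)
Lemma sharp_modulus (f w : R -> R) (phi : nat -> R) t :
  scale_profile phi -> comparable_modulus w phi ->
  (exists K, forall n s, `|s - t| <= 2 ^- n -> `|f s - f t| <= K * (b ^+ n * phi n)) ->
  ~ (forall e, 0 < e -> exists n0, forall n, (n0 <= n)%N -> forall s,
     `|s - t| <= 2 ^- n -> `|f s - f t| <= e * (b ^+ n * phi n)) ->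
  sharp_modulus_at f w t.
Proof.
move=> [phi1 phi_nd phi_slow] [c [C [n1 [c0 C0 hw]]]] [K hK] low.
have b0 := beta_gt0 h; have b1 := beta_lt1 h0.
have bp n : 0 < b ^+ n * phi n.
  by rewrite mulr_gt0 ?exprn_gt0// (lt_le_trans ltr01).
have p2 n : 0 < 2 ^- n :> R by rewrite invr_gt0 exprn_gt0.
split.
  apply: (@le_lt_trans _ _ ((`|K| / c)%:E)); last exact: ltry.
  apply: (@le_trans _ _ (ereal_sup [set (`|f s - f t| / w `|s - t|)%:E |
      s in ball t (2 ^- n1) `\ t])).
    apply: ereal_inf_lbound; exists (ball t (2 ^- n1) `\ t) => //.
    exact: dnbhs_ball.
  apply: ge_ereal_sup => _ [s [/= ts /eqP st] <-]; rewrite lee_fin.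
  have st0 : 0 < `|s - t| by rewrite normr_gt0 subr_eq0.
  have sn1 : `|s - t| <= 2 ^- n1 by rewrite distrC; exact: ltW ts.
  have [n nn1 [hn1 hn2]] := dyadic_scale st0 sn1.
  have [hl hu] := hw _ _ nn1 hn1 hn2.
  have w0 : 0 < w `|s - t| by apply: lt_le_trans hl; rewrite mulr_gt0.
  rewrite ler_pdivrMr// (le_trans (hK _ _ hn2))//.
  apply: (@le_trans _ _ (`|K| / c * (c * (b ^+ n * phi n)))); last first.
    by rewrite ler_wpM2l// divr_ge0// ltW.
  rewrite [leRHS]mulrA divfK ?gt_eqF//.
  by rewrite ler_wpM2r ?ler_norm// ltW.
move=> w' [w'ge0 w'inc w'0 _] w'o.
apply/eqP; rewrite -leye_eq leNgt; apply/negP => fin.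
apply: low => e e0.
have [_ [V tV <-] supV] := ereal_inf_lt fin.
have [M hM] : exists M : R, forall s, V s -> `|f s - f t| / w' `|s - t| <= M.
  move: supV; move E : (ereal_sup _) => S; case: S E => [M| |] E // _.
    exists M => s Vs; rewrite -lee_fin -E.
    by apply: ereal_sup_ubound; exists s.
  (* When the supremum is [-oo], any bound will do. *)
  exists 0 => s Vs; rewrite -lee_fin; apply: (@le_trans _ _ -oo%E); last by rewrite leNye.
  by rewrite -E; apply: ereal_sup_ubound; exists s.
move: tV => [d /= d0 hd].
(* The scale [i] of [|s - t|] may be finer than [n]; the factor [1 - b] absorbs the loss in
   [b^i phi i <= b^n phi n / (1 - b)], which is uniform in [i >= n]. *)
pose e' := e * (1 - b) / ((`|M| + 1) * C).
have e'0 : 0 < e'.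
  by rewrite divr_gt0 ?mulr_gt0 ?subr_gt0// ltr_wpDl.
move/cvgr0Pnorm_le : w'o => /(_ _ e'0) [d' /= d'0 hd'].
have d''0 : 0 < Num.min d d' by rewrite lt_min d0.
have [n2 hn2] := dyadic_lt d''0.
exists (maxn n1 n2) => n; rewrite geq_max => /andP[n1n n2n] s sn.
have [->|st] := eqVneq s t.
  by rewrite subrr normr0 mulr_ge0 ?ltW.
have st0 : 0 < `|s - t| by rewrite normr_gt0 subr_eq0.
have sd : `|s - t| < Num.min d d'.
  rewrite (le_lt_trans sn)// (le_lt_trans _ hn2)//.
  by rewrite lef_pV2 ?posrE ?exprn_gt0// ler_weXn2l// ler1n.
move: sd; rewrite lt_min => /andP[sd sd'].
have Vs : V s by apply: hd => //=; rewrite distrC.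
have w'p : 0 < w' `|s - t| by rewrite -w'0 w'inc.
have [i ni [hi1 hi2]] := dyadic_scale st0 sn.
have [hl hu] := hw _ _ (leq_trans n1n ni) hi1 hi2.
have w0 : 0 < w `|s - t| by apply: lt_le_trans hl; rewrite mulr_gt0.
have hw' : w' `|s - t| <= e' * w `|s - t|.
  have := hd' `|s - t|; rewrite /= sub0r normrN normr_id => /(_ sd' st0).
  by move=> H; rewrite -ler_pdivrMr//; apply: le_trans H; exact: ler_norm.
have hf : `|f s - f t| <= (`|M| + 1) * w' `|s - t|.
  rewrite -ler_pdivrMr// (le_trans (hM _ Vs))//.
  by have := ler_norm M; lra.
have M0 : 0 < `|M| + 1 by rewrite ltr_wpDl.
apply: (le_trans hf).
apply: (@le_trans _ _ ((`|M| + 1) * (e' * (C * (b ^+ i * phi i))))).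
  apply: ler_wpM2l; first exact: ltW.
  by rewrite (le_trans hw')// ler_wpM2l// ltW.
rewrite (_ : (`|M| + 1) * (e' * (C * (b ^+ i * phi i))) =
    e * ((1 - b) * (b ^+ i * phi i))); last first.
  by rewrite /e'; field; rewrite !gt_eqF.
apply: ler_wpM2l; first exact: ltW.
have ib : 0 < 1 - b by rewrite subr_gt0.
rewrite mulrC -ler_pdivlMr//.
apply: (@le_trans _ _ (b ^+ i * ((i - n).+1%:R * phi n))).
  by rewrite ler_wpM2l ?exprn_ge0 ?(ltW b0)// phi_slow.
rewrite -{1}(subnK ni) exprD.
rewrite (_ : b ^+ (i - n) * b ^+ n * ((i - n).+1%:R * phi n) =
    b ^+ n * phi n * ((i - n).+1%:R * b ^+ (i - n))); last by ring.
apply: ler_wpM2l; first exact: ltW.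
by apply: succ_expr_le => //; exact: ltW.
Qed.

Let pow_dyadic n (r : R) : 2 ^- n.+1 < r -> r <= 2 ^- n ->
  b ^+ n.+1 <= r `^ h /\ r `^ h <= b ^+ n.
Proof.
move=> r1 r2; have bX m : (2 ^- m) `^ h = b ^+ m.
  by rewrite -betaX -powR_mulrn// -powRN -powRrM; congr (_ `^ _); ring.
have r0 : 0 < r by apply: lt_trans r1; rewrite invr_gt0 exprn_gt0.
by split; rewrite -bX ge0_ler_powR ?nnegrE ?invr_ge0 ?exprn_ge0 ?(ltW r0) ?(ltW h0) ?(ltW r1)//.
Qed.

Let ln_dyadic n (r : R) : 2 ^- n.+1 < r -> r <= 2 ^- n ->
  n%:R * ln 2 <= ln r^-1 /\ ln r^-1 <= n.+1%:R * ln 2.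
Proof.
move=> r1 r2.
have r0 : 0 < r by apply: lt_trans r1; rewrite invr_gt0 exprn_gt0.
rewrite !mulr_natl -!lnXn// !ler_ln ?posrE ?invr_gt0 ?exprn_gt0//; split.
  by rewrite -[leLHS]invrK lef_pV2 ?posrE ?invr_gt0 ?exprn_gt0.
by rewrite -[leRHS]invrK lef_pV2 ?posrE ?invr_gt0 ?exprn_gt0// ltW.
Qed.

Let comparable_powR (v : R -> R) (g : nat -> R) n1 : (forall n, 0 <= g n) ->
  (forall n r, (n1 <= n)%N -> 2 ^- n.+1 < r -> r <= 2 ^- n ->
     g n / 4 <= v r /\ v r <= g n) ->
  comparable_modulus (fun r => `|r| `^ h * Num.sqrt (v `|r|))
    (fun n => Num.sqrt (g n)).
Proof.
move=> g0 hv; have b0 := beta_gt0 h.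
(* The factor [b] is lost on [r^h] between [2^-(n+1)] and [2^-n]; [1/2] is the square root of
   [1/4]. *)
exists (b / 2), 1, n1; split => //; first by rewrite divr_gt0.
move=> n r nn1 r1 r2.
have r0 : 0 < r by apply: lt_trans r1; rewrite invr_gt0 exprn_gt0.
rewrite gtr0_norm//.
have [l1 l2] := pow_dyadic r1 r2; have [l3 l4] := hv _ _ nn1 r1 r2.
have s4 : Num.sqrt (g n / 4) = Num.sqrt (g n) / 2.
  rewrite sqrtrM// sqrtrV// (_ : 4 = 2 ^+ 2) ?sqrtr_sqr ?ger0_norm//.
  by rewrite -natrX.
split.
  rewrite [leLHS](_ : _ = b ^+ n.+1 * Num.sqrt (g n / 4)); last by rewrite s4 exprS; ring.
  by apply: ler_pM; rewrite ?exprn_ge0 ?(ltW b0)// ler_wsqrtr.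
by rewrite mul1r; apply: ler_pM; rewrite ?powR_ge0// ler_wsqrtr.
Qed.

Lemma omega_s_comparable : comparable_modulus (omega_s h) (@phi_s R).
Proof.
have := @comparable_powR (fun _ => 1) (fun _ => 1) 0%N.
case=> [//|n r _ _ _|c [C [n1 [c0 C0 H]]]]; first by split => //; lra.
exists c, C, n1; split => // n r nn1 r1 r2; have := H n r nn1 r1 r2.
by rewrite /omega_s /phi_s sqrtr1 !mulr1.
Qed.

Lemma omega_r_comparable : comparable_modulus (omega_r h) (@phi_r R).
Proof.
have := @comparable_powR (fun r => ln r^-1) (fun n => n.+1%:R) 1%N.
case=> [//|n r n1 r1 r2|c [C [n1 [c0 C0 H]]]]; last by exists c, C, n1.
have [l1 l2] := ln_dyadic r1 r2; have lh := ln2_ge_half R.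
have l2le : ln 2 <= 1 :> R by have := ln_expn2 R 1; rewrite expr1.
have n1' : 1 <= n%:R :> R by rewrite ler1n.
split; last by apply: (le_trans l2); rewrite ler_piMr.
apply: le_trans l1; apply: (@le_trans _ _ (n%:R * 2^-1)); last by rewrite ler_wpM2l.
by rewrite -natr1; lra.
Qed.

Lemma omega_o_comparable : comparable_modulus (omega_o h) (@phi_o R).
Proof.
have := @comparable_powR (fun r => ln (ln r^-1)) (fun n => lnw n%:R) 5%N.
case=> [n|n r n5 r1 r2|c [C [n1 [c0 C0 H]]]]; last by exists c, C, n1.
  by rewrite ltW// lnw_gt0.
have [l1 l2] := ln_dyadic r1 r2; have lh := ln2_ge_half R.
have l2le : ln 2 <= 1 :> R by have := ln_expn2 R 1; rewrite expr1.
have n1' : 5 <= n%:R :> R by rewrite (ler_nat _ 5 n).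
have l1' : n%:R / 2 <= ln r^-1.
  by apply: le_trans l1; rewrite ler_wpM2l.
have l2' : ln r^-1 <= 1 + n%:R.
  by rewrite (le_trans l2)// addrC natr1 ler_piMr.
have lp : 0 < ln r^-1 by apply: lt_le_trans l1'; lra.
split; last first.
  have : ln (ln r^-1) <= ln (1 + n%:R).
    by rewrite ler_ln ?posrE//; lra.
  by rewrite /lnw; lra.
apply: (@le_trans _ _ (ln (n%:R / 2))); last by rewrite ler_ln ?posrE//; lra.
rewrite ler_pdivrMr// mulr_natr -lnXn; last by lra.
(* As [1 <= ln 4], the constant of [lnw] can be put inside the logarithm; what remains is
   [4 (1 + n) <= (n / 2)^4], which holds from [n = 5] on and fixes the threshold. *)
apply: (@le_trans _ _ (ln (4 * (1 + n%:R)))).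
  rewrite lnM ?posrE//.
  have : ln (2 ^+ 2) = ln 2 *+ 2 :> R by rewrite lnXn.
  by rewrite -natrX /lnw => ->; rewrite mulr2n; lra.
have q1 : 0 < 4 * (1 + n%:R) :> R by lra.
have q2 : 0 < (n%:R / 2) ^+ 4 :> R by apply: exprn_gt0; lra.
rewrite ler_ln ?posrE//.
move: (n%:R) n1' => y y5; rewrite (_ : (y / 2) ^+ 4 = y ^+ 4 / 16); last by field.
have y2 : 25 <= y * y by nra.
have y3 : 125 <= y * y * y by nra.
have : 125 * y <= y * y * y * y by rewrite ler_wpM2r//; lra.
by rewrite (_ : y ^+ 4 = y * y * y * y); [lra|ring].
Qed.

End Sharpness.

(** * Gaussian coefficients *)

Section GaussianTails.
Variable R : realType.
Local Notation nu := (normal_prob (0 : R) 1).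
Implicit Types (x y eta : R).

Lemma measurable_norm_gt y : measurable [set x : R | y < `|x|].
Proof.
have mf : measurable_fun [set: R] (fun x : R => `|x|) by exact: measurableT_comp.
have := mf measurableT _ (measurable_itv `]y, +oo[).
by rewrite setTI; congr measurable; apply/seteqP; split => x /=; rewrite in_itv/= andbT.
Qed.

Lemma measurable_norm_le y : measurable [set x : R | `|x| <= y].
Proof.
rewrite (_ : mkset _ = ~` [set x : R | y < `|x|]).
  by apply: measurableC; exact: measurable_norm_gt.
by apply/seteqP; split => x /=; rewrite leNgt => /negP.
Qed.

Let pdf1 x : normal_pdf 0 1 x = normal_peak 1 * expR (- x ^+ 2 / 2).
Proof.
by rewrite normal_pdfE ?oner_eq0//= /normal_fun subr0 expr1n mulr2n.
Qed.

Let peak1 : normal_peak 1 = (Num.sqrt (pi *+ 2 : R))^-1.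
Proof. by rewrite /normal_peak expr1n mul1r. Qed.

Let peak1_le1 : normal_peak (1 : R) <= 1.
Proof.
have pp := @pi_gt0 R; have pp2 := pi_ge2 R.
have sp : 0 < Num.sqrt (pi *+ 2 : R) by rewrite sqrtr_gt0 mulr2n; lra.
by rewrite peak1 invf_le1// -[leLHS]sqrtr1 ler_wsqrtr// mulr2n; lra.
Qed.

(* For [|x| > y] the standard density is at most [2 exp (- y ^ 2 / 4)] times the
   density of variance [2]. *)
Lemma normal_tail_le y : 0 <= y ->
  (nu [set x | (y < `|x|)%R] <= (2 * expR (- y ^+ 2 / 4))%:E)%E.
Proof.
move=> y0; pose s : R := Num.sqrt 2.
have s2 : s ^+ 2 = 2 by rewrite sqr_sqrtr.
have s0 : s != 0 by rewrite gt_eqF// sqrtr_gt0.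
have mA := measurable_norm_gt y.
have pk : normal_peak (1 : R) <= 2 * normal_peak s.
  rewrite peak1 /normal_peak s2.
  have pp := @pi_gt0 R.
  have sp : 0 < Num.sqrt (pi *+ 2 : R) by rewrite sqrtr_gt0 mulr2n; lra.
  have sp' : 0 < Num.sqrt (2 * pi *+ 2 : R) by rewrite sqrtr_gt0 mulr2n; lra.
  rewrite ler_pdivlMr// mulrC ler_pdivrMr//.
  rewrite -[2 in leRHS](_ : Num.sqrt 4 = 2); last first.
    by rewrite (_ : 4 = 2 ^+ 2) ?sqrtr_sqr ?ger0_norm// -natrX.
  rewrite -sqrtrM// ler_wsqrtr// !mulr2n; have := @pi_gt0 R; lra.
apply: (@le_trans _ _ ((2 * expR (- y ^+ 2 / 4))%:E * normal_prob 0 s [set x | (y < `|x|)%R])%E).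
  rewrite /normal_prob -ge0_integralZl_EFin//; first last.
  - by apply: measurable_funTS; apply/measurable_EFinP; exact: measurable_normal_pdf.
  - by move=> x _; rewrite lee_fin normal_pdf_ge0.
  apply: ge0_le_integral => //.
  - by move=> x _; rewrite lee_fin normal_pdf_ge0.
  - by apply: measurable_funTS; apply/measurable_EFinP; exact: measurable_normal_pdf.
  - apply: emeasurable_funM; first exact: measurable_cst.
    by apply: measurable_funTS; apply/measurable_EFinP; exact: measurable_normal_pdf.
  move=> x /= yx; rewrite -EFinM lee_fin pdf1 normal_pdfE//= /normal_fun subr0 s2.
  rewrite mulrACA -expRD; apply: ler_pM => //.
    exact: normal_peak_ge0.
  rewrite ler_expR (_ : 2 *+ 2 = 4 :> R); last by rewrite mulr2n; ring.
  have : y ^+ 2 <= x ^+ 2.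
    by rewrite -[x ^+ 2]real_normK ?num_real//; apply: lerXn2r; rewrite ?nnegrE// ltW.
  by lra.
rewrite -[leRHS]mule1 lee_wpmul2l ?lee_fin ?mulr_ge0 ?expR_ge0//.
exact: (@probability_le1 _ _ _ (normal_prob 0 s)).
Qed.

Lemma normal_small_le eta : 0 <= eta ->
  (nu [set x | (`|x| <= eta)%R] <= (2 * eta)%:E)%E.
Proof.
move=> e0; have mA := measurable_norm_le eta.
apply: (@le_trans _ _ (\int[lebesgue_measure]_(x in [set x : R | (`|x| <= eta)%R]) (cst 1 x))%E).
  apply: ge0_le_integral => //.
  - by move=> x _; rewrite lee_fin normal_pdf_ge0.
  - by apply: measurable_funTS; apply/measurable_EFinP; exact: measurable_normal_pdf.
  move=> x _; rewrite lee_fin pdf1 (le_trans _ peak1_le1)//.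
  rewrite ler_piMr ?normal_peak_ge0// -[leRHS]expR0 ler_expR.
  by have := sqr_ge0 x; lra.
rewrite integral_cst// mul1e.
rewrite (_ : mkset _ = `[- eta, eta]%classic); last first.
  by apply/seteqP; split => x /=; rewrite in_itv/= ler_norml.
rewrite [X in (X <= _)%E](lebesgue_measure_itv `[- eta, eta])/= lte_fin.
case: ifPn => _.
  by rewrite -EFinB lee_fin; lra.
by rewrite lee_fin; lra.
Qed.

(** For [y < x <= y + 1] one has [x^2 / 2 <= y^2 + 1]. The exponent [y^2], though not optimal, fits
    the profiles: at [y = phi_o j] it gives a harmonic series. *)
Lemma normal_tail_ge : exists2 c, 0 < c & forall y, 0 <= y ->
  ((c * expR (- y ^+ 2))%:E <= nu [set x | (y < `|x|)%R])%E.
Proof.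
exists (normal_peak 1 * expR (- 1)); first by rewrite mulr_gt0 ?normal_peak_gt0 ?oner_eq0 ?expR_gt0.
move=> y y0; have mA := measurable_norm_gt y.
have mB : measurable (`]y, (y + 1)] : set R) by exact: measurable_itv.
have BA : `]y, (y + 1)]%classic `<=` [set x : R | (y < `|x|)%R].
  move=> x /=; rewrite in_itv/= => /andP[yx _].
  by rewrite (lt_le_trans yx)// ler_norm.
apply: (@le_trans _ _ (nu `]y, (y + 1)]%classic)); last first.
  by apply: (@le_measure _ _ _ (normal_prob (0 : R) 1)); rewrite ?inE.
apply: (@le_trans _ _ (\int[lebesgue_measure]_(x in `]y, (y + 1)%R])
    (cst (normal_peak 1 * expR (- 1) * expR (- y ^+ 2))%:E x))%E).
  rewrite integral_cst// [X in (_ * X)%E](lebesgue_measure_itv `]y, (y + 1)])/=.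
  rewrite lte_fin ltrDl ltr01.
  by rewrite -EFinB addrAC subrr add0r mule1.
apply: ge0_le_integral => //.
- by move=> x _; rewrite lee_fin !mulr_ge0 ?expR_ge0 ?normal_peak_ge0.
- by apply: measurable_funTS; apply/measurable_EFinP; exact: measurable_normal_pdf.
move=> x /=; rewrite in_itv/= => /andP[yx xy]; rewrite lee_fin pdf1 -mulrA -expRD.
by rewrite ler_wpM2l ?normal_peak_ge0// ler_expR; have := sqr_ge0 (y - 1); nra.
Qed.

End GaussianTails.

(** * Union bounds and null sets *)

Section UnionBounds.
Variables (R : realType) (d : measure_display) (T : measurableType d).
Variable P : probability T R.

Lemma measure_bigcup_le (F : nat -> set T) (b : nat -> R) K :
  (forall k, measurable (F k)) -> (forall k, (P (F k) <= (b k)%:E)%E) ->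
  (forall n, \sum_(0 <= k < n) b k <= K) ->
  (P (\bigcup_k F k) <= K%:E)%E.
Proof.
move=> mF Fb bK.
apply: (@le_trans _ _ (\sum_(0 <= k <oo) P (F k))%E).
  by apply: measure_sigma_subadditive => //; exact: bigcup_measurable.
apply: lime_le; first by apply: is_cvg_nneseries => *; exact: measure_ge0.
apply: nearW => n; apply: (@le_trans _ _ (\sum_(0 <= k < n) (b k)%:E)%E).
  by apply: lee_sum => k _; exact: Fb.
by rewrite sumEFin lee_fin.
Qed.

Lemma measure_bigcupZ_le (E : int -> set T) c K : 0 <= K ->
  (forall k, measurable (E k)) ->
  (forall k : int, (P (E k) <= (K * (1 + `|c - k%:~R|) ^- 2)%:E)%E) ->
  measurable (\bigcup_k E k) /\ (P (\bigcup_k E k) <= (16 * K)%:E)%E.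
Proof.
move=> K0 mE EK.
have UE : \bigcup_k E k = (\bigcup_(n : nat) E n%:Z) `|` (\bigcup_(n : nat) E (- n.+1%:Z)).
  apply/seteqP; split => [w [[n|n] _ Ew]|w [[n _ Ew]|[n _ Ew]]].
  - by left; exists n.
  - by right; exists n => //; rewrite -NegzE.
  - by exists n%:Z.
  - by exists (- n.+1%:Z).
have m1 : measurable (\bigcup_(n : nat) E n%:Z) by exact: bigcup_measurable.
have m2 : measurable (\bigcup_(n : nat) E (- n.+1%:Z)) by exact: bigcup_measurable.
rewrite UE; split; first exact: measurableU.
apply: (le_trans (measureU2 _ m1 m2)).
rewrite (_ : 16 * K = 8 * K + 8 * K); last by ring.
rewrite EFinD leeD//.
  apply: (measure_bigcup_le (b := fun n => K * (1 + `|c - n%:R|) ^- 2)) => // n.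
  by rewrite -mulr_sumr mulrC ler_wpM2r// sum_invsq_shift.
apply: (measure_bigcup_le (b := fun n => K * (1 + `|(- 1 - c) - n%:R|) ^- 2)) => //.
  move=> n; rewrite (le_trans (EK _))// lee_fin.
  rewrite (_ : `|c - (- n.+1%:Z)%:~R| = `|- 1 - c - n%:R|)// -normrN.
  by congr `| _ |; rewrite mulrNz -[n.+1%:~R]/(n.+1%:R) -natr1; ring.
by move=> n; rewrite -mulr_sumr mulrC ler_wpM2r// sum_invsq_shift.
Qed.

(** Intersecting covers of measure at most [1/(n+1)] dispenses with the measurability of [N]. *)
Lemma negligible_eps (N : set T) : (forall e : R, 0 < e -> exists B,
  [/\ measurable B, N `<=` B & (P B <= e%:E)%E]) -> P.-negligible N.
Proof.
move=> H; have /choice[B hB] : forall n : nat, exists B : set T,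
    [/\ measurable B, N `<=` B & (P B <= (n.+1%:R^-1)%:E)%E].
  by move=> n; apply: H; rewrite invr_gt0.
exists (\bigcap_n B n); split.
- by apply: bigcap_measurable => // n _; case: (hB n).
- apply/eqP; rewrite eq_le measure_ge0 andbT; apply/lee_addgt0Pr => e e0.
  rewrite add0e; have [n ne] : exists n : nat, n.+1%:R^-1 <= e.
    exists (Num.truncn e^-1); rewrite invf_ple ?posrE//.
    exact: ltW (truncnS_gt _).
  have [mB _ PB] := hB n.
  apply: (@le_trans _ _ (P (B n))); last by rewrite (le_trans PB)// lee_fin.
  apply: le_measure; rewrite ?inE//; last exact: bigcap_inf.
  by apply: bigcap_measurable => // k _; case: (hB k).
- by move=> w Nw n _; case: (hB n) => _ + _; apply.
Qed.

Variable X : {RV P >-> R}.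
Hypothesis nX : standard_normal X.

Lemma std_normalE (A : set R) : measurable A ->
  P (X @^-1` A) = normal_prob 0 1 A.
Proof. by move=> mA; rewrite -(nX mA). Qed.

Lemma measurable_RV_preimage (A : set R) : measurable A -> measurable (X @^-1` A).
Proof. by move=> mA; rewrite -[X in measurable X]setTI; exact: measurable_funP. Qed.

Lemma measurable_sqr_gt (v : R) : measurable [set x : R | v < x ^+ 2].
Proof.
have mf : measurable_fun [set: R] (fun x : R => x ^+ 2) by exact: measurable_funX.
have := mf measurableT _ (measurable_itv `]v, +oo[).
by rewrite setTI; congr measurable; apply/seteqP; split => x /=; rewrite in_itv/= andbT.
Qed.

(** From [(L - 2) (v - 1) >= 0], that is [L v >= (L - 2) + 2 v]. The factor [exp (- 2 v)] is to be
    summed over the coefficients; [L] tunes the size of the total. *)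
Lemma sqr_tail_le L (v : R) : 2 <= L -> 1 <= v ->
  (P (X @^-1` [set x | (4 * L * v < x ^+ 2)%R])
     <= (2 * expR (- (L - 2)) * expR (- (2 * v)))%:E)%E.
Proof.
move=> L2 v1; have q0 : 0 <= 4 * L * v by rewrite !mulr_ge0//; lra.
rewrite std_normalE; last exact: measurable_sqr_gt.
rewrite (_ : mkset _ = [set x : R | (Num.sqrt (4 * L * v) < `|x|)%R]); last first.
  apply/seteqP; split => x /=.
    by move=> H; rewrite -sqrtr_sqr ltr_sqrt// (le_lt_trans q0).
  by move=> H; rewrite -(sqr_sqrtr q0) -[x ^+ 2]real_normK ?num_real// ltrXn2r ?nnegrE.
apply: (le_trans (normal_tail_le (sqrtr_ge0 _))); rewrite lee_fin sqr_sqrtr//.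
rewrite -[leRHS]mulrA ler_wpM2l// -expRD ler_expR.
have : 0 <= (L - 2) * (v - 1) by rewrite mulr_ge0// subr_ge0.
by lra.
Qed.

End UnionBounds.

(** * Almost sure behaviour of the coefficients *)

Section RandomCoefficients.
Variables (R : realType) (d : measure_display) (T : measurableType d).
Variables (P : probability T R) (xi : nat * int -> {RV P >-> R}).
Hypothesis nxi : forall jk, standard_normal (xi jk).
Hypothesis ixi : independent_RVs xi.
Implicit Types (j n : nat) (k m : int) (t L : R).

(** The link between Gaussian tails and the sums of [sum_invsq_shift]. *)
Lemma expR_lnw (y : R) : 0 <= y -> expR (- (2 * lnw y)) = expR (- 2) * (1 + y) ^- 2.
Proof.
move=> y0; rewrite /lnw mulrDr mulr1 opprD expRD; congr (_ * _).
rewrite -mulrN mulrC expRM_natr expRN lnK ?exprVn// posrE; lra.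
Qed.

Lemma expRN1_le_half : expR (- 1) <= 2^-1 :> R.
Proof.
have := expR_ge1Dx (1 : R); rewrite expRN lef_pV2 ?posrE ?expR_gt0// => /(le_trans _); apply.
Qed.

Lemma expRN_le (a : R) : 0 <= a -> expR (- a) <= (1 + a)^-1.
Proof.
move=> a0; rewrite expRN lef_pV2 ?posrE ?expR_gt0//; last by lra.
exact: expR_ge1Dx.
Qed.

Lemma coef_bound_ae : \forall w \ae P, exists2 C, 0 <= C &
  coef_bound (fun j k => xi (j, k) w) C.
Proof.
apply: negligible_eps => e e0.
(* The union bound totals [64 * expR (- (L - 2))], and [expR (- (64 / e)) <= e / 64]. *)
pose L := 2 + 64 / e.
have L2 : 2 <= L by rewrite lerDl divr_ge0// ltW.
pose v j k : R := 1 + j%:R + ln (1 + `|k%:~R|).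
have v1 j k : 1 <= v j k.
  by rewrite /v -addrA lerDl addr_ge0// ln_ge0// lerDl.
pose E j k := xi (j, k) @^-1` [set x | (4 * L * v j k < x ^+ 2)%R].
have mE j k : measurable (E j k).
  by apply: measurable_RV_preimage; exact: measurable_sqr_gt.
pose A : R := 2 * expR (- (L - 2)).
have A0 : 0 <= A by rewrite mulr_ge0// expR_ge0.
have EA j k : (P (E j k) <= (A * 2^-1 ^+ j * (1 + `|0 - k%:~R|) ^- 2)%:E)%E.
  apply: (le_trans (sqr_tail_le (nxi (j, k)) L2 (v1 j k))); rewrite lee_fin -[leRHS]mulrA -/A.
  apply: ler_wpM2l => //; rewrite sub0r normrN.
  have -> : 2 * v j k = 2 * j%:R + 2 * lnw `|k%:~R| by rewrite /v /lnw; ring.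
  rewrite opprD expRD expR_lnw//; apply: ler_pM; rewrite ?expR_ge0//.
    apply: (@le_trans _ _ (expR (- 1) ^+ j)); last first.
      by apply: lerXn2r; rewrite ?nnegrE ?expR_ge0//; exact: expRN1_le_half.
    by rewrite -expRM_natr ler_expR; have : 0 <= j%:R :> R by []; lra.
  by rewrite ler_piMl// -[leRHS]expR0 ler_expR; lra.
pose F j := \bigcup_k E j k.
have half0 : 0 <= 2^-1 :> R by [].
have hF j := measure_bigcupZ_le (mulr_ge0 A0 (exprn_ge0 j half0)) (mE j) (EA j).
have mF j : measurable (F j) := (hF j).1.
exists (\bigcup_j F j); split; first exact: bigcup_measurable.
  move=> w /= nw; apply: contrapT => H; apply: nw.
  exists (4 * L) => [|j k]; first by rewrite mulr_ge0//; lra.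
  by rewrite leNgt; apply/negP => jk; apply: H; exists j => //; exists k.
apply: (@le_trans _ _ (16 * (A * 2))%:E).
  apply: (measure_bigcup_le (b := fun j => 16 * (A * 2^-1 ^+ j))) => //.
    by move=> j; exact: (hF j).2.
  move=> n; rewrite -!mulr_sumr ler_wpM2l// ler_wpM2l//.
  have := @sum_expr_le R 2^-1 n; rewrite (_ : (1 - 2^-1)^-1 = 2); last by field.
  by apply; lra.
rewrite lee_fin /A (_ : L - 2 = 64 / e); last by rewrite /L; ring.
have e1 : 0 <= 64 / e by rewrite divr_ge0// ltW.
have : expR (- (64 / e)) <= e / 64.
  apply: (le_trans (expRN_le e1)).
  rewrite -[e / 64]invrK invf_div lef_pV2 ?posrE ?divr_gt0//; lra.
by lra.
Qed.

(** Both factors of [v j k] are at least 1, so [v j k >= lnw j + lnw |k - m j| - 1]: the tails,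
    taken with [L = 3], are summable over [k] and then over [j], and the first half of
    Borel-Cantelli applies. *)
Lemma ordinary_upper_ae t : \forall w \ae P, exists n0, forall j, (n0 <= j)%N ->
  forall k, xi (j, k) w ^+ 2 <=
    12 * (lnw j%:R * lnw `|(k - Num.floor (2 ^+ j * t))%:~R|).
Proof.
pose m j := Num.floor (2 ^+ j * t).
pose v j k : R := lnw j%:R * lnw `|(k - m j)%:~R|.
have l1 j : 1 <= lnw j%:R :> R by exact: lnw_ge1.
have w1 (k : int) : 1 <= lnw `|k%:~R : R| by exact: lnw_ge1.
have v1 j k : 1 <= v j k by have := l1 j; have := w1 (k - m j); rewrite /v; nra.
pose E j k := xi (j, k) @^-1` [set x | (4 * 3 * v j k < x ^+ 2)%R].
have mE j k : measurable (E j k).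
  by apply: measurable_RV_preimage; exact: measurable_sqr_gt.
have EA j k : (P (E j k) <= (2 * (1 + `|0 - j%:R|) ^- 2 *
    (1 + `|(m j)%:~R - k%:~R|) ^- 2)%:E)%E.
  have L3 : 2 <= 3 :> R by lra.
  apply: (le_trans (sqr_tail_le (nxi (j, k)) L3 (v1 j k))); rewrite lee_fin.
  have kE : `|(m j)%:~R - k%:~R : R| = `|(k - m j)%:~R| by rewrite distrC intrB.
  have jE : `|0 - j%:R : R| = j%:R by rewrite sub0r normrN ger0_norm.
  rewrite kE jE -!mulrA ler_wpM2l//.
  apply: (@le_trans _ _ (1 * (expR 2 * (expR (- (2 * lnw j%:R)) *
      expR (- (2 * lnw `|(k - m j)%:~R|)))))).
    apply: ler_pM; rewrite ?expR_ge0//.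
    rewrite -!expRD ler_expR /v; have := l1 j; have := w1 (k - m j).
    by nra.
  rewrite !expR_lnw// mul1r.
  rewrite (_ : expR 2 * _ = expR 2 * expR (- 2) * expR (- 2) *
     ((1 + j%:R) ^- 2 * (1 + `|(k - m j)%:~R|) ^- 2)); last by ring.
  rewrite -expRD subrr expR0 mul1r ler_piMl ?mulr_ge0 ?invr_ge0 ?exprn_ge0 ?addr_ge0//.
pose F j := \bigcup_k E j k.
have i0 j : 0 <= (1 + `|0 - j%:R : R|) ^- 2.
  by rewrite invr_ge0 exprn_ge0// addr_ge0.
have hF j := measure_bigcupZ_le (mulr_ge0 (ler0n R 2) (i0 j)) (mE j) (EA j).
have mF j : measurable (F j) := (hF j).1.
exists (lim_sup_set F); split.
- apply: bigcapT_measurable => n; apply: bigcup_measurable => k _; exact: mF.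
- apply: lim_sup_set_cvg0 => //.
  apply: (@le_lt_trans _ _ (256%:E)%E); last exact: ltry.
  apply: lime_le; first by apply: is_cvg_nneseries => *; exact: measure_ge0.
  apply: nearW => n.
  apply: (@le_trans _ _ (\sum_(0 <= j < n) (16 * (2 * (1 + `|0 - j%:R|) ^- 2))%:E)%E).
    by apply: lee_sum => j _; exact: (hF j).2.
  rewrite sumEFin lee_fin -!mulr_sumr.
  by have := @sum_invsq_shift R 0 n; lra.
- move=> w /= nw n _; apply: contrapT => H; apply: nw; exists n => j nj k.
  rewrite leNgt; apply/negP => jk; apply: H; exists j => //; exists k => //=.
  by rewrite /E /= -[4 * 3 * _]/(4 * 3 * (lnw j%:R * lnw `|(k - m j)%:~R|)) (_ : 4 * 3 = 12)//; ring.
Qed.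

Lemma independent_prod_le (s : seq (nat * int)) (B : nat * int -> set R)
    (g : nat * int -> R) : uniq s -> (forall i, measurable (B i)) ->
  (forall i, (P (xi i @^-1` B i) <= (g i)%:E)%E) ->
  (P (\bigcap_(i in [set` s]) (xi i @^-1` B i)) <= (\prod_(i <- s) g i)%:E)%E.
Proof.
move=> us mB Bg; rewrite ixi//; elim: s {us} => [|i s IH].
  by rewrite !big_nil.
rewrite !big_cons EFinM lee_pmul//.
by elim: (s) => [|a l IHl]; rewrite ?big_nil ?big_cons ?mule_ge0.
Qed.

Lemma normal_le_prob_le c y : (forall y : R, 0 <= y ->
    ((c * expR (- y ^+ 2))%:E <= normal_prob 0 1 [set x : R | (y < `|x|)%R])%E) ->
  0 <= y -> forall i, (P (xi i @^-1` [set x | (`|x| <= y)%R])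
    <= (expR (- (c * expR (- y ^+ 2))))%:E)%E.
Proof.
move=> hc y0 i.
have mX := measurable_RV_preimage (xi i) (measurable_norm_gt y).
rewrite (_ : xi i @^-1` _ = ~` (xi i @^-1` [set x : R | (y < `|x|)%R])); last first.
  by apply/seteqP; split => w /=; rewrite leNgt => /negP.
rewrite probability_setC// (std_normalE (nxi i)); last exact: measurable_norm_gt.
apply: (@le_trans _ _ (1 - (c * expR (- y ^+ 2))%:E)%E); last first.
  by rewrite -EFinB lee_fin expR_ge1Dx.
by rewrite leeB// hc.
Qed.

(** The second half of Borel-Cantelli by hand: since [exp (- phi_o j ^ 2)] is [e^-1 / (j + 1)],
    independence bounds the probability of no exceedance from [n0] to [N] by [exp (- q H)], with [H]
    a block of the harmonic series. *)
Lemma ordinary_lower_ae t : \forall w \ae P, forall n0, exists2 j, (n0 <= j)%N &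
  phi_o R j < `|xi (j, Num.floor (2 ^+ j * t)) w|.
Proof.
have [c c0 hc] := normal_tail_ge R.
suff H n0 : P.-negligible [set w | forall j, (n0 <= j)%N ->
    `|xi (j, Num.floor (2 ^+ j * t)) w| <= phi_o R j].
  have := negligible_bigcup H; apply: negligibleS => w /= nw.
  apply: contrapT => nH; apply: nw => n0; apply: contrapT => hn; apply: nH.
  exists n0 => // j nj /=; rewrite leNgt; apply/negP => jw; apply: hn.
  by exists j.
apply: negligible_eps => e e0.
pose q := c * expR (- 1); have q0 : 0 < q by rewrite mulr_gt0 ?expR_gt0.
have [N hN] : exists N, (q * e)^-1 <= \sum_(n0 <= j < N) harmonic j.
  apply: contrapT => /forallNP HN; apply: (@dvg_harmonic R).
  apply: nondecreasing_is_cvgn.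
    by apply: nondecreasing_series => i _ _; exact: harmonic_ge0.
  exists (\sum_(0 <= j < n0) harmonic j + (q * e)^-1) => _ [n _ <-].
  have [n0n|nn0] := leqP n0 n.
    rewrite /series/= (@big_cat_nat _ _ _ n0)//= lerD2l.
    by have /negP := HN n; rewrite -ltNge => /ltW.
  rewrite /series/= (@big_cat_nat _ _ _ n 0 n0) ?(ltnW nn0)//= -addrA lerDl.
  have qe0 : 0 <= (q * e)^-1 by rewrite invr_ge0 mulr_ge0// ltW.
  by apply: addr_ge0 => //; apply: sumr_ge0 => i _; exact: harmonic_ge0.
pose s := [seq (j, Num.floor (2 ^+ j * t)) | j <- index_iota n0 N].
pose B (i : nat * int) := [set x : R | (`|x| <= phi_o R i.1)%R].
have mB i : measurable (B i) by exact: measurable_norm_le.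
exists (\bigcap_(i in [set` s]) (xi i @^-1` B i)); split.
- apply: fin_bigcap_measurable => [|i _]; first exact: finite_seq.
  exact: measurable_RV_preimage.
- by move=> w hw i /= /mapP[j]; rewrite mem_index_iota => /andP[nj _] ->; exact: hw.
have us : uniq s by rewrite map_inj_uniq ?iota_uniq// => i j [].
have Bg i := normal_le_prob_le hc (sqrtr_ge0 (lnw i.1%:R)) i.
apply: (le_trans (independent_prod_le us mB Bg)); rewrite lee_fin big_map.
rewrite -expR_sum /=.
have -> : \sum_(n0 <= j < N) - (c * expR (- phi_o R j ^+ 2)) =
    - (q * \sum_(n0 <= j < N) harmonic j).
  rewrite mulr_sumr -sumrN; apply: eq_bigr => j _; congr (- _).
  rewrite sqr_sqrtr; last by rewrite ltW// lnw_gt0.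
  by rewrite /lnw opprD expRD [expR (- ln _)]expRN lnK ?posrE ?ltr_pwDl// addrC natr1 mulrA.
have H1 : 0 <= q * \sum_(n0 <= j < N) harmonic j :> R.
  by rewrite mulr_ge0 ?(ltW q0)// sumr_ge0// => i _; exact: harmonic_ge0.
apply: (le_trans (expRN_le H1)).
rewrite -[leRHS]invrK lef_pV2 ?posrE ?invr_gt0//; last by lra.
apply: (@le_trans _ _ (q * \sum_(n0 <= j < N) harmonic j)); last by lra.
rewrite mulrC -ler_pdivrMr// (le_trans _ hN)//.
by rewrite -invfM [e * q]mulrC.
Qed.

(** The factor [1/2] leaves each node of level [j] a probability of at least
    [c exp (- (j + 1) / 4) >= c (3/4)^(j + 1)] to exceed. There are [2^(j - n)] nodes below a given
    interval and [2 * 3/4 > 1], so by independence one sufficiently deep generation already makes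
    failure improbable. *)
Lemma rapid_nodes_ae : \forall w \ae P, forall n m, exists j k,
  [/\ (n <= j)%N, m * 2 ^+ (j - n) <= k, k < (m + 1) * 2 ^+ (j - n) &
    2^-1 * phi_r R j < `|xi (j, k) w|].
Proof.
have [c c0 hc] := normal_tail_ge R.
pose N n m := [set w | forall j, (n <= j)%N -> forall i, (i < 2 ^ (j - n))%N ->
  `|xi (j, m * 2 ^+ (j - n) + i%:Z) w| <= 2^-1 * phi_r R j].
suff H n m : P.-negligible (N n m).
  pose N' p := if unpickle p is Some (n, m) then N n m else set0.
  have H' p : P.-negligible (N' p).
    by rewrite /N'; case: (unpickle p) => [[n m]|]; [exact: H|exact: negligible_set0].
  have := negligible_bigcup H'; apply: negligibleS => w /= nw.
  apply: contrapT => nH; apply: nw => n m; apply: contrapT => hn; apply: nH.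
  exists (pickle (n, m)) => //; rewrite /N' pickleK => j nj i ilt.
  rewrite leNgt; apply/negP => jw; apply: hn; exists j, (m * 2 ^+ (j - n) + i%:Z).
  split => //; first by rewrite lerDl.
  rewrite mulrDl mul1r ltrD2l.
  by rewrite (_ : 2 ^+ (j - n) = (2 ^ (j - n))%N :> int) ?ltz_nat// -natz natrX.
apply: negligible_eps => e e0.
pose a : R := c * (3 / 4) ^+ n.+1; have a0 : 0 < a by rewrite mulr_gt0 ?exprn_gt0.
have bern (i : nat) : 1 + i%:R / 2 <= (3 / 2) ^+ i :> R.
  elim: i => [|i IH]; first by rewrite mul0r addr0.
  rewrite exprS -natr1; have : 0 <= i%:R :> R by [].
  by nra.
have [i hi] : exists i : nat, e^-1 <= a * (3 / 2) ^+ i.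
  exists (Num.truncn (2 * (a^-1 * e^-1))).+1.
  have h1 : 0 <= 2 * (a^-1 * e^-1) by rewrite !mulr_ge0 ?invr_ge0 ?(ltW a0) ?(ltW e0).
  have := truncnS_gt (2 * (a^-1 * e^-1)); have := bern (Num.truncn (2 * (a^-1 * e^-1))).+1.
  move: ((3 / 2) ^+ _) (_.+1%:R) => X Y h2 h3.
  by rewrite -ler_pdivrMl//; lra.
pose j := (n + i)%N; have nj : (n <= j)%N by rewrite leq_addr.
have jn : (j - n)%N = i by rewrite addKn.
pose s := [seq (j, m * 2 ^+ i + l%:Z) | l <- index_iota 0 (2 ^ i)].
pose B (i : nat * int) := [set x : R | (`|x| <= 2^-1 * phi_r R i.1)%R].
have mB i' : measurable (B i') by exact: measurable_norm_le.
exists (\bigcap_(i in [set` s]) (xi i @^-1` B i)); split.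
- apply: fin_bigcap_measurable => [|i' _]; first exact: finite_seq.
  exact: measurable_RV_preimage.
- move=> w hw i' /= /mapP[l]; rewrite mem_index_iota => /andP[_ li] ->.
  by have := hw j nj l; rewrite jn; apply.
have us : uniq s.
  by rewrite map_inj_uniq ?iota_uniq// => l l' [] /addrI [].
have y0 i' : 0 <= 2^-1 * phi_r R i' by rewrite mulr_ge0 ?sqrtr_ge0.
have Bg i' := normal_le_prob_le hc (y0 i'.1) i'.
apply: (le_trans (independent_prod_le us mB Bg)); rewrite lee_fin big_map.
rewrite /= prodr_const_nat subn0 -expRM_natr exprMn sqr_sqrtr// mulNr natrX.
have H1 : e^-1 <= c * expR (- (2^-1 ^+ 2 * j.+1%:R)) * 2 ^+ i.
  apply: (le_trans hi); rewrite /a -[leLHS]mulrA -[leRHS]mulrA; apply: ler_wpM2l.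
    exact: ltW.
  have h4 : 3 / 4 <= expR (- (2^-1 ^+ 2)) :> R.
    by apply: le_trans (expR_ge1Dx _); lra.
  rewrite -mulNr expRM_natr.
  apply: (@le_trans _ _ ((3 / 4) ^+ j.+1 * 2 ^+ i)); last first.
    by rewrite ler_wpM2r ?exprn_ge0//; apply: lerXn2r; rewrite ?nnegrE ?expR_ge0; lra.
  rewrite /j -addSn exprD -mulrA -exprMn le_eqVlt; apply/orP; left; apply/eqP.
  by congr (_ * _ ^+ _); field.
have ei0 : 0 < e^-1 by rewrite invr_gt0.
apply: (le_trans (expRN_le (le_trans (ltW ei0) H1))).
by rewrite -[leRHS]invrK lef_pV2 ?posrE//; lra.
Qed.

End RandomCoefficients.

(** * Ordinary and rapid points *)

Section OrdinaryPoints.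
Variables (R : realType) (d : measure_display) (T : measurableType d).
Variables (P : probability T R) (xi : nat * int -> {RV P >-> R}).
Hypothesis nxi : forall jk, standard_normal (xi jk).
Hypothesis ixi : independent_RVs xi.
Local Notation mu := (@lebesgue_measure R).

Lemma ae_sections (N : set (T * R)) : measurable N ->
  (forall t, P.-negligible [set w | N (w, t)]) ->
  \forall w \ae P, \forall t \ae mu, ~ N (w, t).
Proof.
move=> mN N0.
have sect t : P (ysection N t) = 0%E.
  apply/negligibleP; first exact: measurable_ysection.
  by apply: negligibleS (N0 t) => w; rewrite /ysection/= inE.
have := @indic_fubini_tonelli _ _ _ _ _ P mu N mN.
rewrite indic_fubini_tonelli_FE// indic_fubini_tonelli_GE//.
under [RHS]eq_integral do rewrite /= sect.
rewrite integral0 => I0.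
have mF := measurable_fun_xsection mu mN.
have : ae_eq P setT (mu \o xsection N) (cst 0%E).
  apply/(ae_eq_integral_abs P measurableT mF).
  by rewrite -[RHS]I0; apply: eq_integral => w _; rewrite gee0_abs.
apply: filterS => w /(_ Logic.I) /= mu0.
exists (xsection N w); split => //; first exact: measurable_xsection.
by move=> t /= /contrapT Nwt; rewrite /xsection/= inE.
Qed.

(** The floor is constant on half-open dyadic intervals, so the set is a countable union of
    rectangles. This gives the joint measurability required by Fubini's theorem. *)
Lemma measurable_floor_section j (A : int -> set T) :
  (forall m, measurable (A m)) ->
  measurable [set wt : T * R | A (Num.floor (2 ^+ j * wt.2)) wt.1].
Proof.
move=> mA; pose I m := [set t : R | Num.floor (2 ^+ j * t) = m].
have p0 : 0 < 2 ^+ j :> R by rewrite exprn_gt0.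
have mI m : measurable (I m).
  rewrite (_ : I m = `[m%:~R / 2 ^+ j, (m + 1)%:~R / 2 ^+ j[%classic).
    exact: measurable_itv.
  apply/seteqP; split => t /=; rewrite in_itv/= ler_pdivrMr// ltr_pdivlMr// mulrC.
    by move=> <-; rewrite floor_le floorD1_gt.
  by move=> /floor_def.
rewrite (_ : mkset _ = (\bigcup_(n : nat) (A n%:Z `*` I n%:Z)) `|`
    (\bigcup_(n : nat) (A (- n.+1%:Z) `*` I (- n.+1%:Z)))).
  by apply: measurableU; apply: bigcup_measurable => n _; exact: measurableX.
apply/seteqP; split => [[w t] /=|[w t] /= [[n _ [/= Aw]]|[n _ [/= Aw]]]].
- rewrite /I; move E : (Num.floor _) => m; case: m E => n E Aw.
    by left; exists n.
  by right; exists n; rewrite -?NegzE.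
- by move=> ->.
- by move=> ->.
Qed.

Lemma ordinary_ae : \forall w \ae P, \forall t \ae mu,
  (exists n0, forall j, (n0 <= j)%N -> forall k,
     xi (j, k) w ^+ 2 <=
     12 * (lnw j%:R * lnw `|(k - Num.floor (2 ^+ j * t))%:~R|)) /\
  (forall n0, exists2 j, (n0 <= j)%N &
     phi_o R j < `|xi (j, Num.floor (2 ^+ j * t)) w|).
Proof.
pose A1 j m := [set w | forall k : int, xi (j, k) w ^+ 2 <=
  12 * (lnw j%:R * lnw `|(k - m)%:~R|)].
pose A2 j m := [set w | phi_o R j < `|xi (j, m) w|].
have mA1 j m : measurable (A1 j m).
  have mk k (v : R) : measurable [set w | xi (j, k) w ^+ 2 <= v].
    rewrite (_ : mkset _ = ~` (xi (j, k) @^-1` [set y : R | v < y ^+ 2])).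
      by apply: measurableC; apply: measurable_RV_preimage; exact: measurable_sqr_gt.
    by apply/seteqP; split => w /=; rewrite leNgt => /negP.
  rewrite (_ : A1 j m =
     (\bigcap_(n : nat) [set w | xi (j, n%:Z) w ^+ 2 <=
        12 * (lnw j%:R * lnw `|(n%:Z - m)%:~R|)]) `&`
     (\bigcap_(n : nat) [set w | xi (j, - n.+1%:Z) w ^+ 2 <=
        12 * (lnw j%:R * lnw `|(- n.+1%:Z - m)%:~R|)])).
    by apply: measurableI; apply: bigcapT_measurable => n; exact: mk.
  apply/seteqP; split => w /= => [H|[H1 H2] [n|n]]; first by split => n _; exact: H.
    exact: H1.
  by have := H2 n Logic.I; rewrite /= -NegzE.
have mA2 j m : measurable (A2 j m).
  exact: (measurable_RV_preimage (xi (j, m)) (measurable_norm_gt (phi_o R j))).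
pose S1 j := [set wt : T * R | A1 j (Num.floor (2 ^+ j * wt.2)) wt.1].
pose S2 j := [set wt : T * R | A2 j (Num.floor (2 ^+ j * wt.2)) wt.1].
have mS1 j : measurable (S1 j) by exact: measurable_floor_section.
have mS2 j : measurable (S2 j) by exact: measurable_floor_section.
pose D := (\bigcup_n0 \bigcap_(j in [set j | (n0 <= j)%N]) S1 j) `&`
  (\bigcap_n0 \bigcup_(j in [set j | (n0 <= j)%N]) S2 j).
have mD : measurable D.
  apply: measurableI.
    by apply: bigcup_measurable => n _; apply: bigcap_measurableType.
  by apply: bigcapT_measurable => n; apply: bigcup_measurable.
have N0 t : P.-negligible [set w | (~` D) (w, t)].
  have /(_ _) H := filterI (ordinary_upper_ae nxi t) (ordinary_lower_ae nxi ixi t).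
  apply: negligibleS H => w /= nD [[n0 H1] H2]; apply: nD; split.
    by exists n0 => // j nj; exact: H1.
  by move=> n _; have [j nj hj] := H2 n; exists j.
have := ae_sections (measurableC mD) N0; apply: filterS => w.
apply: (@filterS _ _ (ae_filter_ringOfSetsType mu)) => t /contrapT [[n0 _ D1] D2]; split.
  by exists n0 => j nj; exact: D1 nj.
by move=> n; have [j nj hj] := D2 n Logic.I; exists j.
Qed.

End OrdinaryPoints.

Lemma rapid_point {R : realType} (x : nat -> int -> R) (g : nat -> R) :
  (forall n (m : int), exists j (k : int), [/\ (n <= j)%N, m * 2 ^+ (j - n) <= k,
     k < (m + 1) * 2 ^+ (j - n) & g j < `|x j k|]) ->
  forall I : set R, open I -> I !=set0 -> exists2 t, I t &
    forall n, exists j (k : int), [/\ (n <= j)%N, `|2 ^+ j * t - k%:~R| <= 1 &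
      g j < `|x j k|].
Proof.
move=> nodes I oI I0.
(* The strict inequality makes [F n] open; the nodes [k / 2^j] themselves, which belong to it, make
   it dense. *)
pose F n := [set t : R | exists j (k : int), [/\ (n <= j)%N,
  `|2 ^+ j * t - k%:~R| < 1 & g j < `|x j k|]].
have Fod n : open (F n) /\ dense (F n).
  split.
    rewrite openE => t [j [k [nj tk gk]]]; rewrite /interior.
    near=> s; exists j, k; split => //; near: s.
    have H : (fun s : R => 2 ^+ j * s - k%:~R) @ t --> 2 ^+ j * t - k%:~R.
      by apply: cvgB; [apply: cvgMl_tmp; exact: cvg_id|exact: cvg_cst].
    by move/cvgr_norm_lt : H => /(_ _ tk).
  move=> O [t Ot] oO; have /nbhs_ballP[r /= r0 rO] := open_nbhs_nbhs (conj oO Ot).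
  have [p0 hp0] := dyadic_lt r0.
  pose p := maxn n p0.
  have hp : 2 ^- p < r.
    rewrite (le_lt_trans _ hp0)//.
    by rewrite lef_pV2 ?posrE ?exprn_gt0// ler_weXn2l// ?ler1n// leq_maxr.
  have [j [k [pj k1 k2 gk]]] := nodes p (Num.floor (2 ^+ p * t)).
  have pj0 : 0 < 2 ^+ j :> R by rewrite exprn_gt0.
  have pp0 : 0 < 2 ^+ p :> R by rewrite exprn_gt0.
  have pjp : 0 < 2 ^+ (j - p) :> R by rewrite exprn_gt0.
  exists (k%:~R / 2 ^+ j); split; last first.
    exists j, k; split => //; first exact: leq_trans (leq_maxl _ _) pj.
    by rewrite mulrCA mulfV ?gt_eqF// mulr1 subrr normr0.
  apply: rO; rewrite /ball/=; apply: lt_trans hp.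
  have f1 := floor_le (2 ^+ p * t); have f2 := floorD1_gt (2 ^+ p * t).
  move: k1 k2; rewrite -(ler_int R) -(ltr_int R) !rmorphM/= !rmorphXn/=.
  move: f1 f2; set m := Num.floor _ => f1 f2 k1 k2.
  have E : 2 ^+ j = 2 ^+ (j - p) * 2 ^+ p :> R by rewrite -exprD subnK.
  have e1 : m%:~R <= 2 ^+ p * (k%:~R / 2 ^+ j) :> R.
    rewrite E invfM mulrCA [2 ^+ p * _]mulrCA mulfV ?gt_eqF// mulr1.
    by rewrite ler_pdivlMr.
  have e2 : 2 ^+ p * (k%:~R / 2 ^+ j) < (m + 1)%:~R :> R.
    rewrite E invfM mulrCA [2 ^+ p * _]mulrCA mulfV ?gt_eqF// mulr1.
    by rewrite ltr_pdivrMr.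
  have : `|2 ^+ p * (t - k%:~R / 2 ^+ j)| < 1.
    by move: f2 e2; rewrite intrD mulrBr ltr_norml; lra.
  by rewrite normrM (gtr0_norm pp0) mulrC -ltr_pdivlMr// div1r.
have [t [It Ft]] := Baire Fod I0 oI.
exists t => // n; have [j [k [nj tk gk]]] := Ft n Logic.I.
by exists j, k; split => //; exact: ltW.
Unshelve. all: by end_near. Qed.

(** * Slow points *)

Section SecondMoment.
Variables (R : realType) (d : measure_display) (T : measurableType d).
Variable P : probability T R.

(* Chebyshev's inequality for the number of events [G i] that occur, which has
   mean [n%:R * p]. *)
Lemma second_moment_le n (G : nat -> set T) (p e : R) (c : nat -> nat -> R) :
  (0 < n)%N -> 0 < p -> (forall i, measurable (G i)) ->
  (forall i, (i < n)%N -> P (G i) = p%:E) ->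
  (forall i i', (i < n)%N -> (i' < n)%N ->
     (P (G i `&` G i') <= (p ^+ 2 * (1 + c i i'))%:E)%E) ->
  \sum_(0 <= i < n) \sum_(0 <= i' < n) c i i' <= e * n%:R ^+ 2 ->
  (P (~` \bigcup_(i in `I_n) G i) <= e%:E)%E.
Proof.
move=> n0 p0 mG PG PGG ce.
set A := \bigcup_(_ in _) _.
have mA : measurable A by apply: bigcup_measurable.
have nR : 0 < n%:R :> R by rewrite ltr0n.
pose a := (n%:R * p)^-1; have a0 : 0 < a by rewrite invr_gt0 mulr_gt0.
have mI (B : set T) : measurable B -> measurable_fun setT (fun w => (\1_B w)%:E : \bar R).
  by move=> mB; apply/measurable_EFinP; exact: measurable_indic.
have I0 (B : set T) w : (0 <= (\1_B w)%:E :> \bar R)%E by rewrite lee_fin.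
have IB (k : R) (B : set T) : 0 <= k -> measurable B ->
    (\int[P]_w (k%:E * (\1_B w)%:E) = k%:E * P B)%E.
  by move=> k0 mB; rewrite ge0_integralZl_EFin// ?integral_indic ?setIT//; exact: mI.
(* With [N] the number of events that occur, [(a N - 1)^2] is nonnegative everywhere and equals 1
   where [N = 0]. Moving [2 a N] to the left leaves nonnegative functions only. *)
pose f1 w := ((\1_(~` A) w)%:E + \sum_(0 <= i < n) (2 * a)%:E * (\1_(G i) w)%:E : \bar R)%E.
pose f2 w := (1 + \sum_(0 <= i < n) \sum_(0 <= i' < n)
  (a ^+ 2)%:E * (\1_(G i `&` G i') w)%:E : \bar R)%E.
have f12 w : (f1 w <= f2 w)%E.
  rewrite /f1 /f2.
  pose N := \sum_(0 <= i < n) \1_(G i) w : R.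
  have -> : (\sum_(0 <= i < n) (2 * a)%:E * (\1_(G i) w)%:E = (2 * a * N)%:E)%E.
    by rewrite mulr_sumr -sumEFin; apply: eq_bigr => i _; rewrite EFinM.
  have -> : (\sum_(0 <= i < n) \sum_(0 <= i' < n)
      (a ^+ 2)%:E * (\1_(G i `&` G i') w)%:E = (a ^+ 2 * (N * N))%:E)%E.
    rewrite [N * N]mulr_suml mulr_sumr -sumEFin; apply: eq_bigr => i _.
    rewrite mulr_sumr mulr_sumr -sumEFin; apply: eq_bigr => i' _.
    by rewrite indicI EFinM.
  rewrite -!EFinD lee_fin indicE; case: (boolP (w \in ~` A)) => [|_]; last first.
    by have := sqr_ge0 (a * N - 1); rewrite add0r; nra.
  rewrite inE => nA; suff -> : N = 0 by rewrite !mulr0 !addr0.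
  rewrite /N big_nat big1// => i /= ilt; rewrite indicE memNset// => Giw.
  by apply: nA; exists i.
have mk (k : R) (B : set T) : measurable B ->
    measurable_fun setT (fun w => k%:E * (\1_B w)%:E : \bar R)%E.
  by move=> mB; apply/measurable_EFinP; apply: measurable_funM => //; exact: measurable_indic.
have k0 (k : R) (B : set T) w : 0 <= k -> (0 <= k%:E * (\1_B w)%:E :> \bar R)%E.
  by move=> k0; rewrite mule_ge0.
have a2 : 0 <= 2 * a by rewrite mulr_ge0// ltW.
have aa2 : 0 <= a ^+ 2 by exact: sqr_ge0.
have mGG i i' : measurable (G i `&` G i') by exact: measurableI.
have m1 : measurable_fun setT (fun w => \sum_(0 <= i < n) (2 * a)%:E * (\1_(G i) w)%:E)%E.
  by apply: emeasurable_sum => i; exact: mk.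
have m2' i : measurable_fun setT
    (fun w => \sum_(0 <= i' < n) (a ^+ 2)%:E * (\1_(G i `&` G i') w)%:E)%E.
  by apply: emeasurable_sum => i'; exact: mk.
have m2 : measurable_fun setT (fun w => \sum_(0 <= i < n) \sum_(0 <= i' < n)
    (a ^+ 2)%:E * (\1_(G i `&` G i') w)%:E)%E.
  by apply: emeasurable_sum => i; exact: m2'.
have mf1 : measurable_fun setT f1 by apply: emeasurable_funD => //; exact/mI/measurableC.
have mf2 : measurable_fun setT f2 by apply: emeasurable_funD.
have f10 w : (0 <= f1 w)%E by rewrite adde_ge0// sume_ge0// => i _; exact: k0.
have int1 : (\int[P]_w f1 w = P (~` A) + 2%:E)%E.
  rewrite /f1 ge0_integralD//; last 2 first.
    exact/mI/measurableC.
  - by move=> w _; rewrite sume_ge0// => i _; exact: k0.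
  rewrite integral_indic ?setIT//; last exact: measurableC.
  rewrite ge0_integral_sum//; last 2 first.
    by move=> i; exact: mk.
  - by move=> i w _; exact: k0.
  congr (_ + _)%E.
  rewrite [LHS](_ : _ = \sum_(0 <= i < n) (2 * a * p)%:E)%E; last first.
    by apply: eq_big_nat => i /andP[_ ilt]; rewrite IB// PG// EFinM.
  rewrite sumEFin sumr_const_nat subn0 -mulr_natl; congr EFin.
  by rewrite /a; field; rewrite !gt_eqF.
have int2 : (\int[P]_w f2 w <= (2 + e)%:E)%E.
  rewrite /f2 ge0_integralD//; last first.
    by move=> w _; rewrite sume_ge0// => i _; rewrite sume_ge0// => i' _; exact: k0.
  have -> : (\int[P]_w 1 = 1 :> \bar R)%E.
    by have := integral_cst P measurableT (1%E : \bar R); rewrite mul1e => ->; exact: probability_setT.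
  rewrite ge0_integral_sum//; last first.
    by move=> i w _; rewrite sume_ge0// => i' _; exact: k0.
  apply: (@le_trans _ _ (1 + \sum_(0 <= i < n) \sum_(0 <= i' < n)
      (a ^+ 2 * (p ^+ 2 * (1 + c i i')))%:E)%E).
    rewrite leeD2l// !big_nat; apply: lee_sum => i ilt.
    rewrite ge0_integral_sum//; last 2 first.
      by move=> i'; exact: mk.
    - by move=> i' w _; exact: k0.
    rewrite !big_nat; apply: lee_sum => i' ilt'.
    rewrite IB// [leRHS]EFinM; apply: lee_wpmul2l => //.
    exact: PGG.
  under eq_bigr do rewrite sumEFin.
  rewrite sumEFin -EFinD lee_fin.
  under eq_bigr do rewrite -mulr_sumr -mulr_sumr big_split/= sumr_const_nat subn0.
  rewrite -mulr_sumr -mulr_sumr big_split/= sumr_const_nat subn0.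
  rewrite -[n%:R *+ n]mulr_natl mulrA -exprMn -expr2.
  have E : (a * p) ^+ 2 * n%:R ^+ 2 = 1 by rewrite /a; field; rewrite !gt_eqF.
  have := ler_wpM2l (sqr_ge0 (a * p)) ce.
  by rewrite mulrDr E mulrCA E; lra.
have := @ge0_le_integral _ _ _ P setT measurableT f1 f2 (fun w _ => f10 w) mf1 mf2
  (fun w _ => f12 w).
rewrite int1 => /le_trans/(_ int2).
by rewrite -leeBrDr// -EFinB addrAC subrr add0r.
Qed.

End SecondMoment.

Section Windows.
Variable R : realType.

Definition window (n : nat) (m : int) : seq int :=
  [seq m + (a%:Z - n%:Z) | a <- iota 0 (2 * n).+1].

Lemma mem_window n m (k : int) : (k \in window n m) = (`|k - m| <= n%:Z).
Proof.
apply/mapP/idP => [[a]|].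
  rewrite mem_iota add0n => /andP[_ a2] ->; rewrite ler_norml; lia.
rewrite ler_norml => /andP[h1 h2]; exists (absz (k - m + n%:Z)); last by lia.
by rewrite mem_iota; lia.
Qed.

Lemma window_uniq n m : uniq (window n m).
Proof. by rewrite map_inj_uniq ?iota_uniq// => a a' /= H; lia. Qed.

Lemma prod_window (f : int -> R) n m :
  \prod_(k <- window n m) f (k - m) = \prod_(k <- window n 0) f k.
Proof.
rewrite !big_map; apply: eq_bigr => a _; congr f.
by rewrite add0r addrAC subrr add0r.
Qed.

(** Weierstrass' product inequality, which replaces a union bound over a window. *)
Lemma prod_ge_oneB (I : Type) (s : seq I) (f : I -> R) :
  (forall i, 0 <= f i <= 1) -> 1 - \sum_(i <- s) (1 - f i) <= \prod_(i <- s) f i.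
Proof.
move=> f01; have P01 : 0 <= \prod_(i <- s) f i <= 1.
  elim: s => [|i s /andP[IH1 IH2]]; first by rewrite big_nil ler01 lexx.
  by have /andP[h1 h2] := f01 i; rewrite big_cons mulr_ge0//= mulr_ile1.
elim: s P01 => [|i s IH] P01; first by rewrite !big_nil subr0.
have P01' : 0 <= \prod_(i <- s) f i <= 1.
  elim: (s) => [|i' s' /andP[IH1 IH2]]; first by rewrite big_nil ler01 lexx.
  by have /andP[h1 h2] := f01 i'; rewrite big_cons mulr_ge0//= mulr_ile1.
have := IH P01'; have /andP[h1 h2] := f01 i; move/andP: P01' => [h3 h4].
by rewrite !big_cons; nra.
Qed.

(** If [j] is the last index with [c j], the product is at most [b ^+ (j - n0).+1], one of the terms
    of the sum. Linearity in [c] then allows summing over pairs of branches. *)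
Lemma prod_if_le (b : R) n0 n (c : nat -> bool) : 1 <= b ->
  \prod_(n0 <= j < n) (if c j then b else 1) <=
  1 + \sum_(n0 <= j < n) (c j)%:R * b ^+ (j - n0).+1.
Proof.
move=> b1; have b0 : 0 <= b by lra.
have [nn|] := leqP n n0.
  by rewrite !big_geq// addr0.
elim: n => // n IH; rewrite ltnS => nn.
have S0 (a : nat) : 0 <= \sum_(n0 <= j < a) (c j)%:R * b ^+ (j - n0).+1.
  by apply: sumr_ge0 => j _; rewrite mulr_ge0// exprn_ge0.
have P1 : \prod_(n0 <= j < n) (if c j then b else 1) <= b ^+ (n - n0).
  rewrite -[leRHS]prodr_const_nat; apply: ler_prod => j _.
  by case: (c j); rewrite ?b0 ?lexx ?ler01.
rewrite !big_nat_recr//=; case: (c n).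
  rewrite mul1r exprSr; have := ler_wpM2r b0 P1.
  by have := S0 n; lra.
rewrite mulr1 mul0r addr0; move: nn; rewrite leq_eqVlt => /orP[/eqP->|]; last exact: IH.
by rewrite !big_geq// addr0.
Qed.

(** The indices counted lie in [4 * r + 1] consecutive blocks of length [D]; the truncated
    subtraction in [lo] can only shorten this range. *)
Lemma sum_close_le n D r i : (0 < D)%N ->
  (\sum_(0 <= i' < n) ((i %/ D <= i' %/ D + 2 * r) && (i' %/ D <= i %/ D + 2 * r))
    <= (4 * r + 1) * D)%N.
Proof.
move=> D0; pose lo := ((i %/ D - 2 * r) * D)%N; pose hi := ((i %/ D + 2 * r).+1 * D)%N.
have lohi : (hi - lo <= (4 * r + 1) * D)%N.
  by rewrite -mulnBl leq_mul2r; apply/orP; right; lia.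
apply: leq_trans lohi.
rewrite (eq_bigr (fun i' => if (i %/ D <= i' %/ D + 2 * r) &&
    (i' %/ D <= i %/ D + 2 * r) then 1 else 0))%N; last by move=> i' _; case: ifP.
rewrite -big_mkcond sum1_count -size_filter -(size_iota lo (hi - lo)).
apply: uniq_leq_size => [|i']; first by rewrite filter_uniq// iota_uniq.
rewrite mem_filter !mem_iota => /andP[/andP[h1 h2] _].
have h3 : (lo <= i')%N.
  by apply: leq_trans (leq_divM i' D); rewrite leq_mul2r leq_subLR addnC h1 orbT.
have h4 : (i' < hi)%N.
  by apply: leq_trans (ltn_ceil i' D0) _; rewrite leq_mul2r ltnS h2 orbT.
by rewrite h3/= subnKC// ltnW// (leq_ltn_trans h3).
Qed.

End Windows.

Section SlowNodes.
Variables (R : realType) (d : measure_display) (T : measurableType d).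
Variables (P : probability T R) (xi : nat * int -> {RV P >-> R}).
Hypothesis nxi : forall jk, standard_normal (xi jk).
Hypothesis ixi : independent_RVs xi.
Local Notation nu := (normal_prob (0 : R) 1).

Definition level_event n0 n (L : nat -> seq int) (B : nat -> int -> set R) :=
  [set w | forall j k, (n0 <= j < n)%N -> k \in L j -> B j k (xi (j, k) w)].

Let level_eventE n0 n L B : level_event n0 n L B =
  \bigcap_(i in [set` [seq (j, k) | j <- index_iota n0 n, k <- L j]])
    (xi i @^-1` B i.1 i.2).
Proof.
apply/seteqP; split => w /= H.
  by move=> [j k] /= /allpairsPdep[j' [k' [+ + [-> ->]]]]; rewrite mem_index_iota; exact: H.
move=> j k jn kL; apply: (H (j, k)); apply/allpairsPdep.
by exists j, k; rewrite mem_index_iota.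
Qed.

Lemma measurable_level_event n0 n L B : (forall j k, measurable (B j k)) ->
  measurable (level_event n0 n L B).
Proof.
move=> mB; rewrite level_eventE; apply: fin_bigcap_measurable => [|i _].
  exact: finite_seq.
exact: measurable_RV_preimage.
Qed.

Lemma level_eventP n0 n L B : (forall j k, measurable (B j k)) ->
  (forall j, uniq (L j)) -> P (level_event n0 n L B) =
  (\prod_(n0 <= j < n) \prod_(k <- L j) fine (nu (B j k)))%:E.
Proof.
move=> mB uL; rewrite level_eventE (ixi (B := fun i => B i.1 i.2))//; last first.
  apply: allpairs_uniq_dep => [||[j k] [j' k'] _ _ /= []]; first exact: iota_uniq.
    by move=> j _; exact: uL.
  by move=> -> ->.
rewrite [RHS](_ : _ = (\prod_(i <- [seq (j, k) | j <- index_iota n0 n, k <- L j])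
    fine (nu (B i.1 i.2)))%:E); last by rewrite big_allpairs_dep.
elim: [seq (j, k) | j <- _, k <- _] => [|i s IH]; rewrite ?big_nil// !big_cons EFinM IH.
congr (_ * _)%E; rewrite -(std_normalE (nxi i))// fineK// fin_num_measure//.
exact: measurable_RV_preimage.
Qed.

(** The two constants are balanced: a probability of at least [4/5] per level keeps the correlation
    factor below [5/4], and [5/4 * (3/2) / 2 = 15/16 < 1]. *)
Variables (B : int -> set R) (rho : nat -> nat).
Hypothesis mB : forall k, measurable (B k).
Hypothesis rho_lt : forall j, (4 * rho j + 1)%:R <= 5 * (3 / 2) ^+ j :> R.
Hypothesis prodB : forall j, 4 / 5 <= \prod_(k <- window (rho j) 0) fine (nu (B k)).

(* The level-[j] ancestor of the [i]-th of the [2^(n-r)] dyadic intervals of length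
   [2^-n] contained in [[q 2^-r, (q+1) 2^-r]]. *)
Definition ancestor (r n : nat) (q : int) j i : int :=
  q * 2 ^+ (j - r) + (i %/ 2 ^ (n - j))%N%:Z.

Definition good_branch r n0 n q i := level_event n0 n
  (fun j => window (rho j) (ancestor r n q j i)) (fun j k => B (k - ancestor r n q j i)).

(** At a level where the windows of two branches are disjoint, independence gives exactly [p j ^ 2];
    where they meet, [p j <= 5/4 * p j ^ 2] suffices. Starting at a late level [n0] makes meetings
    rare enough for the second moment. *)
Lemma good_branch_prob r q e : 0 < e -> exists2 n0, (r <= n0)%N &
  forall n, (n0 <= n)%N ->
    (P (~` \bigcup_(i in `I_(2 ^ (n - r))) good_branch r n0 n q i) <= e%:E)%E.
Proof.
move=> e0.
(* [100 = 5 * (5/4) * 16]: from [rho_lt], from the successor in the exponent of [prod_if_le], and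
   from the sum of the powers of [15/16]. *)
have [n1 hn1] : exists n, 100 * (3 / 4) ^+ n <= e * 2 ^- r :> R.
  have er : 0 < e * 2 ^- r / 100 by rewrite !mulr_gt0// invr_gt0 exprn_gt0.
  have /cvgr0Pnorm_lt/(_ _ er) : (fun n => (3 / 4) ^+ n : R) @ \oo --> 0.
    by apply: cvg_expr; rewrite ger0_norm; lra.
  move=> [N _ hN]; exists N; have := hN N (leqnn _); rewrite /= ger0_norm ?exprn_ge0//.
  by move: (_ ^+ N) (_ * 2 ^- r) => X Y; lra.
pose n0 := maxn n1 r; have rn0 : (r <= n0)%N by exact: leq_maxr.
have hn0 : 100 * (3 / 4) ^+ n0 <= e * 2 ^- r.
  apply: le_trans hn1; rewrite ler_wpM2l//; apply: ler_wiXn2l; [lra|lra|exact: leq_maxl].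
exists n0 => // n n0n.
pose f k := fine (nu (B k)).
pose p j := \prod_(k <- window (rho j) 0) f k.
have p0 j : 4 / 5 <= p j by exact: prodB.
pose pp := \prod_(n0 <= j < n) p j.
have pp0 : 0 < pp by apply: prodr_gt0 => j _; apply: lt_le_trans (p0 j); lra.
pose a j i := ancestor r n q j i.
pose D j := (2 ^ (n - j))%N.
have D0 j : (0 < D j)%N by rewrite expn_gt0.
pose close j i i' := ((i %/ D j <= i' %/ D j + 2 * rho j) &&
  (i' %/ D j <= i %/ D j + 2 * rho j))%N.
pose c i i' := \sum_(n0 <= j < n) (close j i i')%:R * (5 / 4) ^+ (j - n0).+1 : R.
apply: (@second_moment_le _ _ _ _ _ _ pp _ c) => //.
- by rewrite expn_gt0.
- by move=> i; exact: measurable_level_event.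
- move=> i _; rewrite level_eventP//; last by move=> j; exact: window_uniq.
  by congr EFin; apply: eq_bigr => j _; rewrite (prod_window f).
- move=> i i' _ _.
  (* Where the windows meet, the constraints of the second branch are dropped, which only enlarges
     the event. *)
  pose L j := if close j i i' then window (rho j) (a j i) else
    window (rho j) (a j i) ++ window (rho j) (a j i').
  pose B' j k := if k \in window (rho j) (a j i) then B (k - a j i) else B (k - a j i').
  have disj j k : ~~ close j i i' -> k \in window (rho j) (a j i') ->
      k \notin window (rho j) (a j i).
    rewrite /close !mem_window => nc h1; apply/negP => h2; move/negP: nc; apply.
    move: h1 h2; rewrite !ler_norml /a /ancestor -/(D j).
    by move: (_ %/ _)%N (i' %/ _)%N (_ * _) => u v z; lia.
  have uL j : uniq (L j).
    rewrite /L; case: ifPn => [_|nc]; first exact: window_uniq.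
    rewrite cat_uniq; apply/and3P; split; [exact: window_uniq| |exact: window_uniq].
    by apply/hasPn => k; exact: disj.
  have mB' j k : measurable (B' j k) by rewrite /B'; case: ifP.
  apply: (@le_trans _ _ (P (level_event n0 n L B'))).
    apply: le_measure; rewrite ?inE.
    + by apply: measurableI; exact: measurable_level_event.
    + exact: measurable_level_event.
    + move=> w [/= H1 H2] j k jn; rewrite /L /B'; case: ifPn => [_ kw|nc].
        by rewrite kw; exact: H1.
      by rewrite mem_cat; case: ifPn => [kw _|_ /= kw]; [exact: H1|exact: H2].
  rewrite level_eventP// lee_fin.
  apply: (@le_trans _ _ (pp ^+ 2 * \prod_(n0 <= j < n) (if close j i i' then 5 / 4 else 1))).
    rewrite expr2 /pp -!big_split/=; apply: ler_prod => j _.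
    have fW m : \prod_(k <- window (rho j) m) f (k - m) = p j by exact: prod_window.
    have -> : \prod_(k <- L j) fine (nu (B' j k)) = if close j i i' then p j else p j * p j.
      have E1 : \prod_(k <- window (rho j) (a j i)) fine (nu (B' j k)) = p j.
        by rewrite -(fW (a j i)); apply: eq_big_seq => k kw; rewrite /B' kw.
      rewrite /L; case: ifPn => [_|nc]; first exact: E1.
      rewrite big_cat/= E1; congr (_ * _).
      rewrite -(fW (a j i')); apply: eq_big_seq => k kw.
      by rewrite /B' (negbTE (disj _ _ nc kw)).
    have := p0 j; case: ifP => _ h; nra.
  apply: ler_wpM2l; first exact: sqr_ge0.
  by apply: prod_if_le; lra.
- set M := (2 ^ (n - r))%N.
  apply: (@le_trans _ _ (\sum_(0 <= i < M) \sum_(n0 <= j < n)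
      ((4 * rho j + 1) * D j)%:R * (5 / 4) ^+ (j - n0).+1)).
    apply: ler_sum => i _; rewrite exchange_big/=; apply: ler_sum => j _.
    rewrite -mulr_suml ler_wpM2r ?exprn_ge0// -natr_sum ler_nat.
    exact: sum_close_le.
  rewrite sumr_const_nat subn0 -[_ *+ M]mulr_natl expr2 [e * _]mulrC -[leRHS]mulrA.
  apply: ler_wpM2l => //.
  have MR : M%:R = 2 ^+ n * 2 ^- r :> R.
    by rewrite /M natrX -[in RHS](subnK (leq_trans rn0 n0n)) exprD mulfK// gt_eqF ?exprn_gt0.
  have -> : M%:R * e = 2 ^+ n * (e * 2 ^- r) by rewrite MR; ring.
  apply: (@le_trans _ _ (2 ^+ n * (100 * (3 / 4) ^+ n0))); last first.
    by rewrite ler_wpM2l ?exprn_ge0.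
  apply: (@le_trans _ _ (\sum_(n0 <= j < n)
      (2 ^+ n * (25 / 4 * (3 / 4) ^+ n0)) * (15 / 16) ^+ (j - n0))).
    rewrite !big_nat; apply: ler_sum => j /andP[n0j jn].
    have D2 : (D j)%:R = 2 ^+ n * 2^-1 ^+ j :> R.
      by rewrite /D natrX -[in RHS](subnK (ltnW jn)) exprD -mulrA -exprMn mulfV// expr1n mulr1.
    rewrite natrM D2 exprS.
    have : (4 * rho j + 1)%:R * 2^-1 ^+ j <= 5 * (3 / 4) ^+ j :> R.
      apply: (@le_trans _ _ (5 * (3 / 2) ^+ j * 2^-1 ^+ j)).
        by rewrite ler_wpM2r ?exprn_ge0.
      by rewrite -mulrA -exprMn (_ : 3 / 2 * 2^-1 = 3 / 4 :> R)//; field.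
    have -> : (15 / 16 : R) = 5 / 4 * (3 / 4) by field.
    rewrite [(5 / 4 * (3 / 4)) ^+ _]exprMn.
    rewrite [in X in 5 * X](_ : (3 / 4) ^+ j = (3 / 4) ^+ (j - n0) * (3 / 4) ^+ n0); last first.
      by rewrite -exprD subnK.
    have : 0 <= 2 ^+ n * (5 / 4) ^+ (j - n0) :> R by rewrite mulr_ge0// exprn_ge0.
    move: (2 ^+ n) ((5 / 4) ^+ _) ((3 / 4) ^+ _) ((3 / 4) ^+ _) ((_ + _)%:R) (2^-1 ^+ _).
    move=> X Y Z U V S h1 /(ler_wpM2l h1); lra.
  rewrite -mulr_sumr.
  have sumle : \sum_(n0 <= j < n) (15 / 16) ^+ (j - n0) <= 16 :> R.
    rewrite -{1}[n0]add0n big_addn.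
    under eq_bigr do rewrite addnK.
    have := @sum_expr_le R (15 / 16) (n - n0).
    by rewrite (_ : (1 - 15 / 16)^-1 = 16) => [|//]; [apply; lra|field].
  have h1 : 0 <= 2 ^+ n * (25 / 4 * (3 / 4) ^+ n0) :> R by rewrite !mulr_ge0// exprn_ge0.
  by have := ler_wpM2l h1 sumle; lra.
Qed.

End SlowNodes.

Section SlowNodesAE.
Variables (R : realType) (d : measure_display) (T : measurableType d).
Variables (P : probability T R) (xi : nat * int -> {RV P >-> R}).
Hypothesis nxi : forall jk, standard_normal (xi jk).
Hypothesis ixi : independent_RVs xi.
Local Notation nu := (normal_prob (0 : R) 1).

(** A good branch cut at its last generation is still good, so the failures increase with [n] and
    their union has probability at most [e]: one [n0] serves all [n]. *)
Lemma good_branch_ae (B : int -> set R) (rho : nat -> nat) r q :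
  (forall k, measurable (B k)) ->
  (forall j, (4 * rho j + 1)%:R <= 5 * (3 / 2) ^+ j :> R) ->
  (forall j, 4 / 5 <= \prod_(k <- window (rho j) 0) fine (nu (B k))) ->
  \forall w \ae P, exists2 n0, (r <= n0)%N & forall n, (n0 <= n)%N ->
    exists2 i, (i < 2 ^ (n - r))%N & good_branch xi B rho r n0 n q i w.
Proof.
move=> mB rho_lt prodB; apply: negligible_eps => e e0.
have [n0 rn0 hn0] := good_branch_prob nxi ixi mB rho_lt prodB r q e0.
pose G n i := good_branch xi B rho r n0 n q i.
pose F n := ~` \bigcup_(i in `I_(2 ^ (n0 + n - r))) G (n0 + n)%N i.
have mF n : measurable (F n).
  apply: measurableC; apply: bigcup_measurable => i _.
  exact: measurable_level_event.
have ndF : {homo F : n m / (n <= m)%N >-> (n <= m)%O}.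
  apply/nondecreasing_seqP => n; rewrite subsetEset.
  apply: subsetC => w [i /= ilt Gi]; exists (i %/ 2)%N => /=.
    by rewrite ltn_divLR// -expnSr -subSn -?addnS// (leq_trans rn0)// leq_addr.
  move=> j k /andP[n0j jn].
  have jn' : (n0 <= j < n0 + n.+1)%N by rewrite n0j addnS (ltn_trans jn).
  have := Gi j k jn'.
  by rewrite /ancestor addnS subSn ?(ltnW jn)// expnS divnMA.
have PF : (P (\bigcup_n F n) <= e%:E)%E.
  have H := nondecreasing_cvg_mu (mu := P) mF (bigcup_measurable (fun n _ => mF n)) ndF.
  rewrite -(cvg_lim _ H)//; apply: lime_le; first exact: cvgP H.
  by apply: nearW => n; apply: hn0; rewrite leq_addr.
exists (\bigcup_n F n); split => //; first exact: bigcup_measurable.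
move=> w /= nw; apply: contrapT => nF; apply: nw; exists n0 => // n n0n.
apply: contrapT => nG; apply: nF; exists (n - n0)%N => // -[i /=].
by rewrite /G subnKC// => ilt Gi; apply: nG; exists i.
Qed.

(** Here [k] is the offset from the centre of the window. With [48 = 4 * 12] and
    [2 * expR (- 10) <= 1/512], the upper bounds fail with total probability at most [8/512], the
    lower bound with at most [2 * 1/20]; a window thus succeeds with probability at least [4/5]. *)
Definition slow_box (k : int) : set R :=
  [set x | x ^+ 2 <= 48 * lnw `|k%:~R| /\ (k = 0 -> 20^-1 < `|x|)].

Let measurable_slow_box k : measurable (slow_box k).
Proof.
rewrite (_ : slow_box k = ~` [set x : R | 48 * lnw `|k%:~R| < x ^+ 2] `&`
    (if k == 0 then [set x : R | 20^-1 < `|x|] else setT)); last first.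
  apply/seteqP; split => x /= [h1 h2]; split.
  - by apply/negP; rewrite -leNgt.
  - by case: eqP => // /h2.
  - by rewrite leNgt; exact/negP.
  - by move=> k0; move: h2; rewrite k0 eqxx.
apply: measurableI.
  by apply: measurableC; exact: measurable_sqr_gt.
by case: eqP => _; [exact: measurable_norm_gt|exact: measurableT].
Qed.

Let slow_box_prob k : 1 - fine (nu (slow_box k)) <=
  512^-1 * (1 + `|k%:~R|) ^- 2 + (k == 0)%:R / 10.
Proof.
(* Any of the variables serves to transfer the tail bounds stated for [P]. *)
pose X := xi (0%N, 0); have nX : standard_normal X := nxi _.
have mS := measurable_RV_preimage X (measurable_slow_box k).
have mA1 := measurable_RV_preimage X (measurable_sqr_gt (48 * lnw `|k%:~R|)).
have mA2 := measurable_RV_preimage X (measurable_norm_le 20^-1).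
rewrite -(std_normalE nX)//.
have SE : P (~` (X @^-1` slow_box k)) = (1 - fine (P (X @^-1` slow_box k)))%:E.
  by rewrite probability_setC// EFinB fineK// fin_num_measure.
rewrite -lee_fin -SE.
have h1 : (P (X @^-1` [set x : R | (48 * lnw `|k%:~R| < x ^+ 2)%R]) <=
    (512^-1 * (1 + `|k%:~R|) ^- 2)%:E)%E.
  have L2 : 2 <= 12 :> R by lra.
  have -> : 48 = 4 * 12 :> R by ring.
  have l1 : 1 <= lnw `|k%:~R : R| by exact: lnw_ge1.
  apply: (le_trans (sqr_tail_le nX L2 l1)); rewrite lee_fin expR_lnw//.
  have e1 := expRN1_le_half R.
  have e10 : expR (- (12 - 2)) <= 2^-1 ^+ 10 :> R.
    rewrite (_ : - (12 - 2) = - 1 * 10); last by ring.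
    by rewrite expRM_natr; apply: lerXn2r; rewrite ?nnegrE// expR_ge0.
  have i0 : 0 <= (1 + `|k%:~R : R|) ^- 2 by rewrite invr_ge0 exprn_ge0// addr_ge0.
  rewrite mulrA; apply: ler_wpM2r => //.
  apply: (@le_trans _ _ (2 * 2^-1 ^+ 10 * 1)); last first.
    by rewrite mulr1 exprVn -natrX (_ : (2 ^ 10)%N = 1024%N)//; lra.
  apply: ler_pM => //; rewrite ?mulr_ge0 ?expR_ge0//; first by rewrite ler_wpM2l.
have [k0|k0] := eqVneq k 0.
  apply: (@le_trans _ _ (P (X @^-1` [set x : R | (48 * lnw `|k%:~R| < x ^+ 2)%R] `|`
      X @^-1` [set x : R | (`|x| <= 20^-1)%R]))).
    apply: le_measure; rewrite ?inE; [exact: measurableC|exact: measurableU|].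
    move=> w /= nS; have [h|h] := ltP (48 * lnw `|k%:~R|) (X w ^+ 2); first by left.
    by right; rewrite leNgt; apply/negP => h'; apply: nS.
  apply: (le_trans (measureU2 P mA1 mA2)); rewrite EFinD; apply: leeD => //.
  have i20 : 0 <= 20^-1 :> R by rewrite invr_ge0.
  have := normal_small_le i20; rewrite -(std_normalE nX (measurable_norm_le _)).
  by move=> /le_trans; apply; rewrite lee_fin/=; lra.
rewrite mul0r addr0; apply: le_trans h1; apply: le_measure; rewrite ?inE//.
  exact: measurableC.
move=> w /= nS; rewrite ltNge; apply/negP => h; apply: nS; split => // k0'.
by rewrite k0' eqxx in k0.
Qed.

Lemma slow_nodes_ae : \forall w \ae P, forall r q, exists2 n0, (r <= n0)%N &
  forall n, (n0 <= n)%N -> exists2 i, (i < 2 ^ (n - r))%N &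
  forall j k, (n0 <= j < n)%N -> `|k - ancestor r n q j i| <= (2 ^ j./2)%N%:Z ->
    slow_box (k - ancestor r n q j i) (xi (j, k) w).
Proof.
(* Outside such a window [ln (1 + |k - m|)] dominates [j], so that there the
   almost sure bound on all the coefficients is good enough. *)
pose rho j := (2 ^ j./2)%N.
have rho_lt j : (4 * rho j + 1)%:R <= 5 * (3 / 2) ^+ j :> R.
  have h : 2 ^+ j./2 <= (3 / 2) ^+ j :> R.
    rewrite -[in leRHS](odd_double_half j) exprD -[leLHS]mul1r.
    apply: ler_pM; rewrite ?exprn_ge0//; first by apply: exprn_ege1; lra.
    by rewrite -mul2n exprM; apply: lerXn2r; rewrite ?nnegrE ?exprn_ge0//; lra.
  have h1 : 1 <= 2 ^+ j./2 :> R by apply: exprn_ege1; lra.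
  by rewrite natrD natrM /rho natrX; lra.
have prodB j : 4 / 5 <= \prod_(k <- window (rho j) 0) fine (nu (slow_box k)).
  apply: le_trans (prod_ge_oneB _ _); last first.
    move=> k; have nX : standard_normal (xi (0%N, 0)) := nxi _.
    rewrite -(std_normalE nX)// fine_ge0//=.
    have mS := measurable_RV_preimage (xi (0%N, 0)) (measurable_slow_box k).
    rewrite -lee_fin fineK; first exact: probability_le1.
    exact: fin_num_measure.
  have S1 : \sum_(k <- window (rho j) 0) (1 - fine (nu (slow_box k))) <=
      \sum_(k <- window (rho j) 0) (512^-1 * (1 + `|k%:~R|) ^- 2 + (k == 0)%:R / 10).
    by apply: ler_sum => k _; exact: slow_box_prob.
  have S0 : \sum_(k <- window (rho j) 0) (512^-1 * (1 + `|k%:~R|) ^- 2 + (k == 0)%:R / 10) =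
      512^-1 * (\sum_(k <- window (rho j) 0) (1 + `|k%:~R|) ^- 2) +
      (\sum_(k <- window (rho j) 0) (k == 0)%:R) / 10 :> R.
    by rewrite big_split/= -mulr_sumr -mulr_suml.
  have S2 : \sum_(k <- window (rho j) 0) (1 + `|k%:~R|) ^- 2 <= 8 :> R.
    apply: le_trans (sum_invsq_shift (rho j)%:R (2 * rho j).+1).
    rewrite big_map /index_iota subn0 le_eqVlt; apply/orP; left; apply/eqP.
    by apply: eq_bigr => a _; rewrite add0r distrC rmorphB.
  have S3 : \sum_(k <- window (rho j) 0) (k == 0)%:R <= 1 :> R.
    rewrite -natr_sum -[1]/(1%:R) ler_nat.
    rewrite (eq_bigr (fun k : int => if k == 0%R then 1 else 0)%N) => [|k _]; last by case: ifP.
    by rewrite -big_mkcond sum1_count count_uniq_mem ?window_uniq//; case: (_ \in _).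
  by rewrite S0 in S1; lra.
pose N rq := [set w | ~ exists2 n0, (rq.1 <= n0)%N & forall n, (n0 <= n)%N ->
  exists2 i, (i < 2 ^ (n - rq.1))%N & good_branch xi slow_box rho rq.1 n0 n rq.2 i w].
pose N' p := if unpickle p is Some rq then N rq else set0.
have H' p : P.-negligible (N' p).
  rewrite /N'; case: (unpickle p) => [rq|]; last exact: negligible_set0.
  exact: good_branch_ae.
have := negligible_bigcup H'; apply: negligibleS => w /= nw.
apply: contrapT => nH; apply: nw => r q; apply: contrapT => hn; apply: nH.
exists (pickle (r, q)) => //; rewrite /N' pickleK /N /= => -[n0 rn0 h]; apply: hn.
exists n0 => // n n0n; have [i ilt hi] := h n n0n; exists i => // j k jn kj.
by apply: hi => //; rewrite mem_window.
Qed.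

End SlowNodesAE.

(** The branches obtained for different [n] need not be nested, so their end points [u n] are only
    given a cluster point [t]. For each [j], some [u n] with [n > j] lies within [2^-j] of [t], and
    the level-[j] ancestor of that branch is within 1 of [2^j u n], hence within 2 of [2^j t]: the
    origin of the tolerance 2. *)
Lemma slow_point {R : realType} (x : nat -> int -> R) (C : R) r q :
  0 <= C -> coef_bound x C ->
  (exists2 n0, (r <= n0)%N & forall n, (n0 <= n)%N -> exists2 i, (i < 2 ^ (n - r))%N &
    forall j k, (n0 <= j < n)%N -> `|k - ancestor r n q j i| <= (2 ^ j./2)%N%:Z ->
      slow_box (k - ancestor r n q j i) (x j k)) ->
  exists2 t : R, q%:~R / 2 ^+ r <= t <= (q + 1)%:~R / 2 ^+ r &
    exists n0 A, forall j, (n0 <= j)%N -> exists2 m, `|2 ^+ j * t - m%:~R| <= 2 &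
      20^-1 < `|x j m| /\ forall k, `|x j k| <= A * lnw `|(k - m)%:~R|.
Proof.
move=> C0 xC [n0 rn0 nodes].
have /choice[i hi] n : exists i, (n0 <= n)%N -> (i < 2 ^ (n - r))%N /\
    forall j k, (n0 <= j < n)%N -> `|k - ancestor r n q j i| <= (2 ^ j./2)%N%:Z ->
      slow_box (k - ancestor r n q j i) (x j k).
  have [n0n|nn0] := leqP n0 n; last by exists 0%N.
  by have [i] := nodes n n0n; exists i.
have p0 j : 0 < 2 ^+ j :> R by rewrite exprn_gt0.
have anc n j : (n0 <= j <= n)%N -> `|2 ^+ j * ((q * 2 ^+ (n - r) + (i n)%:Z)%:~R / 2 ^+ n) -
    (ancestor r n q j (i n))%:~R| <= 1 :> R.
  move=> /andP[n0j jn]; rewrite /ancestor.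
  set D := (2 ^ (n - j))%N; have D0 : (0 < D)%N by rewrite expn_gt0.
  have DR : 0 < D%:R :> R by rewrite ltr0n.
  have -> : 2 ^+ n = D%:R * 2 ^+ j :> R by rewrite /D natrX -exprD subnK.
  have -> : (q * 2 ^+ (n - r) + (i n)%:Z)%:~R =
      D%:R * (q * 2 ^+ (j - r))%:~R + (i n)%:R :> R.
    rewrite intrD !intrM !rmorphXn/= /D natrX mulrCA -exprD; congr (_ * _ ^+ _ + _).
    lia.
  rewrite intrD; set Q := _%:~R; rewrite -pmulrn.
  have h1 : (i n %/ D)%:R * D%:R <= (i n)%:R :> R by rewrite -natrM ler_nat leq_divM.
  have h2 : (i n)%:R < (i n %/ D)%:R * D%:R + D%:R :> R.
    by rewrite -natrM -natrD ltr_nat -mulSnr ltn_ceil.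
  have -> : 2 ^+ j * ((D%:R * Q + (i n)%:R) / (D%:R * 2 ^+ j)) - (Q + (i n %/ D)%:R) =
      ((i n)%:R - (i n %/ D)%:R * D%:R) / D%:R :> R by field; rewrite !gt_eqF.
  rewrite ger0_norm; last by rewrite divr_ge0// subr_ge0.
  by rewrite ler_pdivrMr//; lra.
pose u n : R := (q * 2 ^+ (n - r) + (i n)%:Z)%:~R / 2 ^+ n.
have uI n : (n0 <= n)%N -> u n \in `[q%:~R / 2 ^+ r, (q + 1)%:~R / 2 ^+ r].
  move=> n0n; have [ilt _] := hi n n0n.
  have E : 2 ^+ n = 2 ^+ (n - r) * 2 ^+ r :> R.
    by rewrite -exprD subnK// (leq_trans rn0).
  have iR : (i n)%:R <= 2 ^+ (n - r) :> R by rewrite -natrX ler_nat ltnW.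
  have i0 : 0 <= (i n)%:R :> R by [].
  have -> : u n = (q%:~R + (i n)%:R / 2 ^+ (n - r)) / 2 ^+ r.
    rewrite /u E intrD intrM rmorphXn/= -pmulrn.
    by field; rewrite !gt_eqF.
  rewrite in_itv/= intrD !ler_pM2r ?invr_gt0// lerDl divr_ge0//=.
  by rewrite lerD2l ler_pdivrMr// mul1r.
have [t [tI tu]] : exists t, (`[q%:~R / 2 ^+ r, (q + 1)%:~R / 2 ^+ r] `&` cluster (u @ \oo)) t.
  apply: segment_compact; exists n0 => // n /= n0n; exact: uI.
(* Inside the window [7^2 >= 48] is used, outside it the square root from [coef_bound_far]. *)
exists t => //; exists n0, (7 + Num.sqrt (11 * (C * (1 + `|t|)))) => j n0j.
have [v [[n /= jn <-] tv]] : exists v, (u @` [set n | (j < n)%N] `&` ball t (2 ^- j)) v.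
  apply: tu; last by apply: nbhsx_ballx; rewrite invr_gt0.
  by exists j.+1 => // n /= jn; exists n.
have n0n : (n0 <= n)%N by exact: leq_trans n0j (ltnW jn).
have [_ hn] := hi n n0n; pose m := ancestor r n q j (i n).
have tm : `|2 ^+ j * t - m%:~R| <= 2.
  rewrite (_ : _ - _ = 2 ^+ j * (t - u n) + (2 ^+ j * u n - m%:~R)); last by ring.
  rewrite (le_trans (ler_normD _ _))// (_ : 2 = 1 + 1 :> R)//; apply: lerD; last first.
    by apply: anc; rewrite n0j ltnW.
  by rewrite normrM gtr0_norm// mulrC -ler_pdivlMr// div1r ltW.
have jn' : (n0 <= j < n)%N by rewrite n0j.
exists m => //; split.
  have := hn j m jn'; rewrite subrr normr0 => /(_ isT)[_]; exact.
move=> k; have l1 : 1 <= lnw `|(k - m)%:~R : R| by exact: lnw_ge1.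
have s0 : 0 <= Num.sqrt (11 * (C * (1 + `|t|))) :> R by exact: sqrtr_ge0.
have [near|far] := leP `|k - m| (2 ^ j./2)%N%:Z.
  have [h _] := hn j k jn' near.
  apply: (@le_trans _ _ (7 * lnw `|(k - m)%:~R|)); last by nra.
  by apply: sqr_le_norm; [lra|nra].
by apply: le_trans (coef_bound_far C0 xC tm far) _; nra.
Qed.

(** * From coefficients near a point to sharp moduli *)

Section Sharp.
Variables (R : realType) (h : R) (psi psit : R -> R) (x : nat -> int -> R) (C : R).
Hypotheses (h0 : 0 < h) (h1 : h < 1) (W : biorthogonal_wavelets psi psit).
Hypotheses (C0 : 0 <= C) (xC : coef_bound x C).

Lemma sharp_of_coefs (phi : nat -> R) (w : R -> R) t A e n0 :
  scale_profile phi -> comparable_modulus h w phi ->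
  (forall j, (n0 <= j)%N -> exists2 m, `|2 ^+ j * t - m%:~R| <= 2 &
     forall k, `|x j k| <= A * phi j * lnw `|(k - m)%:~R|) ->
  0 < e -> (forall n, exists j m, [/\ (n <= j)%N, `|2 ^+ j * t - m%:~R| <= 2 &
     e * phi j < `|x j m|]) ->
  sharp_modulus_at (wavelet_series h psi x) w t.
Proof.
move=> phiP wphi up e0 low; have [phi1 phi_nd phi_slow] := phiP.
have phi0 j : 0 <= phi j by exact: le_trans (phi1 j).
have loc1 : schwartz psi \/ compactly_supported psi.
  by case: (wavelets_localized W) => -[]; [left|right].
have loc2 : schwartz psit \/ compactly_supported psit.
  by case: (wavelets_localized W) => -[]; [left|right].
have dpsi := wavelets_derivable W.
have [D [decay lip]] := wavelet_regularity dpsi (wavelets_C1 W) loc1.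
have cpsi : continuous psi.
  by move=> y; apply: differentiable_continuous; exact/derivable1_diffP.
have atom00 : wavelet_atom psit (0, 0) = psit.
  by apply/funext => y; rewrite /wavelet_atom/= mul0r powRr0 expr0z !mul1r subr0.
have L2 : psit \in Lfun (@lebesgue_measure R) 2%:E.
  by have [L2 _ _] := wavelets_dual_riesz W; have := L2 (0, 0); rewrite atom00.
have [mpsit ipsit] := wavelet_moment L2 loc2.
apply: (sharp_modulus h0 phiP wphi).
(* The finitely many levels below [n0] are covered by the bound on all coefficients, whose factor
   [sqrt j.+1] is capped there. *)
- pose S : R := Num.sqrt (5 * C) * (1 + `|t|) * Num.sqrt n0.+1%:R.
  have S0 : 0 <= S by rewrite !mulr_ge0// ?sqrtr_ge0// addr_ge0.
  have AS : 0 <= `|A| + S by rewrite addr_ge0.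
  have [|K _ hK] := @wavelet_series_modulus R h psi x h0 h1 D decay C C0 xC lip
      t phi _ AS phi0 phi_nd phi_slow; last by exists K.
  move=> j; have lw (d : int) : 0 <= lnw `|d%:~R : R| by rewrite ltW// lnw_gt0.
  have [n0j|jn0] := leqP n0 j.
    have [m tm hm] := up j n0j; exists m => // k; apply: (le_trans (hm k)).
    apply: ler_wpM2r => //; apply: ler_wpM2r => //.
    by have := ler_norm A; lra.
  exists (Num.floor (2 ^+ j * t)) => [|k]; first by have := near_floor j t; lra.
  have tm : `|2 ^+ j * t - (Num.floor (2 ^+ j * t))%:~R| <= 2.
    by have := near_floor j t; lra.
  apply: (le_trans (coef_bound_near C0 xC k tm)); apply: ler_wpM2r => //.
  apply: (@le_trans _ _ S).
    by rewrite /S ler_wpM2l ?ler_wsqrtr ?ler_nat// ltnW.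
  have := phi1 j; have := normr_ge0 A; clearbody S; nra.
- move=> small.
  have [j0 hj0] := @coef_small_of_increments R h psi psit x h0 h1 D decay C C0 xC cpsi
    mpsit ipsit (wavelets_dual_mean0 W) (wavelets_biorthogonal W) t phi phi1 phi_nd small e e0.
  have [j [m [j0j tm]]] := low j0.
  by rewrite ltNge hj0.
Qed.

End Sharp.

Theorem theorem1p4 (R : realType) (d : measure_display) (T : measurableType d)
    (P : probability T R) (h : R) (psi psit : R -> R)
    (xi : nat * int -> {RV P >-> R}) :
  0 < h -> h < 1 ->
  biorthogonal_wavelets psi psit ->
  (forall jk : nat * int, standard_normal (xi jk)) ->
  independent_RVs xi ->
  \forall w \ae P,
    let f : R -> R := wavelet_series h psi (fun j k => xi (j, k) w) in
    forall I : set R, open I -> is_interval I -> I !=set0 ->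
      [/\ \forall t \ae (@lebesgue_measure R),
            I t -> sharp_modulus_at f (omega_o h) t,
          exists2 t : R, I t & sharp_modulus_at f (omega_r h) t
        & exists2 t : R, I t & sharp_modulus_at f (omega_s h) t].
Proof.
move=> h0 h1 W nxi ixi.
have /(_ _) H1 := filterI (coef_bound_ae nxi) (ordinary_ae nxi ixi).
have /(_ _) H2 := filterI (rapid_nodes_ae nxi ixi) (slow_nodes_ae nxi ixi).
(* The exceptional set is chosen before [I]; from here on [w] is fixed. *)
have /(_ _) := filterI H1 H2; apply: filterS => w [[[C C0 xC] ord] [rapid slow]] I oI _ I0.
pose x j k := xi (j, k) w.
have floor2 j (t : R) : `|2 ^+ j * t - (Num.floor (2 ^+ j * t))%:~R| <= 2.
  by have := near_floor j t; lra.
split.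
- move: ord; apply: (@filterS _ _ (ae_filter_ringOfSetsType _)) => t [[n0 up] low] _.
  (* [A = 4] because [4^2 >= 12] and the weight in [k], being at least 1, is below its square. *)
  apply: (sharp_of_coefs h0 h1 W C0 xC (phi_o_profile R) (omega_o_comparable h0)
    (A := 4) (e := 1) (n0 := n0)) => //.
    move=> j n0j; exists (Num.floor (2 ^+ j * t)) => // k.
    have l1 : 1 <= lnw `|(k - Num.floor (2 ^+ j * t))%:~R : R| by exact: lnw_ge1.
    have l2 : 1 <= lnw j%:R :> R by exact: lnw_ge1.
    apply: sqr_le_norm; first by rewrite !mulr_ge0 ?sqrtr_ge0//; lra.
    apply: (le_trans (up j n0j k)); rewrite !exprMn sqr_sqrtr; last by lra.
    rewrite -mulrA; move: l1 l2; set a := lnw _; set b := lnw _ => l1 l2.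
    have : b * a <= b * a ^+ 2 by rewrite ler_wpM2l ?expr2 ?ler_peMr//; lra.
    have : 0 <= b * a ^+ 2 by rewrite mulr_ge0 ?sqr_ge0//; lra.
    by lra.
  move=> n; have [j nj hj] := low n; exists j, (Num.floor (2 ^+ j * t)); split => //.
  by rewrite mul1r.
- have [t It rt] := rapid_point rapid oI I0; exists t => //.
  apply: (sharp_of_coefs h0 h1 W C0 xC (phi_r_profile R) (omega_r_comparable h0)
    (A := Num.sqrt (5 * C) * (1 + `|t|)) (e := 2^-1) (n0 := 0%N)) => //.
    move=> j _; exists (Num.floor (2 ^+ j * t)) => // k.
    exact: (coef_bound_near C0 xC k (floor2 j t)).
  move=> n; have [j [m [nj tm hm]]] := rt n; exists j, m; split => //.
  by lra.
- have [t0 It0] := I0.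
  have /nbhs_ballP[r /= r0 rI] := open_nbhs_nbhs (conj oI It0).
  have [p hp] := dyadic_lt r0.
  have [t tI [n0 [A slowt]]] :=
    slow_point C0 xC (slow p (Num.floor (2 ^+ p * t0))).
  exists t.
    apply: rI; rewrite /ball/=; apply: le_lt_trans hp.
    have p0 : 0 < 2 ^+ p :> R by rewrite exprn_gt0.
    have f1 := floor_le (2 ^+ p * t0); have f2 := floorD1_gt (2 ^+ p * t0).
    move: tI f1 f2; rewrite intrD ler_pdivrMr// ler_pdivlMr// => /andP[g1 g2] f1 f2.
    have : `|2 ^+ p * (t0 - t)| <= 1 by rewrite ler_norml mulrBr; lra.
    by rewrite normrM gtr0_norm// mulrC -ler_pdivlMr// div1r.
  apply: (sharp_of_coefs h0 h1 W C0 xC (phi_s_profile R) (omega_s_comparable h0)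
    (A := A) (e := 20^-1) (n0 := n0)) => //.
    move=> j n0j; have [m tm [_ hm]] := slowt j n0j; exists m => // k.
    by rewrite /phi_s mulr1.
  move=> n; have [m tm [hm _]] := slowt (maxn n n0) (leq_maxr _ _).
  by exists (maxn n n0), m; split; rewrite ?leq_maxl// /phi_s mulr1.
Qed.
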